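(* Let $\nu>\eta>0$ and $\mu=\sqrt{\nu^2-\eta^2}$. The following bounds hold. (i) For every $k\in\mathbb{N}$ such that $\pi\left(k-\tfrac12\right)>\underline{\psi}_{\nu,\eta}\left(x^{@}_{\mu,\eta}\right)$, $$u'_{\nu,\eta,k}<\left(\underline{\psi}_{\nu,\eta}\right)^{-1}\left(\pi\left(k-\tfrac12\right)\right).$$ (ii) For every $k\in\mathbb{N}$ such that $\pi k>\underline{\psi}_{\nu,\eta}\left(x^{@}_{\mu,\eta}\right)$, $$w'_{\nu,\eta,k}<\left(\underline{\psi}_{\nu,\eta}\right)^{-1}\left(\pi k\right).$$
   Context: $\mathbb{N}=\{1,2,\dots\}$. $J_\nu,Y_\nu$ are the standard Bessel functions of the first and second kind. For $\nu>\eta>0$ set $U_{\nu,\eta}(x):=x^{-\eta}J_\nu(x)$, $W_{\nu,\eta}(x):=x^{-\eta}Y_\nu(x)$ (ultraspherical Bessel functions); $u'_{\nu,\eta,k}$ and $w'_{\nu,\eta,k}$ denote the $k$th positive zeros (in increasing order) of the derivatives $U'_{\nu,\eta}$ and $W'_{\nu,\eta}$, respectively. With $\mu:=\sqrt{\nu^2-\eta^2}$, define for $x>\mu$ $$\underline{\psi}_{\nu,\eta}(x):=\sqrt{x^2-\mu^2}-\left(\frac{\eta^2}{2\mu}+\mu\right)\arccos\frac{\mu}{x}+\frac{\eta}{\sqrt{x^2-\mu^2}}+\frac{\pi}{4}\left(\frac{\eta^2}{\mu}+2(\mu-\nu)+1\right).$$ Its derivative vanishes at $$x^{\#}_{\mu,\eta}:=\frac12\sqrt{4\mu^2+\eta(\eta+2)+\sqrt{\eta^2(\eta+2)^2+16\mu^2\eta}}>\mu$$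 and is positive for $x>x^{\#}_{\mu,\eta}$; $\left(\underline{\psi}_{\nu,\eta}\right)^{-1}:\left(\underline{\psi}_{\nu,\eta}(x^{\#}_{\mu,\eta}),+\infty\right)\to\left(x^{\#}_{\mu,\eta},+\infty\right)$ denotes the inverse of the restriction of $\underline{\psi}_{\nu,\eta}$ to $(x^{\#}_{\mu,\eta},+\infty)$. Define, for $\mu\ge0$, $\eta>0$, the polynomial in $x$ $$\begin{aligned} r_{\mu,\eta}(x):={}&12x^{14}+x^{12}\left(-44\mu^2+4\eta(\eta^3+4\eta^2-5\eta-18)\right)\\ &+x^{10}\left(40\mu^4+8(-3\eta^3-10\eta^2+6\eta+5)\eta\mu^2-\eta^2(\eta+2)^2(4\eta^2+8\eta-3)\right)\\ &+x^8\big(40\mu^6+4(15\eta^3+40\eta^2+2\eta+70)\eta\mu^4\\ &\qquad+(20\eta^4+96\eta^3+147\eta^2+96\eta+52)\eta^2\mu^2+(\eta+2)^4\eta^4\big)\\ &+x^6\big(-100\mu^8-8\eta(10\eta^3+20\eta^2+14\eta+45)\mu^6\\ &\qquad-\eta^2(40\eta^4+144\eta^3+171\eta^2+116\eta+80)\mu^4-4\eta^5(\eta+2)^3\mu^2\big)\\ &+x^4\big(68\mu^{10}+4(15\eta^3+20\eta^2+27\eta+20)\eta\mu^8\\ &\qquad+(40\eta^4+96\eta^3+81\eta^2+24\eta+16)\eta^2\mu^6+6(\eta+2)^2\eta^6\mu^4\big)\\ &+x^2\big(-16\mu^{12}-8\eta(3\eta^3+2\eta^2+4\eta-4)\mu^{10}\\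 &\qquad-4\eta^3(5\eta^3+6\eta^2+3\eta-4)\mu^8-4\eta^7(\eta+2)\mu^6\big)\\ &+\left(4\eta^4\mu^{12}+4\eta^6\mu^{10}+\eta^8\mu^8\right), \end{aligned}$$ and let $x^{@}_{\mu,\eta}$ be its greatest positive real root (it exists, and $x^{@}_{\mu,\eta}>x^{\#}_{\mu,\eta}$). *)

(* Defs.v *)
From Stdlib Require Export Reals Factorial List ClassicalEpsilon.
From Coquelicot Require Export Coquelicot.
Open Scope R_scope.

(** Definite descriptions: [the P] is the real number satisfying [P]; it is
    meaningful only when there is exactly one. *)
Definition the (P : R -> Prop) : R := epsilon (inhabits 0) P.

(** [rGamma z] is 1 / Gamma(z), by Euler's limit
    Gamma(z) = lim_n n! n^z / (z (z+1) ... (z+n)).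
    The reciprocal is an entire function, equal to 0 at 0, -1, -2, ... *)
Definition rGamma (z : R) : R :=
  real (Lim_seq (fun n : nat =>
    prod_f_R0 (fun i => z + INR i) n / (INR (fact n) * Rpower (INR n) z))).

(** J_nu(x) = (x/2)^nu sum_m (-1)^m (x^2/4)^m / (m! Gamma(m + nu + 1)),
    for x > 0 ([Rpower] is the real power only for a positive base). *)
Definition BesselJ (nu x : R) : R :=
  Rpower (x / 2) nu *
  PSeries (fun m : nat => (-1) ^ m * rGamma (INR m + nu + 1) / INR (fact m))
          (x ^ 2 / 4).

Definition BesselY_quotient (nu x : R) : R :=
  (BesselJ nu x * cos (nu * PI) - BesselJ (- nu) x) / sin (nu * PI).

(** At an integer order, i.e. where sin (nu PI) = 0, Y_nu is the limit of the
    quotient in the order. *)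
Definition BesselY (nu x : R) : R :=
  if Req_EM_T (sin (nu * PI)) 0
  then real (Lim (fun a : R => BesselY_quotient a x) nu)
  else BesselY_quotient nu x.

Definition U (nu eta x : R) : R := Rpower x (- eta) * BesselJ nu x.
Definition W (nu eta x : R) : R := Rpower x (- eta) * BesselY nu x.

(** [z] is a zero of [f] and exactly k - 1 zeros of [f] lie in (0, z)
    (so [k] counts from 1). *)
Definition is_pos_zero (f : R -> R) (k : nat) (z : R) : Prop :=
  0 < z /\ f z = 0 /\
  exists l : list R,
    NoDup l /\ S (length l) = k /\
    forall x : R, In x l <-> (0 < x < z /\ f x = 0).

Definition u' (nu eta : R) (k : nat) : R :=
  the (is_pos_zero (Derive (U nu eta)) k).
Definition w' (nu eta : R) (k : nat) : R :=
  the (is_pos_zero (Derive (W nu eta)) k).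

Definition mu_of (nu eta : R) : R := sqrt (nu ^ 2 - eta ^ 2).

(** Used for x > mu_of nu eta only. *)
Definition psi_low (nu eta x : R) : R :=
  let mu := mu_of nu eta in
  sqrt (x ^ 2 - mu ^ 2) - (eta ^ 2 / (2 * mu) + mu) * acos (mu / x)
  + eta / sqrt (x ^ 2 - mu ^ 2)
  + PI / 4 * (eta ^ 2 / mu + 2 * (mu - nu) + 1).

Definition x_sharp (mu eta : R) : R :=
  1 / 2 * sqrt (4 * mu ^ 2 + eta * (eta + 2)
                + sqrt (eta ^ 2 * (eta + 2) ^ 2 + 16 * mu ^ 2 * eta)).

(** Inverse of the restriction of [psi_low nu eta] to (x_sharp, +oo). *)
Definition psi_low_inv (nu eta t : R) : R :=
  the (fun x => x_sharp (mu_of nu eta) eta < x /\ psi_low nu eta x = t).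

Definition r (mu eta x : R) : R :=
  12 * x ^ 14
  + x ^ 12 * (- 44 * mu ^ 2 + 4 * eta * (eta ^ 3 + 4 * eta ^ 2 - 5 * eta - 18))
  + x ^ 10 * (40 * mu ^ 4
      + 8 * (- 3 * eta ^ 3 - 10 * eta ^ 2 + 6 * eta + 5) * eta * mu ^ 2
      - eta ^ 2 * (eta + 2) ^ 2 * (4 * eta ^ 2 + 8 * eta - 3))
  + x ^ 8 * (40 * mu ^ 6
      + 4 * (15 * eta ^ 3 + 40 * eta ^ 2 + 2 * eta + 70) * eta * mu ^ 4
      + (20 * eta ^ 4 + 96 * eta ^ 3 + 147 * eta ^ 2 + 96 * eta + 52)
        * eta ^ 2 * mu ^ 2
      + (eta + 2) ^ 4 * eta ^ 4)
  + x ^ 6 * (- 100 * mu ^ 8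
      - 8 * eta * (10 * eta ^ 3 + 20 * eta ^ 2 + 14 * eta + 45) * mu ^ 6
      - eta ^ 2 * (40 * eta ^ 4 + 144 * eta ^ 3 + 171 * eta ^ 2 + 116 * eta + 80)
        * mu ^ 4
      - 4 * eta ^ 5 * (eta + 2) ^ 3 * mu ^ 2)
  + x ^ 4 * (68 * mu ^ 10
      + 4 * (15 * eta ^ 3 + 20 * eta ^ 2 + 27 * eta + 20) * eta * mu ^ 8
      + (40 * eta ^ 4 + 96 * eta ^ 3 + 81 * eta ^ 2 + 24 * eta + 16)
        * eta ^ 2 * mu ^ 6
      + 6 * (eta + 2) ^ 2 * eta ^ 6 * mu ^ 4)
  + x ^ 2 * (- 16 * mu ^ 12
      - 8 * eta * (3 * eta ^ 3 + 2 * eta ^ 2 + 4 * eta - 4) * mu ^ 10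
      - 4 * eta ^ 3 * (5 * eta ^ 3 + 6 * eta ^ 2 + 3 * eta - 4) * mu ^ 8
      - 4 * eta ^ 7 * (eta + 2) * mu ^ 6)
  + (4 * eta ^ 4 * mu ^ 12 + 4 * eta ^ 6 * mu ^ 10 + eta ^ 8 * mu ^ 8).

Definition x_at (mu eta : R) : R :=
  the (fun x => 0 < x /\ r mu eta x = 0 /\
                forall y, 0 < y -> r mu eta y = 0 -> y <= x).

(* Main.v *)
From Stdlib Require Import Lra Lia Psatz ZArith Ranalysis5.
Require Import Defs.

(** Let u = x^(eta+1) U' and v = x^(eta+1) W'. These are x J' - eta J and x Y' - eta Y, and the plane
    vector (u, v) never vanishes; its polar angle psi ([derivative_phase]) controls the zeros, since
    u = 0 where cos psi = 0 and v = 0 where sin psi = 0. With mu^2 = nu^2 - eta^2, the recurrences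
    give psi' the sign of x^2 - mu^2 ([dp_derive]). Two facts about psi remain to be found: that
    psi < pi/2 near 0, and that psi - x tends to pi/4 - nu pi/2 at infinity.

    Both come from an integral. On the contour t = p + i gd(p) of steepest descent, Hankel's integral
    has the real decaying factor exp(-x gh(p)) ([HL]). It yields, for every real order, functions [G]
    and [Y] with the recurrences of the Bessel functions ([bpair_cyl]) and explicit behaviour at
    infinity ([HL_over_Lap1]). For orders in (-1/2, 1/2] the integrand is positive, which confines the
    argument to a quadrant and gives the phase of (G, Y) ([has_phase_base]); passing to the next order
    turns the vector by an angle in (0, pi) that tends to a right angle ([has_phase_step]), and so
    does passing to the derivative ([derivative_phase_exists]). The cross product of consecutive
    vectors, a Wronskian, is a positive constant, so no branch of the angle has ever to be chosen.

    The functions of the statement are defined by power series and by Euler's limit, and are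
    identified with constant multiples of G and Y ([BesselJ_eq_G], [BesselY_eq_Y]). Bohr and
    Mollerup's argument equates Euler's limit with Euler's integral. For orders in (0, 1] the Wronskian
    of J and G vanishes at 0, so they are proportional; recurrences give the other orders. For the
    second kind, J at the orders nu and -nu must have the same factor, which the symmetry of
    Gamma(nu) Gamma(1 - nu) sin(pi nu) provides; integral orders follow by a limit in the order.

    The comparison with [psi_low] is Sturm's, for the first-order system x g' = eta g + u,
    u' = - eta/x u - (x^2 - mu^2)/x g. A suitable amplitude times sin(psi_low - c) solves the same
    system with u replaced by kappa u in the first equation, and kappa - 1 equals r divided by a
    positive quantity ([kappa_excess]). Beyond x_at, the greatest root, r is positive, so the model
    oscillates faster: psi_low gains more than pi over each half-turn of psi ([sturm_step]). Its lead
    psi_low - psi therefore increases from one half-turn to the next; as both have the same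
    asymptotics at infinity the lead tends to 0, so it must have been negative: psi_low < psi beyond
    x_at ([psi_low_lt_psi]). The root x_at lies beyond x_sharp because r(x_sharp) < 0 ([r_x_sharp]).

    Put X = psi_low_inv(t) with t = pi (k - 1/2) + beta, where beta is 0 for U and pi/2 for W. Then
    psi(X) > t, while psi starts below pi/2, so that psi takes each of the k values
    beta + pi/2 + j pi with 0 <= j < k at a point before X ([phase_zeros]). There are k zeros before X,
    and finitely many in all, so the k-th one is less than X ([kth_zero_below]). *)

(** * Integrals over the half-line *)

Lemma exp_le (x y : R) : x <= y -> exp x <= exp y.
Proof. intros [H | ->]; [left; now apply exp_increasing | apply Rle_refl]. Qed.

Lemma exp_nonneg (x : R) : 0 <= exp x.
Proof. left. apply exp_pos. Qed.

Lemma Rabs_exp (x : R) : Rabs (exp x) = exp x.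
Proof. apply Rabs_pos_eq, exp_nonneg. Qed.

(** The improper integral over the half-line, total as a function of the integrand; it has its
    meaning on the class [edom]. *)
Definition Int (f : R -> R) : R := real (Lim (fun b => RInt f 0 b) p_infty).

(** Exponential domination. Every integrand below decays at least like this, and the class, unlike
    mere convergence, is stable under the operations that occur and gives explicit tails. *)
Definition edom (f : R -> R) : Prop :=
  (forall p, continuous f p) /\
  exists M d, 0 < d /\ forall p, 0 <= p -> Rabs (f p) <= M * exp (- (d * p)).

Lemma RInt_exp_decay (M d a b : R) : 0 < d ->
  is_RInt (fun p => M * exp (- (d * p))) a b
    (M / d * exp (- (d * a)) - M / d * exp (- (d * b))).
Proof.
  intros Hd.
  evar_last.
  apply (is_RInt_derive (fun p => - (M / d) * exp (- (d * p)))).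
  - intros p _. auto_derive; [easy | field; lra].
  - intros p _. apply (ex_derive_continuous (fun p => M * exp (- (d * p)))). auto_derive; easy.
  - unfold minus, plus, opp; simpl. ring.
Qed.

Lemma continuous_RInt (f : R -> R) (a b : R) :
  (forall p, continuous f p) -> ex_RInt f a b.
Proof. intros Hf. apply (ex_RInt_continuous f). intros; apply Hf. Qed.

Lemma RInt_Chasles_R (f : R -> R) (a b c : R) :
  (forall p, continuous f p) -> RInt f a b + RInt f b c = RInt f a c.
Proof.
  intros Hf. apply (RInt_Chasles f a b c); now apply continuous_RInt.
Qed.

Lemma edom_tail (f : R -> R) (M d : R) :
  (forall p, continuous f p) -> 0 < d ->
  (forall p, 0 <= p -> Rabs (f p) <= M * exp (- (d * p))) ->
  forall a b, 0 <= a <= b -> Rabs (RInt f a b) <= M / d * exp (- (d * a)).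
Proof.
  intros Hc Hd Hb a b [Ha Hab].
  assert (HM : 0 <= M).
  { specialize (Hb 0 (Rle_refl 0)). rewrite Rmult_0_r, Ropp_0, exp_0 in Hb.
    pose proof (Rabs_pos (f 0)). lra. }
  apply Rle_trans with (M / d * exp (- (d * a)) - M / d * exp (- (d * b))).
  - apply (norm_RInt_le f (fun p => M * exp (- (d * p))) a b (RInt f a b)).
    + easy.
    + intros x Hx. apply Hb. lra.
    + apply (RInt_correct f). now apply continuous_RInt.
    + now apply RInt_exp_decay.
  - assert (0 <= M / d) by (apply Rdiv_le_0_compat; lra).
    pose proof (exp_pos (- (d * b))). nra.
Qed.

Lemma exp_decay_small (K d eps : R) : 0 < d -> 0 < eps ->
  exists b, 0 <= b /\ forall a, b <= a -> K * exp (- (d * a)) < eps.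
Proof.
  intros Hd He.
  exists (Rmax 0 (K / (eps * d))). split; [apply Rmax_l|].
  intros a Ha.
  assert (H0 : 0 <= a) by (eapply Rle_trans; [apply Rmax_l | exact Ha]).
  assert (H1 : K / (eps * d) <= a) by (eapply Rle_trans; [apply Rmax_r | exact Ha]).
  assert (Hk : K <= a * (eps * d)).
  { apply (Rmult_le_compat_r (eps * d)) in H1; [|nra].
    replace (K / (eps * d) * (eps * d)) with K in H1 by (field; nra). lra. }
  pose proof (exp_ineq1_le (d * a)).
  rewrite exp_Ropp. pose proof (exp_pos (d * a)).
  apply Rmult_lt_reg_r with (exp (d * a)); [lra|].
  rewrite Rmult_assoc, Rinv_l, Rmult_1_r by lra. nra.
Qed.

(** The partial integrals form a Cauchy family because the tails are at most M/d exp(-d a). *)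
Lemma Int_correct (f : R -> R) : edom f ->
  is_lim (fun b => RInt f 0 b) p_infty (Int f).
Proof.
  intros [Hc (M & d & Hd & Hb)].
  assert (H : exists y, filterlim (fun b => RInt f 0 b) (Rbar_locally' p_infty) (locally y)).
  { apply (proj1 (filterlim_locally_cauchy (F := Rbar_locally' p_infty) (fun b => RInt f 0 b))).
    intros eps.
    destruct (exp_decay_small (M / d) d eps Hd (cond_pos eps)) as (b & Hb0 & Hbb).
    exists (fun u => b < u). split; [now exists b|].
    assert (W : forall u v, b < u -> b < v -> u <= v -> Rabs (RInt f 0 v - RInt f 0 u) < eps).
    { intros u v Hu Hv Huv.
      replace (RInt f 0 v - RInt f 0 u) with (RInt f u v).
      2:{ pose proof (RInt_Chasles_R f 0 u v Hc). lra. }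
      eapply Rle_lt_trans; [now apply (edom_tail f M d); [..|split; [lra|]]|].
      apply Hbb; lra. }
    intros u v Hu Hv. unfold ball; simpl; unfold AbsRing_ball, abs, minus, plus, opp; simpl.
    destruct (Rle_lt_dec u v) as [Huv | Huv].
    - now apply W.
    - rewrite <- Rabs_Ropp.
      replace (- (RInt f 0 v + - RInt f 0 u)) with (RInt f 0 u - RInt f 0 v) by ring.
      apply W; lra. }
  destruct H as [y Hy].
  unfold Int. rewrite (is_lim_unique _ p_infty y); easy.
Qed.

Lemma Int_unique (f : R -> R) (l : R) :
  is_lim (fun b => RInt f 0 b) p_infty l -> Int f = l.
Proof. intros H. unfold Int. now rewrite (is_lim_unique _ _ _ H). Qed.

Lemma edom_ext (f g : R -> R) : (forall p, f p = g p) -> edom f -> edom g.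
Proof.
  intros H [Hc (M & d & Hd & Hb)]. split.
  - intros p. apply (continuous_ext f); [easy|apply Hc].
  - exists M, d. split; [easy|]. intros p Hp. rewrite <- H. now apply Hb.
Qed.

Lemma Int_ext (f g : R -> R) : (forall p, 0 <= p -> f p = g p) -> Int f = Int g.
Proof.
  intros H. unfold Int. f_equal. apply Lim_ext_loc.
  exists 0. intros b Hb. apply RInt_ext. intros p Hp.
  rewrite Rmin_left in Hp by lra. symmetry; apply H; lra.
Qed.

Lemma edom_plus (f g : R -> R) : edom f -> edom g -> edom (fun p => f p + g p).
Proof.
  intros [Hc (M & d & Hd & Hb)] [Hc' (M' & d' & Hd' & Hb')]. split.
  - intros p. apply (continuous_plus f g); [apply Hc | apply Hc'].
  - assert (HM : 0 <= M /\ 0 <= M').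
    { specialize (Hb 0 (Rle_refl 0)). specialize (Hb' 0 (Rle_refl 0)).
      rewrite Rmult_0_r, Ropp_0, exp_0 in Hb, Hb'.
      pose proof (Rabs_pos (f 0)). pose proof (Rabs_pos (g 0)). lra. }
    exists (M + M'), (Rmin d d'). split; [now apply Rmin_pos|].
    intros p Hp. eapply Rle_trans; [apply Rabs_triang|].
    rewrite Rmult_plus_distr_r. apply Rplus_le_compat.
    + eapply Rle_trans; [now apply Hb|]. apply Rmult_le_compat_l; [lra|].
      apply exp_le. pose proof (Rmin_l d d'); nra.
    + eapply Rle_trans; [now apply Hb'|]. apply Rmult_le_compat_l; [lra|].
      apply exp_le. pose proof (Rmin_r d d'); nra.
Qed.

Lemma edom_scal (c : R) (f : R -> R) : edom f -> edom (fun p => c * f p).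
Proof.
  intros [Hc (M & d & Hd & Hb)]. split.
  - intros p. apply (continuous_scal_r c f). apply Hc.
  - exists (Rabs c * M), d. split; [easy|]. intros p Hp.
    rewrite Rabs_mult, Rmult_assoc. apply Rmult_le_compat_l; [apply Rabs_pos|]. now apply Hb.
Qed.

Lemma Int_plus (f g : R -> R) : edom f -> edom g ->
  Int (fun p => f p + g p) = Int f + Int g.
Proof.
  intros Hf Hg. apply Int_unique.
  apply is_lim_ext with (fun b => RInt f 0 b + RInt g 0 b).
  - intros b. symmetry. apply (RInt_plus f g 0 b); apply continuous_RInt; [apply Hf | apply Hg].
  - apply (is_lim_plus' (fun b => RInt f 0 b) (fun b => RInt g 0 b)); now apply Int_correct.
Qed.

Lemma Int_scal (c : R) (f : R -> R) : edom f -> Int (fun p => c * f p) = c * Int f.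
Proof.
  intros Hf. apply Int_unique.
  apply is_lim_ext with (fun b => c * RInt f 0 b).
  - intros b. symmetry. apply (RInt_scal f 0 b c). apply continuous_RInt; apply Hf.
  - apply (is_lim_scal_l (fun b => RInt f 0 b) c p_infty (Int f)). now apply Int_correct.
Qed.

Lemma Int_lin (a b : R) (f g k : R -> R) : edom f -> edom g ->
  (forall p, 0 <= p -> k p = a * f p + b * g p) ->
  Int k = a * Int f + b * Int g.
Proof.
  intros Hf Hg Hk. rewrite (Int_ext k (fun p => a * f p + b * g p)) by easy.
  rewrite Int_plus, !Int_scal; try easy; now apply edom_scal.
Qed.

Lemma Int_minus (f g : R -> R) : edom f -> edom g ->
  Int (fun p => f p - g p) = Int f - Int g.
Proof.
  intros Hf Hg. rewrite (Int_lin 1 (-1) f g); try easy; intros; ring.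
Qed.

Lemma Int_le (f g : R -> R) : edom f -> edom g ->
  (forall p, 0 <= p -> f p <= g p) -> Int f <= Int g.
Proof.
  intros Hf Hg H.
  apply (is_lim_le_loc (fun b => RInt f 0 b) (fun b => RInt g 0 b) p_infty (Int f) (Int g)); [|now apply Int_correct ..].
  exists 0. intros b Hb. apply RInt_le; [lra | apply continuous_RInt, Hf | apply continuous_RInt, Hg |].
    intros p Hp. apply H; lra.
Qed.

Lemma Int_abs_le (f g : R -> R) : edom f -> edom g ->
  (forall p, 0 <= p -> Rabs (f p) <= g p) -> Rabs (Int f) <= Int g.
Proof.
  intros Hf Hg H. apply Rabs_le. split.
  - replace (- Int g) with (Int (fun p => -1 * g p)) by (rewrite Int_scal by easy; ring).
    apply Int_le; [now apply edom_scal | easy |].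
    intros p Hp. specialize (H p Hp). apply Rabs_le_between in H. lra.
  - apply Int_le; try easy. intros p Hp. eapply Rle_trans; [apply Rle_abs|]. now apply H.
Qed.

Lemma Int_derive (F f : R -> R) :
  (forall p, is_derive F p (f p)) -> edom f -> edom F -> Int f = - F 0.
Proof.
  intros HF Hf [_ (M & d & Hd & Hb)]. apply Int_unique.
  apply is_lim_ext_loc with (fun b => F b - F 0).
  - exists 0. intros b Hb0. symmetry. apply is_RInt_unique.
    apply (is_RInt_derive F f); intros; [apply HF | apply Hf].
  - replace (- F 0) with (0 - F 0) by ring.
    apply (is_lim_minus' F (fun _ => F 0) p_infty 0 (F 0)).
    2: apply is_lim_const.
    apply is_lim_spec. intros eps.
    destruct (exp_decay_small M d eps Hd (cond_pos eps)) as (b & Hb0 & Hbb).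
    exists b. intros p Hp. rewrite Rminus_0_r.
    eapply Rle_lt_trans; [apply Hb; lra|]. apply Hbb; lra.
Qed.

Lemma edom_exp (M d : R) : 0 < d -> edom (fun p => M * exp (- (d * p))).
Proof.
  intros Hd. split.
  - intros p. apply (ex_derive_continuous (fun p => M * exp (- (d * p)))). auto_derive; easy.
  - exists (Rabs M), d. split; [easy|]. intros p _.
    rewrite Rabs_mult, (Rabs_pos_eq (exp _)); [lra | apply exp_nonneg].
Qed.

Lemma Int_exp (M d : R) : 0 < d -> Int (fun p => M * exp (- (d * p))) = M / d.
Proof.
  intros Hd.
  rewrite (Int_derive (fun p => - (M / d) * exp (- (d * p)))).
  - rewrite Rmult_0_r, Ropp_0, exp_0. ring.
  - intros p. auto_derive; [easy | field; lra].
  - now apply edom_exp.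
  - now apply edom_exp.
Qed.

Lemma Int_pos (f : R -> R) : edom f -> (forall p, 0 <= p -> 0 <= f p) ->
  (forall p, 0 < p < 1 -> 0 < f p) -> 0 < Int f.
Proof.
  intros Hf Hp Hpos.
  apply Rlt_le_trans with (RInt f 0 1).
  - apply RInt_gt_0; try lra; [easy|]. intros; apply Hf.
  - apply (is_lim_le_loc (fun _ => RInt f 0 1) (fun b => RInt f 0 b) p_infty (RInt f 0 1) (Int f)); [|apply is_lim_const | now apply Int_correct].
      exists 1. intros b Hb.
      rewrite <- (RInt_Chasles_R f 0 1 b) by apply Hf.
      assert (0 <= RInt f 1 b).
      { apply RInt_ge_0; [lra | apply continuous_RInt, Hf |]. intros; apply Hp; lra. }
      lra.
Qed.

Lemma Int_ge_segment (f : R -> R) (a m : R) : edom f -> 0 <= a ->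
  (forall p, 0 <= p -> 0 <= f p) -> (forall p, 0 <= p <= a -> m <= f p) -> a * m <= Int f.
Proof.
  intros Hf Ha Hp Hm.
  apply Rle_trans with (RInt f 0 a).
  - replace (a * m) with (RInt (fun _ => m) 0 a).
    2:{ rewrite RInt_const. unfold scal; simpl; unfold mult; simpl. ring. }
    apply RInt_le; [easy | apply ex_RInt_const | apply continuous_RInt, Hf |].
    intros; apply Hm; lra.
  - apply (is_lim_le_loc (fun _ => RInt f 0 a) (fun b => RInt f 0 b) p_infty (RInt f 0 a) (Int f)); [|apply is_lim_const | now apply Int_correct].
      exists a. intros b Hb.
      rewrite <- (RInt_Chasles_R f 0 a b) by apply Hf.
      assert (0 <= RInt f a b).
      { apply RInt_ge_0; [lra | apply continuous_RInt, Hf |]. intros; apply Hp; lra. }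
      lra.
Qed.

(** * Laplace integrals *)

(** Replaces the derivatives that [auto_derive] leaves symbolic. *)
Ltac derive_with D :=
  match type of D with is_derive ?f ?x ?l =>
    repeat match goal with |- context [Derive ?g x] =>
      replace (Derive g x) with l by (symmetry; exact (is_derive_unique _ _ _ D)) end
  end.

(** Admissible weights: at most exponential growth, which the doubly exponential decay of exp(-x
    H) with H a [kernel] absorbs. *)
Definition expo (A : R -> R) : Prop :=
  (forall p, continuous A p) /\
  exists C l, 0 <= l /\ forall p, 0 <= p -> Rabs (A p) <= C * exp (l * p).

(** The exponents in use are exp, for the Gamma function, and cosh - 1/cosh, for the Bessel
    functions; the bounds are those that both satisfy. *)
Definition kernel (H : R -> R) : Prop :=
  (forall p, continuous H p) /\
  forall p, 0 <= p -> 0 <= H p /\ exp p / 2 - 1 <= H p <= exp p.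

Definition Lap (H A : R -> R) (x : R) : R := Int (fun p => exp (- (x * H p)) * A p).

Lemma expo_intro (A : R -> R) (C l : R) :
  (forall p, continuous A p) -> 0 <= l ->
  (forall p, 0 <= p -> Rabs (A p) <= C * exp (l * p)) -> expo A.
Proof. intros Hc Hl HA. split; [easy|]. now exists C, l. Qed.

Lemma expo_const (c : R) : expo (fun _ => c).
Proof.
  apply (expo_intro _ (Rabs c) 0); try lra.
  - intros p. apply continuous_const.
  - intros p _. rewrite Rmult_0_l, exp_0. lra.
Qed.

Lemma expo_plus (A B : R -> R) : expo A -> expo B -> expo (fun p => A p + B p).
Proof.
  intros [Hc (C & l & Hl & HA)] [Hc' (C' & l' & Hl' & HB)].
  assert (HC : 0 <= C /\ 0 <= C').
  { specialize (HA 0 (Rle_refl 0)). specialize (HB 0 (Rle_refl 0)).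
    rewrite Rmult_0_r, exp_0 in HA, HB.
    pose proof (Rabs_pos (A 0)). pose proof (Rabs_pos (B 0)). lra. }
  apply (expo_intro _ (C + C') (l + l')); [|lra|].
  - intros p. apply (continuous_plus A B); [apply Hc | apply Hc'].
  - intros p Hp. eapply Rle_trans; [apply Rabs_triang|].
    rewrite Rmult_plus_distr_r. apply Rplus_le_compat.
    + eapply Rle_trans; [now apply HA|]. apply Rmult_le_compat_l; [lra|]. apply exp_le. nra.
    + eapply Rle_trans; [now apply HB|]. apply Rmult_le_compat_l; [lra|]. apply exp_le. nra.
Qed.

Lemma expo_mult (A B : R -> R) : expo A -> expo B -> expo (fun p => A p * B p).
Proof.
  intros [Hc (C & l & Hl & HA)] [Hc' (C' & l' & Hl' & HB)].
  apply (expo_intro _ (C * C') (l + l')); [|lra|].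
  - intros p. apply (continuous_mult A B); [apply Hc | apply Hc'].
  - intros p Hp. rewrite Rabs_mult, Rmult_plus_distr_r, exp_plus.
    replace (C * C' * (exp (l * p) * exp (l' * p)))
      with ((C * exp (l * p)) * (C' * exp (l' * p))) by ring.
    apply Rmult_le_compat; try apply Rabs_pos; [now apply HA | now apply HB].
Qed.

Lemma expo_scal (c : R) (A : R -> R) : expo A -> expo (fun p => c * A p).
Proof. intros HA. apply expo_mult; [apply expo_const | easy]. Qed.

Lemma expo_ext (A B : R -> R) : (forall p, A p = B p) -> expo A -> expo B.
Proof.
  intros H [Hc (C & l & Hl & HA)]. apply (expo_intro _ C l); try easy.
  - intros p. now apply (continuous_ext A).
  - intros p Hp. rewrite <- H. now apply HA.
Qed.

Lemma expo_exp (C l : R) : expo (fun p => C * exp (l * p)).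
Proof.
  apply (expo_intro _ (Rabs C) (Rabs l)); [|apply Rabs_pos|].
  - intros p. apply (ex_derive_continuous (fun p => C * exp (l * p))). auto_derive; easy.
  - intros p Hp. rewrite Rabs_mult, Rabs_exp.
    apply Rmult_le_compat_l; [apply Rabs_pos|]. apply exp_le.
    apply Rmult_le_compat_r; [easy | apply Rle_abs].
Qed.

Lemma kernel_expo (H : R -> R) : kernel H -> expo H.
Proof.
  intros [Hc HH]. apply (expo_intro _ 1 1); [easy|lra|].
  intros p Hp. destruct (HH p Hp) as (H0 & _ & H1).
  rewrite Rabs_pos_eq, Rmult_1_l, Rmult_1_l; easy.
Qed.

Lemma exp_ge_sqr (p : R) : 0 <= p -> p ^ 2 / 4 <= exp p.
Proof.
  intros Hp. pose proof (exp_ineq1_le (p / 2)).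
  replace p with (p / 2 + p / 2) at 2 by field. rewrite exp_plus. nra.
Qed.

(** The exponential e^p in x H outgrows every multiple of p, here through e^p >= p^2/4 and
    completing the square. *)
Lemma Lap_edom (H A : R -> R) (x : R) : kernel H -> expo A -> 0 < x ->
  edom (fun p => exp (- (x * H p)) * A p).
Proof.
  intros [HcH HH] [Hc (C & l & Hl & HA)] Hx. split.
  - intros p. apply (continuous_mult (fun p => exp (- (x * H p))) A); [|apply Hc].
    apply (continuous_comp (fun p => - (x * H p)) exp).
    + apply (continuous_opp (fun p => x * H p)). apply (continuous_scal_r x H). apply HcH.
    + apply (ex_derive_continuous exp). auto_derive; easy.
  - exists (C * exp (x + 2 * (l + 1) ^ 2 / x)), 1. split; [lra|].
    intros p Hp. rewrite Rabs_mult, Rabs_exp.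
    destruct (HH p Hp) as (_ & H1 & _).
    apply Rle_trans with (exp (- (x * H p)) * (C * exp (l * p))).
    + apply Rmult_le_compat_l; [apply exp_nonneg | now apply HA].
    + assert (HC : 0 <= C).
      { specialize (HA 0 (Rle_refl 0)). rewrite Rmult_0_r, exp_0 in HA.
        pose proof (Rabs_pos (A 0)). lra. }
      replace (exp (- (x * H p)) * (C * exp (l * p)))
        with (C * (exp (- (x * H p)) * exp (l * p))) by ring.
      rewrite Rmult_assoc, <- !exp_plus. apply Rmult_le_compat_l; [easy|]. apply exp_le.
      pose proof (exp_ge_sqr p Hp).
      assert (x * (p ^ 2 / 8 - 1) <= x * H p) by (apply Rmult_le_compat_l; lra).
      assert (0 <= x * (p ^ 2 / 8) + 2 * (l + 1) ^ 2 / x - (l + 1) * p).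
      { replace (x * (p ^ 2 / 8) + 2 * (l + 1) ^ 2 / x - (l + 1) * p)
          with ((x * p - 4 * (l + 1)) ^ 2 / (8 * x)) by (field; lra).
        apply Rdiv_le_0_compat; [apply pow2_ge_0 | lra]. }
      lra.
Qed.

Lemma Lap_lin (H A B C : R -> R) (a b x : R) : kernel H -> expo A -> expo B -> 0 < x ->
  (forall p, 0 <= p -> C p = a * A p + b * B p) ->
  Lap H C x = a * Lap H A x + b * Lap H B x.
Proof.
  intros HH HA HB Hx HC. apply Int_lin; try now apply Lap_edom.
  intros p Hp. rewrite HC by easy. ring.
Qed.

Lemma Lap_ext (H A B : R -> R) (x : R) :
  (forall p, 0 <= p -> A p = B p) -> Lap H A x = Lap H B x.
Proof. intros HAB. apply Int_ext. intros p Hp. now rewrite HAB. Qed.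

Lemma Lap_abs_le (H A B : R -> R) (x : R) : kernel H -> expo A -> expo B -> 0 < x ->
  (forall p, 0 <= p -> Rabs (A p) <= B p) -> Rabs (Lap H A x) <= Lap H B x.
Proof.
  intros HH HA HB Hx HC. apply Int_abs_le; try now apply Lap_edom.
  intros p Hp. rewrite Rabs_mult, Rabs_exp.
  apply Rmult_le_compat_l; [apply exp_nonneg | now apply HC].
Qed.

Lemma Lap_pos (H A : R -> R) (x : R) : kernel H -> expo A -> 0 < x ->
  (forall p, 0 <= p -> 0 <= A p) -> (forall p, 0 < p < 1 -> 0 < A p) -> 0 < Lap H A x.
Proof.
  intros HH HA Hx H0 H1. apply Int_pos; [now apply Lap_edom | |].
  - intros p Hp. apply Rmult_le_pos; [apply exp_nonneg | now apply H0].
  - intros p Hp. apply Rmult_lt_0_compat; [apply exp_pos | now apply H1].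
Qed.

Lemma derive_of_quadratic (F : R -> R) (x D K r : R) : 0 < r ->
  (forall y, Rabs (y - x) < r -> Rabs (F y - F x - (y - x) * D) <= K * (y - x) ^ 2) ->
  is_derive F x D.
Proof.
  intros Hr HF. apply is_derive_Reals. intros eps Heps.
  assert (Hd : 0 < Rmin r (eps / (Rabs K + 1))).
  { apply Rmin_pos; [easy|]. apply Rdiv_lt_0_compat; [easy|]. pose proof (Rabs_pos K). lra. }
  exists (mkposreal _ Hd). intros t Ht Htd. simpl in Htd.
  specialize (HF (x + t)). replace (x + t - x) with t in HF by ring.
  assert (Rabs t < r) by (eapply Rlt_le_trans; [exact Htd | apply Rmin_l]).
  assert (Rabs t < eps / (Rabs K + 1)) by (eapply Rlt_le_trans; [exact Htd | apply Rmin_r]).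
  replace ((F (x + t) - F x) / t - D) with ((F (x + t) - F x - t * D) / t) by (field; easy).
  unfold Rdiv. rewrite Rabs_mult, Rabs_inv.
  assert (Ht' : 0 < Rabs t) by now apply Rabs_pos_lt.
  apply Rle_lt_trans with (K * t ^ 2 * / Rabs t).
  - apply Rmult_le_compat_r; [left; now apply Rinv_0_lt_compat | now apply HF].
  - replace (t ^ 2) with (Rabs t * Rabs t) by (rewrite <- Rabs_mult, Rabs_pos_eq; nra).
    replace (K * (Rabs t * Rabs t) * / Rabs t) with (K * Rabs t) by (field; lra).
    pose proof (Rle_abs K). pose proof (Rabs_pos K).
    apply Rle_lt_trans with ((Rabs K + 1) * Rabs t); [nra|].
    replace eps with ((Rabs K + 1) * (eps / (Rabs K + 1))) by (field; lra).
    apply Rmult_lt_compat_l; lra.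
Qed.

Lemma exp_taylor2 (t : R) : Rabs (exp t - 1 - t) <= t ^ 2 * exp (Rabs t).
Proof.
  pose proof (exp_ineq1_le t). pose proof (exp_ineq1_le (- t)).
  pose proof (exp_pos t). pose proof (exp_Ropp t).
  assert (exp t * exp (- t) = 1) by (rewrite exp_Ropp; field; lra).
  assert (exp t - 1 <= t * exp t) by nra.
  rewrite Rabs_pos_eq by lra.
  unfold Rabs. destruct (Rcase_abs t).
  - pose proof (exp_ineq1_le (- t)). nra.
  - nra.
Qed.

(** Differentiation under the integral sign. The Taylor remainder of the exponential is at most
    (y - x)^2 times a Laplace integral at x/2, uniformly for y within x/2 of x. *)
Lemma Lap_derive (H A : R -> R) (x : R) : kernel H -> expo A -> 0 < x ->
  is_derive (Lap H A) x (- Lap H (fun p => H p * A p) x).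
Proof.
  intros HH HA Hx.
  pose proof HA as [Hc (C & l & Hl & HAb)].
  (* The factor exp (2 p) dominates (H p)^2 in the Taylor remainder. *)
  pose (B := fun p => C * exp ((l + 2) * p)).
  assert (HB : expo B) by apply expo_exp.
  assert (HHA : expo (fun p => H p * A p)) by (apply expo_mult; [now apply kernel_expo | easy]).
  apply (derive_of_quadratic _ x _ (Lap H B (x / 2)) (x / 2)); [lra|].
  intros y Hy. apply Rabs_def2 in Hy.
  unfold Lap at 1 2 3.
  rewrite <- Int_minus by (apply Lap_edom; try easy; lra).
  replace (- Int (fun p => exp (- (x * H p)) * (H p * A p)))
    with (Int (fun p => -1 * (exp (- (x * H p)) * (H p * A p))))
    by (rewrite Int_scal; [ring | now apply Lap_edom]).
  set (f := fun p => exp (- (y * H p)) * A p - exp (- (x * H p)) * A p).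
  set (g := fun p => -1 * (exp (- (x * H p)) * (H p * A p))).
  assert (Hf : edom f).
  { apply edom_ext with (fun p => exp (- (y * H p)) * A p + -1 * (exp (- (x * H p)) * A p)).
    - intros p. unfold f. ring.
    - apply edom_plus; [apply Lap_edom; try easy; lra|]. apply edom_scal, Lap_edom; easy. }
  assert (Hg : edom g) by (apply edom_scal, Lap_edom; easy).
  replace (Int f - (y - x) * Int g) with (Int (fun p => f p + (- (y - x)) * g p)).
  2:{ rewrite (Int_lin 1 (- (y - x)) f g); try easy; intros; ring. }
  unfold Lap. rewrite Rmult_comm, <- Int_scal by (apply Lap_edom; try easy; lra).
  apply Int_abs_le.
  - apply edom_plus; [easy | now apply edom_scal].
  - apply edom_scal, Lap_edom; try easy; lra.
  - intros p Hp. unfold f, g, B.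
    destruct HH as [_ HH]. destruct (HH p Hp) as (H0 & _ & H2).
    set (t := - ((y - x) * H p)).
    replace (exp (- (y * H p))) with (exp (- (x * H p)) * exp t)
      by (rewrite <- exp_plus; f_equal; unfold t; ring).
    replace (exp (- (x * H p)) * exp t * A p - exp (- (x * H p)) * A p +
             - (y - x) * (-1 * (exp (- (x * H p)) * (H p * A p))))
      with (exp (- (x * H p)) * ((exp t - 1 - t) * A p)) by (unfold t; ring).
    rewrite !Rabs_mult, Rabs_exp.
    assert (Ht : Rabs t <= x / 2 * H p).
    { unfold t. apply Rabs_le. nra. }
    assert (Ht2 : t ^ 2 <= (y - x) ^ 2 * (exp p * exp p)).
    { unfold t. replace ((- ((y - x) * H p)) ^ 2) with ((y - x) ^ 2 * (H p * H p)) by ring.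
      apply Rmult_le_compat_l; [apply pow2_ge_0|]. apply Rmult_le_compat; lra. }
    apply Rle_trans with
      (exp (- (x * H p)) * (((y - x) ^ 2 * (exp p * exp p) * exp (x / 2 * H p)) * (C * exp (l * p)))).
    + apply Rmult_le_compat_l; [apply exp_nonneg|].
      apply Rmult_le_compat; try apply Rabs_pos; [|now apply HAb].
      eapply Rle_trans; [apply exp_taylor2|].
      apply Rmult_le_compat; [apply pow2_ge_0 | apply exp_nonneg | easy | now apply exp_le].
    + right. replace ((l + 2) * p) with (p + p + l * p) by ring.
      replace (- (x / 2 * H p)) with (- (x * H p) + x / 2 * H p) by field.
      rewrite !exp_plus. ring.
Qed.

Lemma Lap_by_parts (H h1 F f : R -> R) (x : R) :
  kernel H -> expo F -> expo f -> expo h1 -> 0 < x ->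
  (forall p, is_derive H p (h1 p)) -> (forall p, is_derive F p (f p)) -> F 0 = 0 ->
  Lap H f x = x * Lap H (fun p => h1 p * F p) x.
Proof.
  intros HH HF Hf Hh1 Hx HdH HdF HF0.
  assert (HhF : expo (fun p => h1 p * F p)) by now apply expo_mult.
  enough (E : Int (fun p => exp (- (x * H p)) * f p + - x * (exp (- (x * H p)) * (h1 p * F p)))
    = - (exp (- (x * H 0)) * F 0)).
  { rewrite Int_plus, Int_scal in E.
    - unfold Lap. rewrite HF0 in E. lra.
    - now apply Lap_edom.
    - now apply Lap_edom.
    - now apply edom_scal, Lap_edom. }
  apply (Int_derive (fun p => exp (- (x * H p)) * F p)).
  - intros p. pose proof (HdH p) as DH. pose proof (HdF p) as DF.
    auto_derive.
    + split; [now exists (h1 p)|]. split; [now exists (f p)|easy].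
    + derive_with DH. derive_with DF. ring.
  - apply edom_plus; [now apply Lap_edom | now apply edom_scal, Lap_edom].
  - now apply Lap_edom.
Qed.

(** The inequality u^s <= (s/e)^s e^u in logarithmic form: the tangent to ln at s. *)
Lemma mul_ln_le (s u : R) : 0 < s -> 0 < u -> s * ln u <= u + s * (ln s - 1).
Proof.
  intros Hs Hu.
  assert (H : ln (u / s) <= u / s - 1).
  { pose proof (exp_ineq1_le (ln (u / s))). rewrite exp_ln in H; [lra|]. now apply Rdiv_lt_0_compat. }
  rewrite ln_div in H by easy.
  assert (s * (ln u - ln s) <= s * (u / s - 1)) by (apply Rmult_le_compat_l; lra).
  replace (s * (u / s - 1)) with (u - s) in H0 by (field; lra). lra.
Qed.

(** As x tends to 0 the integrand lives up to p of order ln(1/x), so that a weight of size e^(l p)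
    contributes about x^(-l); any exponent s above l leaves room for an elementary estimate. *)
Lemma Lap_small (H A : R -> R) (C l s : R) : kernel H -> expo A -> 0 <= l < s ->
  (forall p, 0 <= p -> Rabs (A p) <= C * exp (l * p)) ->
  exists K, 0 <= K /\ forall x, 0 < x <= 1 -> Rabs (Lap H A x) <= K * Rpower x (- s).
Proof.
  intros HH HA Hls HC.
  assert (HC0 : 0 <= C).
  { specialize (HC 0 (Rle_refl 0)). rewrite Rmult_0_r, exp_0 in HC.
    pose proof (Rabs_pos (A 0)). lra. }
  set (k := 1 + s * (ln s - 1) + s * ln 2).
  exists (C * exp k / (s - l)). split.
  { apply Rdiv_le_0_compat; [|lra]. apply Rmult_le_pos; [easy | apply exp_nonneg]. }
  intros x Hx.
  replace (C * exp k / (s - l) * Rpower x (- s)) with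
    (Int (fun p => (C * exp k * Rpower x (- s)) * exp (- ((s - l) * p))))
    by (rewrite Int_exp by lra; field; lra).
  apply Int_abs_le; [apply Lap_edom; try easy; lra | apply edom_exp; lra |].
  intros p Hp. rewrite Rabs_mult, Rabs_exp.
  apply Rle_trans with (exp (- (x * H p)) * (C * exp (l * p))).
  { apply Rmult_le_compat_l; [apply exp_nonneg | now apply HC]. }
  unfold Rpower.
  replace (exp (- (x * H p)) * (C * exp (l * p))) with (C * (exp (- (x * H p)) * exp (l * p))) by ring.
  rewrite !Rmult_assoc, <- !exp_plus. apply Rmult_le_compat_l; [easy|]. apply exp_le.
  destruct HH as [_ HH]. destruct (HH p Hp) as (_ & H1 & _).
  assert (Hu : 0 < x / 2 * exp p) by (apply Rmult_lt_0_compat; [lra | apply exp_pos]).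
  assert (Hs : 0 < s) by lra.
  pose proof (mul_ln_le s (x / 2 * exp p) Hs Hu) as HR.
  rewrite ln_mult, ln_exp, ln_div in HR by (try apply exp_pos; lra).
  assert (x * (exp p / 2 - 1) <= x * H p) by (apply Rmult_le_compat_l; lra).
  unfold k. lra.
Qed.

(** As x grows the integral concentrates at p = 0. The comparison function h1 exp(-(x-1) H) is an
    exact derivative, with integral 1/(x-1), and the exponential growth of the weight is paid for
    by the unit of x that is given up. *)
Lemma Lap_large (H h1 A : R -> R) (C l : R) : kernel H -> expo A -> expo h1 -> 0 <= l ->
  (forall p, is_derive H p (h1 p)) -> H 0 = 0 -> (forall p, 0 <= p -> p <= h1 p) ->
  (forall p, 0 <= p -> Rabs (A p) <= C * p * exp (l * p)) ->
  exists K, 0 <= K /\ forall x, 2 <= x -> Rabs (Lap H A x) <= K / (x - 1).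
Proof.
  intros HH HA Hh1 Hl HdH HH0 Hp1 HAb.
  assert (HC0 : 0 <= C).
  { specialize (HAb 1 Rle_0_1). pose proof (Rabs_pos (A 1)). pose proof (exp_pos (l * 1)). nra. }
  (* From H p >= p^2 / 8 - 1, the quantity l p - H p is at most k. *)
  set (k := 1 + 2 * l ^ 2).
  exists (C * exp k). split; [apply Rmult_le_pos; [easy | apply exp_nonneg]|].
  intros x Hx.
  assert (Hh : edom (fun p => exp (- ((x - 1) * H p)) * h1 p)) by (apply Lap_edom; try easy; lra).
  assert (E : Int (fun p => exp (- ((x - 1) * H p)) * h1 p) = / (x - 1)).
  { rewrite (Int_derive (fun p => exp (- ((x - 1) * H p)) * - / (x - 1))).
    - rewrite HH0, Rmult_0_r, Ropp_0, exp_0. ring.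
    - intros p. pose proof (HdH p) as DH. auto_derive.
      + now exists (h1 p).
      + derive_with DH. field; lra.
    - easy.
    - apply Lap_edom; try easy; [apply expo_const | lra]. }
  replace (C * exp k / (x - 1)) with (Int (fun p => C * exp k * (exp (- ((x - 1) * H p)) * h1 p)))
    by (rewrite Int_scal, E by easy; field; lra).
  apply Int_abs_le; [apply Lap_edom; try easy; lra | now apply edom_scal |].
  intros p Hp. rewrite Rabs_mult, Rabs_exp.
  apply Rle_trans with (exp (- (x * H p)) * (C * p * exp (l * p))).
  { apply Rmult_le_compat_l; [apply exp_nonneg | now apply HAb]. }
  replace (exp (- (x * H p)) * (C * p * exp (l * p)))
    with (C * (exp (- (x * H p)) * exp (l * p) * p)) by ring.
  replace (C * exp k * (exp (- ((x - 1) * H p)) * h1 p))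
    with (C * (exp k * exp (- ((x - 1) * H p)) * h1 p)) by ring.
  apply Rmult_le_compat_l; [easy|]. rewrite <- !exp_plus.
  apply Rmult_le_compat; [apply exp_nonneg | easy | | now apply Hp1].
  apply exp_le. destruct HH as [_ HH]. destruct (HH p Hp) as (_ & H1 & _).
  pose proof (exp_ge_sqr p Hp). unfold k.
  assert (0 <= p ^ 2 / 8 - l * p + 2 * l ^ 2) by (pose proof (pow2_ge_0 (p - 4 * l)); lra). lra.
Qed.

(** * The contour of steepest descent *)

Lemma cosh_ge_1 (p : R) : 1 <= cosh p.
Proof.
  unfold cosh. rewrite exp_Ropp. pose proof (exp_pos p).
  apply Rmult_le_reg_r with (2 * exp p); [lra|].
  replace ((exp p + / exp p) / 2 * (2 * exp p)) with (exp p ^ 2 + 1) by (field; lra).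
  pose proof (pow2_ge_0 (exp p - 1)). lra.
Qed.

Lemma cosh_sqr (p : R) : cosh p ^ 2 = 1 + sinh p ^ 2.
Proof.
  unfold cosh, sinh. rewrite exp_Ropp. field. pose proof (exp_pos p); lra.
Qed.

Lemma is_derive_cosh (p : R) : is_derive cosh p (sinh p).
Proof. apply is_derive_Reals, derivable_pt_lim_cosh. Qed.

Lemma is_derive_sinh (p : R) : is_derive sinh p (cosh p).
Proof. apply is_derive_Reals, derivable_pt_lim_sinh. Qed.

(** The contour t = p + i gd(p), with gd the Gudermannian function: there cosh t = 1 + i gh(p), so
    that e^(i x cosh t) = e^(ix) e^(-x gh(p)) decays without oscillating (steepest descent for the
    Hankel functions). Also dt/dp = 1 + i gs(p), and gh1 is the derivative of gh. *)
Definition gs (p : R) : R := / cosh p.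
Definition gh (p : R) : R := cosh p - / cosh p.
Definition gh1 (p : R) : R := sinh p * (1 + gs p ^ 2).
Definition gd (p : R) : R := atan (sinh p).

Lemma cos_gd (p : R) : cos (gd p) = gs p.
Proof.
  unfold gd, gs. rewrite cos_atan. unfold Rsqr.
  replace (1 + sinh p * sinh p) with (cosh p ^ 2) by (rewrite cosh_sqr; ring).
  rewrite <- Rsqr_pow2, sqrt_Rsqr; [field|]; pose proof (cosh_ge_1 p); lra.
Qed.

Lemma sin_gd (p : R) : sin (gd p) = sinh p * gs p.
Proof.
  unfold gd, gs. rewrite sin_atan. unfold Rsqr.
  replace (1 + sinh p * sinh p) with (cosh p ^ 2) by (rewrite cosh_sqr; ring).
  rewrite <- Rsqr_pow2, sqrt_Rsqr; [easy|]; pose proof (cosh_ge_1 p); lra.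
Qed.

Lemma is_derive_gd (p : R) : is_derive gd p (gs p).
Proof.
  unfold gd, gs. pose proof (is_derive_sinh p) as D.
  pose proof (cosh_ge_1 p).
  evar_last.
  - apply (is_derive_comp atan sinh p).
    + apply is_derive_Reals. apply derivable_pt_lim_atan.
    + exact D.
  - unfold scal; simpl; unfold mult; simpl. unfold Rsqr.
    replace (1 + sinh p * (sinh p * 1)) with (cosh p ^ 2) by (rewrite cosh_sqr; ring).
    field. lra.
Qed.

Lemma is_derive_gs (p : R) : is_derive gs p (- sinh p * gs p ^ 2).
Proof.
  unfold gs. pose proof (is_derive_cosh p) as D. pose proof (cosh_ge_1 p).
  auto_derive; [lra|]. field. lra.
Qed.

Lemma is_derive_gh (p : R) : is_derive gh p (gh1 p).
Proof.
  unfold gh, gh1, gs. pose proof (is_derive_cosh p) as D. pose proof (cosh_ge_1 p).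
  auto_derive; [lra|]. field. lra.
Qed.

Lemma gh_0 : gh 0 = 0.
Proof. unfold gh. rewrite cosh_0. field. Qed.

Lemma continuous_of_derive (f f' : R -> R) :
  (forall p, is_derive f p (f' p)) -> forall p, continuous f p.
Proof. intros H p. apply (ex_derive_continuous f). now exists (f' p). Qed.

Lemma MVT_derive (f f' : R -> R) (a b : R) : a <= b ->
  (forall x, a <= x <= b -> is_derive f x (f' x)) ->
  exists c, a <= c <= b /\ f b - f a = f' c * (b - a).
Proof.
  intros Hab Hd. destruct (MVT_gen f a b f') as (c & Hc & E).
  - intros x Hx. rewrite Rmin_left, Rmax_right in Hx by easy. apply Hd; lra.
  - intros x Hx. rewrite Rmin_left, Rmax_right in Hx by easy.
    apply continuity_pt_filterlim. apply (ex_derive_continuous f). exists (f' x). now apply Hd.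
  - rewrite Rmin_left, Rmax_right in Hc by easy. now exists c.
Qed.

Lemma sinh_ge (p : R) : 0 <= p -> p <= sinh p.
Proof.
  intros Hp. destruct (MVT_derive sinh cosh 0 p Hp) as (c & Hc & E).
  - intros x _. apply is_derive_sinh.
  - rewrite sinh_0, !Rminus_0_r in E. pose proof (cosh_ge_1 c). nra.
Qed.

Lemma sinh_le (p : R) : 0 <= p <= 1 -> sinh p <= 2 * p.
Proof.
  intros Hp. unfold sinh. pose proof (exp_ineq1_le (- p)).
  destruct (MVT_derive exp exp 0 p (proj1 Hp)) as (c & Hc & E).
  - intros x _. apply is_derive_exp.
  - rewrite exp_0 in E. pose proof exp_le_3. assert (exp c <= exp 1) by (apply exp_le; lra).
    nra.
Qed.

Lemma cosh_le_exp (p : R) : 0 <= p -> cosh p <= exp p.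
Proof. intros Hp. unfold cosh. assert (exp (- p) <= exp p) by (apply exp_le; lra). lra. Qed.

Lemma gs_range (p : R) : 0 < gs p <= 1.
Proof.
  unfold gs. pose proof (cosh_ge_1 p). split; [apply Rinv_0_lt_compat; lra|].
  rewrite <- Rinv_1. apply Rinv_le_contravar; lra.
Qed.

Lemma gh1_ge (p : R) : 0 <= p -> p <= gh1 p.
Proof.
  intros Hp. unfold gh1. pose proof (sinh_ge p Hp). pose proof (pow2_ge_0 (gs p)). nra.
Qed.

Lemma gh_le (p : R) : 0 <= p <= 1 -> gh p <= 4 * p ^ 2.
Proof.
  intros Hp. pose proof (sinh_le p Hp). pose proof (sinh_ge p (proj1 Hp)).
  replace (gh p) with (sinh p ^ 2 * gs p).
  - pose proof (gs_range p). assert (sinh p ^ 2 <= (2 * p) ^ 2) by (apply pow_incr; lra).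
    assert (0 <= sinh p ^ 2) by apply pow2_ge_0. nra.
  - unfold gh, gs. pose proof (cosh_ge_1 p).
    replace (sinh p ^ 2) with (cosh p ^ 2 - 1) by (rewrite cosh_sqr; ring). field. lra.
Qed.

Lemma kernel_gh : kernel gh.
Proof.
  split; [exact (continuous_of_derive _ _ is_derive_gh)|].
  intros p Hp. unfold gh. pose proof (gs_range p) as Hs. unfold gs in Hs.
  pose proof (cosh_ge_1 p). pose proof (cosh_le_exp p Hp). repeat split; try lra.
  unfold cosh at 1. pose proof (exp_pos (- p)). lra.
Qed.

Lemma expo_bounded (f : R -> R) : (forall p, continuous f p) ->
  (forall p, Rabs (f p) <= 1) -> expo f.
Proof.
  intros Hc Hb. apply (expo_intro _ 1 0); [easy | lra |].
  intros p _. rewrite Rmult_0_l, exp_0, Rmult_1_r. apply Hb.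
Qed.

Lemma expo_gs : expo gs.
Proof.
  apply expo_bounded; [exact (continuous_of_derive _ _ is_derive_gs) |].
  intros p. pose proof (gs_range p). rewrite Rabs_pos_eq; lra.
Qed.

Lemma expo_sinh : expo sinh.
Proof.
  apply (expo_intro _ 1 1); [exact (continuous_of_derive _ _ is_derive_sinh) | lra |].
  intros p Hp. pose proof (sinh_ge p Hp). pose proof (cosh_le_exp p Hp).
  assert (sinh p < cosh p) by (unfold sinh, cosh; pose proof (exp_pos (- p)); lra).
  rewrite Rabs_pos_eq, !Rmult_1_l; lra.
Qed.

Lemma expo_gs_sqr : expo (fun p => gs p ^ 2).
Proof. apply expo_ext with (fun p => gs p * gs p); [intros; ring | apply expo_mult; apply expo_gs]. Qed.

Lemma expo_gh1 : expo gh1.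
Proof.
  apply (expo_mult sinh (fun p => 1 + gs p ^ 2)); [apply expo_sinh|].
  apply (expo_plus (fun _ => 1)); [apply expo_const | apply expo_gs_sqr].
Qed.

Lemma expo_minus (A B : R -> R) : expo A -> expo B -> expo (fun p => A p - B p).
Proof.
  intros HA HB. apply expo_ext with (fun p => A p + -1 * B p); [intros; ring|].
  apply expo_plus; [easy | now apply expo_scal].
Qed.

(** On the contour, [expt c l p] is the real part of e^(-ic) e^(l t), and [expdt c l p] that of
    e^(-ic) e^(l t) dt/dp. The angle c makes one family out of the real and the imaginary part. *)
Definition expt (c l p : R) : R := exp (l * p) * cos (c - l * gd p).
Definition expdt (c l p : R) : R :=
  exp (l * p) * (cos (c - l * gd p) + gs p * sin (c - l * gd p)).

(** Likewise e^(-ic) cosh(nu t) dt/dp and e^(-ic) sinh(nu t). *)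
Definition coshdt (c nu p : R) : R := (expdt c nu p + expdt c (- nu) p) / 2.
Definition sinht (c nu p : R) : R := (expt c nu p - expt c (- nu) p) / 2.

Lemma is_derive_expt (c l p : R) : is_derive (expt c l) p (l * expdt c l p).
Proof.
  pose proof (is_derive_gd p) as D. unfold expt, expdt. auto_derive.
  - now exists (gs p).
  - derive_with D. unfold Rminus. ring.
Qed.

Lemma is_derive_sinht (c nu p : R) : is_derive (sinht c nu) p (nu * coshdt c nu p).
Proof.
  pose proof (is_derive_expt c nu p) as D1. pose proof (is_derive_expt c (- nu) p) as D2.
  unfold sinht, coshdt. auto_derive.
  - repeat split; eexists; eassumption.
  - derive_with D1. derive_with D2. field.
Qed.

Lemma abs_cos (a : R) : Rabs (cos a) <= 1.
Proof. apply Rabs_le, COS_bound. Qed.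

Lemma exp_scal_le (l p : R) : 0 <= p -> exp (l * p) <= exp (Rabs l * p).
Proof. intros Hp. apply exp_le, Rmult_le_compat_r; [easy | apply Rle_abs]. Qed.

Lemma turn_bound (s a : R) : 0 <= s <= 1 -> Rabs (cos a + s * sin a) <= 2.
Proof. intros Hs. pose proof (COS_bound a). pose proof (SIN_bound a). apply Rabs_le. split; nra. Qed.

Lemma expdt_bound (c l p : R) : 0 <= p -> Rabs (expdt c l p) <= 2 * exp (Rabs l * p).
Proof.
  intros Hp. unfold expdt. rewrite Rabs_mult, Rabs_exp, Rmult_comm.
  pose proof (gs_range p).
  apply Rmult_le_compat; [apply Rabs_pos | apply exp_nonneg | apply turn_bound; lra | now apply exp_scal_le].
Qed.

Lemma coshdt_bound (c nu p : R) : 0 <= p -> Rabs (coshdt c nu p) <= 2 * exp (Rabs nu * p).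
Proof.
  intros Hp. unfold coshdt. pose proof (expdt_bound c nu p Hp) as H1.
  pose proof (expdt_bound c (- nu) p Hp) as H2. rewrite Rabs_Ropp in H2.
  apply Rabs_le_between in H1. apply Rabs_le_between in H2. apply Rabs_le. lra.
Qed.

Lemma expo_expt (c l : R) : expo (expt c l).
Proof.
  apply (expo_intro _ 1 (Rabs l)); [exact (continuous_of_derive _ _ (is_derive_expt c l)) | apply Rabs_pos |].
  intros p Hp. unfold expt. rewrite Rabs_mult, Rabs_exp, Rmult_comm.
  apply Rmult_le_compat; [apply Rabs_pos | apply exp_nonneg | apply abs_cos | now apply exp_scal_le].
Qed.

Lemma sinht_is_expo (c nu : R) : expo (sinht c nu).
Proof.
  apply expo_ext with (fun p => / 2 * (expt c nu p - expt c (- nu) p)); [intros; unfold sinht; field|].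
  apply expo_scal, expo_minus; apply expo_expt.
Qed.

(** The derivative of [expdt], arranged as a combination of functions of known growth. *)
Definition expdt' (c l p : R) : R :=
  l * expdt c l p + (- (sinh p * gs p ^ 2) * expt (c - PI / 2) l p + gs p * (l * expdt (c - PI / 2) l p)).

Lemma expdt_split (c l p : R) : expdt c l p = expt c l p + gs p * expt (c - PI / 2) l p.
Proof.
  unfold expdt, expt. replace (c - PI / 2 - l * gd p) with (- (PI / 2 - (c - l * gd p))) by ring.
  rewrite cos_neg, cos_shift. ring.
Qed.

Lemma is_derive_expdt (c l p : R) : is_derive (expdt c l) p (expdt' c l p).
Proof.
  apply (is_derive_ext (fun p => expt c l p + gs p * expt (c - PI / 2) l p));
    [intros; symmetry; apply expdt_split|].
  pose proof (is_derive_expt c l p) as D1. pose proof (is_derive_expt (c - PI / 2) l p) as D2.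
  pose proof (is_derive_gs p) as D3. unfold expdt'. auto_derive.
  - repeat split; eexists; eassumption.
  - derive_with D1. derive_with D2. derive_with D3. ring.
Qed.

Lemma expo_expdt (c l : R) : expo (expdt c l).
Proof.
  apply (expo_intro _ 2 (Rabs l)); [exact (continuous_of_derive _ _ (is_derive_expdt c l)) | apply Rabs_pos |].
  intros p Hp. now apply expdt_bound.
Qed.

Lemma expo_expdt' (c l : R) : expo (expdt' c l).
Proof.
  apply (expo_plus (fun p => l * expdt c l p)); [apply expo_scal, expo_expdt|].
  apply (expo_plus (fun p => - (sinh p * gs p ^ 2) * expt (c - PI / 2) l p)).
  - apply (expo_mult (fun p => - (sinh p * gs p ^ 2))); [|apply expo_expt].
    apply expo_ext with (fun p => -1 * (sinh p * gs p ^ 2)); [intros; ring|].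
    apply expo_scal, expo_mult; [apply expo_sinh | apply expo_gs_sqr].
  - apply (expo_mult gs); [apply expo_gs | apply expo_scal, expo_expdt].
Qed.

Lemma expo_coshdt (c nu : R) : expo (coshdt c nu).
Proof.
  apply expo_ext with (fun p => / 2 * (expdt c nu p + expdt c (- nu) p)); [intros; unfold coshdt; field|].
  apply expo_scal, expo_plus; apply expo_expdt.
Qed.

(** Since cosh t = 1 + i gh and (sinh t) dt/dp = i gh1, multiplying e^(l t) by these shifts l by
    1; under the integral these are the recurrences of the Bessel functions. *)
Lemma expdt_shift (c l p : R) :
  gh p * expdt c l p = expdt (c - PI / 2) l p
                       - (expdt (c - PI / 2) (l + 1) p + expdt (c - PI / 2) (l - 1) p) / 2
  /\ gh1 p * expt c l p = (expdt (c + PI / 2) (l + 1) p - expdt (c + PI / 2) (l - 1) p) / 2.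
Proof.
  unfold expdt, expt, gh, gh1, cosh, sinh.
  replace ((l + 1) * p) with (l * p + p) by ring. replace ((l - 1) * p) with (l * p + - p) by ring.
  replace (c - PI / 2 - (l + 1) * gd p) with ((c - l * gd p - gd p) - PI / 2) by ring.
  replace (c - PI / 2 - (l - 1) * gd p) with ((c - l * gd p + gd p) - PI / 2) by ring.
  replace (c + PI / 2 - (l + 1) * gd p) with ((c - l * gd p - gd p) + PI / 2) by ring.
  replace (c + PI / 2 - (l - 1) * gd p) with ((c - l * gd p + gd p) + PI / 2) by ring.
  replace (c - PI / 2 - l * gd p) with ((c - l * gd p) - PI / 2) by ring.
  generalize (c - l * gd p); intros a.
  rewrite !(cos_minus _ (PI / 2)), !(sin_minus _ (PI / 2)), !(cos_plus _ (PI / 2)), !(sin_plus _ (PI / 2)).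
  rewrite cos_PI2, sin_PI2, (cos_minus a), (sin_minus a), (cos_plus a), (sin_plus a), cos_gd, sin_gd, !exp_plus.
  unfold gs, cosh, sinh. rewrite (exp_Ropp p).
  pose proof (exp_pos p) as He. set (e := exp p) in *. clearbody e.
  assert (e * e + 1 <> 0) by nra. split; field; split; lra.
Qed.

Lemma gh_coshdt (c nu p : R) : gh p * coshdt c nu p =
  coshdt (c - PI / 2) nu p - (coshdt (c - PI / 2) (nu + 1) p + coshdt (c - PI / 2) (nu - 1) p) / 2.
Proof.
  unfold coshdt. replace (- (nu + 1)) with (- nu - 1) by ring. replace (- (nu - 1)) with (- nu + 1) by ring.
  replace (gh p * ((expdt c nu p + expdt c (- nu) p) / 2))
    with ((gh p * expdt c nu p + gh p * expdt c (- nu) p) / 2) by field.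
  rewrite (proj1 (expdt_shift c nu p)), (proj1 (expdt_shift c (- nu) p)). field.
Qed.

Lemma gh1_sinht (c nu p : R) : gh1 p * sinht c nu p =
  (coshdt (c + PI / 2) (nu + 1) p - coshdt (c + PI / 2) (nu - 1) p) / 2.
Proof.
  unfold coshdt, sinht. replace (- (nu + 1)) with (- nu - 1) by ring. replace (- (nu - 1)) with (- nu + 1) by ring.
  replace (gh1 p * ((expt c nu p - expt c (- nu) p) / 2))
    with ((gh1 p * expt c nu p - gh1 p * expt c (- nu) p) / 2) by field.
  rewrite (proj2 (expdt_shift c nu p)), (proj2 (expdt_shift c (- nu) p)). field.
Qed.

Lemma coshdt_opp (c nu p : R) : coshdt c (- nu) p = coshdt c nu p.
Proof. unfold coshdt. rewrite Ropp_involutive. field. Qed.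

Lemma coshdt_turn (c d nu p : R) :
  coshdt (c + d) nu p = cos d * coshdt c nu p + sin d * coshdt (c + PI / 2) nu p.
Proof.
  assert (W : forall l, expdt (c + d) l p = cos d * expdt c l p + sin d * expdt (c + PI / 2) l p).
  { intros l. unfold expdt.
    replace (c + d - l * gd p) with ((c - l * gd p) + d) by ring.
    replace (c + PI / 2 - l * gd p) with ((c - l * gd p) + PI / 2) by ring.
    generalize (c - l * gd p); intros a.
    rewrite !cos_plus, !sin_plus, cos_PI2, sin_PI2. ring. }
  unfold coshdt. rewrite !W. field.
Qed.

Lemma coshdt_0 (c nu : R) : coshdt c nu 0 = cos c + sin c.
Proof.
  unfold coshdt, expdt, gs, gd. rewrite sinh_0, atan_0, cosh_0, !Rmult_0_r, exp_0, Rminus_0_r. field.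
Qed.

(** * Cylinder functions *)

Lemma Lap_gh_lin (A B C : R -> R) (a b x : R) : expo A -> expo B -> 0 < x ->
  (forall p, C p = a * A p + b * B p) -> Lap gh C x = a * Lap gh A x + b * Lap gh B x.
Proof. intros HA HB Hx HC. apply Lap_lin; try easy. apply kernel_gh. Qed.

(** Up to a constant factor, e^(ix) (HL 0 nu x + i HL (pi/2) nu x) is e^(i nu pi/2) times the
    Hankel function of the first kind; [HL c] is the real part of e^(-ic) times that integral. *)
Definition HL (c nu x : R) : R := Lap gh (coshdt c nu) x.

Lemma HL_opp (c nu x : R) : HL c (- nu) x = HL c nu x.
Proof. unfold HL. apply Lap_ext. intros p _. apply coshdt_opp. Qed.

Lemma HL_turn (c d nu x : R) : 0 < x ->
  HL (c + d) nu x = cos d * HL c nu x + sin d * HL (c + PI / 2) nu x.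
Proof.
  intros Hx. apply Lap_gh_lin; [apply expo_coshdt | apply expo_coshdt | easy | intros; apply coshdt_turn].
Qed.

Lemma HL_eq (c nu x : R) : 0 < x -> HL c nu x = cos c * HL 0 nu x + sin c * HL (PI / 2) nu x.
Proof.
  intros Hx. replace c with (0 + c) at 1 by ring. rewrite HL_turn by easy. now rewrite Rplus_0_l.
Qed.

Definition dHL (c nu x : R) : R :=
  (HL (c - PI / 2) (nu + 1) x + HL (c - PI / 2) (nu - 1) x) / 2 - HL (c - PI / 2) nu x.

Lemma is_derive_HL (c nu x : R) : 0 < x -> is_derive (HL c nu) x (dHL c nu x).
Proof.
  intros Hx. replace (dHL c nu x) with (- Lap gh (fun p => gh p * coshdt c nu p) x).
  - exact (Lap_derive gh (coshdt c nu) x kernel_gh (expo_coshdt c nu) Hx).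
  - unfold dHL, HL. set (k := c - PI / 2).
    rewrite (Lap_gh_lin (coshdt k nu) (fun p => / 2 * coshdt k (nu + 1) p + / 2 * coshdt k (nu - 1) p) _ 1 (-1));
      [| apply expo_coshdt | apply expo_plus; apply expo_scal, expo_coshdt | easy
       | intros p; rewrite gh_coshdt; unfold k; field].
    rewrite (Lap_gh_lin (coshdt k (nu + 1)) (coshdt k (nu - 1))
      (fun p => / 2 * coshdt k (nu + 1) p + / 2 * coshdt k (nu - 1) p) (/ 2) (/ 2));
      [field | apply expo_coshdt | apply expo_coshdt | easy | easy].
Qed.

Lemma HL_by_parts (c nu x : R) : 0 < x ->
  nu * HL c nu x = x / 2 * (HL (c + PI / 2) (nu + 1) x - HL (c + PI / 2) (nu - 1) x).
Proof.
  intros Hx. set (k := c + PI / 2).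
  transitivity (Lap gh (fun p => nu * coshdt c nu p) x).
  { unfold HL. rewrite (Lap_gh_lin (coshdt c nu) (fun _ => 0) (fun p => nu * coshdt c nu p) nu 0);
      [ring | apply expo_coshdt | apply expo_const | easy | intros; ring]. }
  rewrite (Lap_by_parts gh gh1 (sinht c nu)).
  - unfold HL. rewrite (Lap_gh_lin (coshdt k (nu + 1)) (coshdt k (nu - 1)) (fun p => gh1 p * sinht c nu p) (/ 2) (- / 2));
      [field | apply expo_coshdt | apply expo_coshdt | easy | intros p; rewrite gh1_sinht; unfold k; field].
  - apply kernel_gh.
  - apply sinht_is_expo.
  - apply expo_scal, expo_coshdt.
  - apply expo_gh1.
  - easy.
  - apply is_derive_gh.
  - apply is_derive_sinht.
  - unfold sinht, expt, gd. rewrite sinh_0, atan_0, !Rmult_0_r. field.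
Qed.

(** [G] and [Y] are pi/2 times the Bessel functions of the first and the second kind. Adding pi/2
    to the angle with each unit of the order makes one recurrence valid for both. *)
Definition cyl (c nu x : R) : R := HL (c + nu * (PI / 2) - x) nu x.
Definition G : R -> R -> R := cyl (PI / 2).
Definition Y : R -> R -> R := cyl PI.

Lemma HL_quarter (c nu x : R) : 0 < x ->
  HL (c + PI / 2) nu x = cos c * HL (PI / 2) nu x - sin c * HL 0 nu x
  /\ HL (c - PI / 2) nu x = sin c * HL 0 nu x - cos c * HL (PI / 2) nu x.
Proof.
  intros Hx. rewrite (HL_eq (c + PI / 2)), (HL_eq (c - PI / 2)) by easy.
  rewrite cos_plus, sin_plus, cos_minus, sin_minus, cos_PI2, sin_PI2. split; ring.
Qed.

Lemma locally_above (a x : R) : a < x -> locally x (fun z => a < z).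
Proof.
  intros H. assert (Hd : 0 < x - a) by lra. exists (mkposreal _ Hd). intros z Hz.
  unfold ball in Hz; simpl in Hz; unfold AbsRing_ball, abs, minus, plus, opp in Hz; simpl in Hz.
  apply Rabs_def2 in Hz. lra.
Qed.

Lemma is_derive_cyl (c nu x : R) : 0 < x -> let b := c + nu * (PI / 2) - x in
  is_derive (cyl c nu) x (- (HL (b + PI / 2) (nu + 1) x + HL (b + PI / 2) (nu - 1) x) / 2).
Proof.
  intros Hx b. set (a := c + nu * (PI / 2)).
  apply (is_derive_ext_loc (fun y => cos (a - y) * HL 0 nu y + sin (a - y) * HL (PI / 2) nu y)).
  { generalize (locally_above 0 x Hx). apply filter_imp. intros y Hy. symmetry. now apply HL_eq. }
  pose proof (is_derive_HL 0 nu x Hx) as D1. pose proof (is_derive_HL (PI / 2) nu x Hx) as D2.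
  auto_derive; [split; [eexists; exact D1 | split; [eexists; exact D2 | easy]] |].
  derive_with D1. derive_with D2. unfold dHL.
  assert (H0 : forall n, HL (0 - PI / 2) n x = - HL (PI / 2) n x).
  { intros n. rewrite (proj2 (HL_quarter 0 n x Hx)), sin_0, cos_0. ring. }
  replace (PI / 2 - PI / 2) with 0 by ring. rewrite !H0.
  rewrite !(fun n => proj1 (HL_quarter b n x Hx)). change (a - x) with b. fold b.
  change (a + - x) with b. field.
Qed.

Lemma is_derive_cyl_up (c nu x : R) : 0 < x ->
  is_derive (cyl c nu) x (nu / x * cyl c nu x - cyl c (nu + 1) x).
Proof.
  intros Hx. evar_last; [now apply is_derive_cyl|]. unfold cyl.
  replace (c + (nu + 1) * (PI / 2) - x) with (c + nu * (PI / 2) - x + PI / 2) by ring.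
  set (b := c + nu * (PI / 2) - x).
  replace (nu / x * HL b nu x) with (nu * HL b nu x / x) by (field; lra).
  rewrite HL_by_parts by easy. simpl. field. lra.
Qed.

Lemma is_derive_cyl_down (c nu x : R) : 0 < x ->
  is_derive (cyl c nu) x (cyl c (nu - 1) x - nu / x * cyl c nu x).
Proof.
  intros Hx. evar_last; [now apply is_derive_cyl|]. unfold cyl.
  replace (c + (nu - 1) * (PI / 2) - x) with (c + nu * (PI / 2) - x - PI / 2) by ring.
  set (b := c + nu * (PI / 2) - x).
  replace (nu / x * HL b nu x) with (nu * HL b nu x / x) by (field; lra).
  rewrite HL_by_parts by easy. rewrite (proj2 (HL_quarter b (nu - 1) x Hx)).
  rewrite !(fun n => proj1 (HL_quarter b n x Hx)). simpl. field. lra.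
Qed.

(** The derivative recurrences for two consecutive orders. They imply Bessel's equation and are
    all that Wronskian arguments use, so that the integrals and the power series can be compared
    without a second derivative. *)
Definition bpair (nu : R) (g g1 : R -> R) : Prop := forall x, 0 < x ->
  is_derive g x (nu / x * g x - g1 x) /\ is_derive g1 x (g x - (nu + 1) / x * g1 x).

Lemma bpair_cyl (c nu : R) : bpair nu (cyl c nu) (cyl c (nu + 1)).
Proof.
  intros x Hx. split; [now apply is_derive_cyl_up|].
  evar_last; [now apply is_derive_cyl_down|]. simpl. now replace (nu + 1 - 1) with nu by ring.
Qed.

Lemma bpair_G (nu : R) : bpair nu (G nu) (G (nu + 1)).
Proof. exact (bpair_cyl (PI / 2) nu). Qed.

Lemma bpair_Y (nu : R) : bpair nu (Y nu) (Y (nu + 1)).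
Proof. exact (bpair_cyl PI nu). Qed.

Lemma constant_of_derive_0 (f : R -> R) :
  (forall x, 0 < x -> is_derive f x 0) -> forall x y, 0 < x -> 0 < y -> f x = f y.
Proof.
  intros Hf.
  assert (W : forall x y, 0 < x -> 0 < y -> x <= y -> f x = f y).
  { intros x y Hx Hy Hxy. destruct (MVT_derive f (fun _ => 0) x y Hxy) as (c & _ & E).
    - intros z Hz. apply Hf; lra.
    - lra. }
  intros x y Hx Hy. destruct (Rle_lt_dec x y); [now apply W|]. symmetry. apply W; lra.
Qed.

(** The product of x and the Wronskian of g and y, with the derivatives eliminated by the
    recurrence. *)
Definition cross (g g1 y y1 : R -> R) (x : R) : R := x * (g1 x * y x - g x * y1 x).

Lemma cross_constant (nu : R) (g g1 y y1 : R -> R) : bpair nu g g1 -> bpair nu y y1 ->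
  forall x x', 0 < x -> 0 < x' -> cross g g1 y y1 x = cross g g1 y y1 x'.
Proof.
  intros Hg Hy. apply constant_of_derive_0. intros x Hx.
  destruct (Hg x Hx) as [D1 D2]. destruct (Hy x Hx) as [D3 D4].
  unfold cross. auto_derive.
  - repeat split; eexists; eassumption.
  - derive_with D1. derive_with D2. derive_with D3. derive_with D4. field. lra.
Qed.

(** * Behaviour at infinity *)

Lemma is_lim_mult_R (f g : R -> R) (a b : R) : is_lim f p_infty a -> is_lim g p_infty b ->
  is_lim (fun x => f x * g x) p_infty (a * b).
Proof. intros Hf Hg. now apply (is_lim_mult f g p_infty a b). Qed.

Lemma is_lim_value (f : R -> R) (l l' : R) : is_lim f p_infty l -> l = l' -> is_lim f p_infty l'.
Proof. now intros H <-. Qed.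

Lemma is_lim_seq_value (u : nat -> R) (l l' : R) : is_lim_seq u l -> l = l' -> is_lim_seq u l'.
Proof. now intros H <-. Qed.

(** Splits the limit of a sum or product, with hypotheses for the constituents. [limit] leaves the
    equation between the limit found and the limit claimed. *)
Ltac limit_steps := repeat match goal with
  | H : is_lim ?f ?a _ |- is_lim ?f ?a _ => exact H
  | H : is_lim ?f ?a _ |- is_lim (fun x => ?f x) ?a _ => exact H
  | |- is_lim (fun _ => ?c) _ _ => apply is_lim_const
  | |- is_lim (fun x => @?f x - @?g x) _ _ => apply (is_lim_minus' f g)
  | |- is_lim (fun x => @?f x + @?g x) _ _ => apply (is_lim_plus' f g)
  | |- is_lim (fun x => @?f x * @?g x) _ _ => apply (is_lim_mult_R f g)
  | H : is_lim_seq ?u _ |- is_lim_seq ?u _ => exact H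
  | H : is_lim_seq ?u _ |- is_lim_seq (fun n => ?u n) _ => exact H
  | |- is_lim_seq (fun _ => ?c) _ => apply is_lim_seq_const
  | |- is_lim_seq (fun n => @?u n - @?v n) _ => apply (is_lim_seq_minus' u v)
  | |- is_lim_seq (fun n => @?u n + @?v n) _ => apply (is_lim_seq_plus' u v)
  | |- is_lim_seq (fun n => @?u n * @?v n) _ => apply (is_lim_seq_mult' u v)
  end.
Ltac limit := (eapply is_lim_value || eapply is_lim_seq_value); [limit_steps |].

Lemma expo_increment (F f : R -> R) : (forall p, is_derive F p (f p)) -> expo f ->
  exists C l, 0 <= l /\ forall p, 0 <= p -> Rabs (F p - F 0) <= C * p * exp (l * p).
Proof.
  intros HF [_ (C & l & Hl & Hb)]. exists C, l. split; [easy|]. intros p Hp.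
  destruct (MVT_derive F f 0 p Hp) as (c & Hc & E); [intros; apply HF|].
  rewrite E, Rminus_0_r, Rabs_mult, (Rabs_pos_eq p) by easy.
  assert (HC : 0 <= C).
  { specialize (Hb 0 (Rle_refl 0)). rewrite Rmult_0_r, exp_0 in Hb. pose proof (Rabs_pos (f 0)). lra. }
  replace (C * p * exp (l * p)) with (C * exp (l * p) * p) by ring.
  apply Rmult_le_compat_r; [easy|]. eapply Rle_trans; [apply Hb; lra|].
  apply Rmult_le_compat_l; [easy|]. apply exp_le. nra.
Qed.

(** The common scale at infinity: every [HL c nu], divided by it, has a limit, and it cancels from
    the ratios that determine angles. *)
Definition Lap1 (x : R) : R := Lap gh (fun _ => 1) x.

(** On [0, 1/sqrt x] the exponent x gh(p) is at most 4. *)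
Lemma Lap1_lower (x : R) : 1 <= x -> exp (-4) / sqrt x <= Lap1 x.
Proof.
  intros Hx. assert (Hs : 1 <= sqrt x) by (rewrite <- sqrt_1; apply sqrt_le_1; lra).
  assert (Hss : sqrt x * sqrt x = x) by (apply sqrt_sqrt; lra).
  replace (exp (-4) / sqrt x) with (/ sqrt x * exp (-4)) by (field; lra).
  unfold Lap1, Lap. apply Int_ge_segment.
  - apply Lap_edom; [apply kernel_gh | apply expo_const | lra].
  - left. apply Rinv_0_lt_compat; lra.
  - intros p _. rewrite Rmult_1_r. apply exp_nonneg.
  - intros p Hp. rewrite Rmult_1_r. apply exp_le.
    assert (Hi : / sqrt x <= 1) by (rewrite <- Rinv_1; apply Rinv_le_contravar; lra).
    pose proof (gh_le p).
    assert (p * sqrt x <= 1).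
    { apply Rle_trans with (/ sqrt x * sqrt x); [apply Rmult_le_compat_r; lra | rewrite Rinv_l; lra]. }
    assert (x * p ^ 2 <= 1).
    { replace (x * p ^ 2) with ((p * sqrt x) ^ 2) by (replace ((p * sqrt x) ^ 2) with (p ^ 2 * (sqrt x * sqrt x)) by ring; rewrite Hss; ring).
      rewrite <- (pow1 2). apply pow_incr. split; [apply Rmult_le_pos; lra | easy]. }
    assert (x * gh p <= x * (4 * p ^ 2)) by (apply Rmult_le_compat_l; [lra | apply H; lra]).
    lra.
Qed.

(** Lap1 decays no faster than x^(-1/2), hence more slowly than 1/x. *)
Lemma small_over_Lap1 (f : R -> R) (K : R) : (forall x, 2 <= x -> Rabs (f x) <= K / (x - 1)) ->
  is_lim (fun x => f x / Lap1 x) p_infty 0.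
Proof.
  intros Hf.
  assert (HK : 0 <= K).
  { specialize (Hf 2 (Rle_refl 2)). pose proof (Rabs_pos (f 2)).
    replace (K / (2 - 1)) with K in Hf by field. lra. }
  apply is_lim_spec. intros eps.
  set (T := 2 * K * exp 4 / eps).
  assert (HT : 0 <= T).
  { apply Rdiv_le_0_compat; [|apply cond_pos]. pose proof (exp_pos 4). nra. }
  exists (Rmax 2 (T ^ 2)). intros x Hx. rewrite Rminus_0_r.
  assert (H2 : 2 < x) by (eapply Rle_lt_trans; [apply Rmax_l | exact Hx]).
  assert (H3 : T ^ 2 < x) by (eapply Rle_lt_trans; [apply Rmax_r | exact Hx]).
  pose proof (Lap1_lower x) as HZ.
  assert (Hs : 0 < sqrt x) by (apply sqrt_lt_R0; lra).
  assert (Hss : sqrt x * sqrt x = x) by (apply sqrt_sqrt; lra).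
  assert (HTs : T < sqrt x) by nra.
  assert (HZ0 : 0 < exp (-4) / sqrt x) by (apply Rdiv_lt_0_compat; [apply exp_pos | easy]).
  assert (HZ1 : 0 < Lap1 x) by (specialize (HZ ltac:(lra)); lra).
  unfold Rdiv. rewrite Rabs_mult, Rabs_inv, (Rabs_pos_eq (Lap1 x)) by lra.
  apply Rmult_lt_reg_r with (Lap1 x); [easy|]. rewrite Rmult_assoc, Rinv_l, Rmult_1_r by lra.
  eapply Rle_lt_trans; [apply Hf; lra|].
  apply Rlt_le_trans with (eps * (exp (-4) / sqrt x)).
  2:{ apply Rmult_le_compat_l; [left; apply cond_pos | apply HZ; lra]. }
  apply Rle_lt_trans with (2 * K / x).
  - apply Rmult_le_reg_r with (x * (x - 1)); [nra|].
    replace (K / (x - 1) * (x * (x - 1))) with (K * x) by (field; lra).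
    replace (2 * K / x * (x * (x - 1))) with (2 * K * (x - 1)) by (field; lra). nra.
  - apply Rmult_lt_reg_r with (x * exp 4 / eps).
    { apply Rdiv_lt_0_compat; [|apply cond_pos]. apply Rmult_lt_0_compat; [lra | apply exp_pos]. }
    replace (2 * K / x * (x * exp 4 / eps)) with T
      by (unfold T; field; split; [pose proof (cond_pos eps) | ]; lra).
    replace (eps * (exp (-4) / sqrt x) * (x * exp 4 / eps)) with (sqrt x); [easy|].
    replace (exp (-4)) with (/ exp 4) by (rewrite <- exp_Ropp; f_equal; ring).
    pose proof (cond_pos eps). pose proof (exp_pos 4).
    transitivity (x / sqrt x); [apply Rmult_eq_reg_r with (sqrt x); [rewrite Hss; field; lra | lra] | field; repeat split; lra].
Qed.

Lemma Lap1_pos (x : R) : 0 < x -> 0 < Lap1 x.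
Proof.
  intros Hx. apply Lap_pos; try easy; [apply kernel_gh | apply expo_const | intros; lra | intros; lra].
Qed.

Lemma weight_over_Lap1 (w w' : R -> R) : (forall p, is_derive w p (w' p)) -> expo w -> expo w' ->
  is_lim (fun x => Lap gh w x / Lap1 x) p_infty (w 0).
Proof.
  intros Dw Ew Ew'.
  destruct (expo_increment w w' Dw Ew') as (C & l & Hl & Hb).
  assert (Em : expo (fun p => w p - w 0)) by (apply expo_minus; [easy | apply expo_const]).
  destruct (Lap_large gh gh1 _ C l kernel_gh Em expo_gh1 Hl is_derive_gh gh_0 gh1_ge Hb) as (K & _ & HK).
  apply is_lim_ext_loc with (fun x => Lap gh (fun p => w p - w 0) x / Lap1 x + w 0).
  - exists 0. intros x Hx. pose proof (Lap1_pos x Hx).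
    rewrite (Lap_lin gh w (fun _ => 1) (fun p => w p - w 0) 1 (- w 0));
      [| apply kernel_gh | easy | apply expo_const | easy | intros; ring].
    fold (Lap1 x). field. lra.
  - pose proof (small_over_Lap1 _ K HK). limit. ring.
Qed.

Lemma HL_over_Lap1 (c nu : R) : is_lim (fun x => HL c nu x / Lap1 x) p_infty (cos c + sin c).
Proof.
  rewrite <- (coshdt_0 c nu).
  apply (weight_over_Lap1 _ (fun p => / 2 * (expdt' c nu p + expdt' c (- nu) p))).
  - intros p. pose proof (is_derive_expdt c nu p) as D1. pose proof (is_derive_expdt c (- nu) p) as D2.
    unfold coshdt. auto_derive; [repeat split; eexists; eassumption|].
    derive_with D1. derive_with D2. field.
  - apply expo_coshdt.
  - apply expo_scal, expo_plus; apply expo_expdt'.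
Qed.

(** * Phases of the cylinder functions *)

(** A continuous polar angle of the vector (g, y). *)
Definition phase_of (g y theta : R -> R) : Prop :=
  (forall x, 0 < x -> continuous theta x) /\
  forall x, 0 < x -> exists M, 0 < M /\ g x = M * cos (theta x) /\ y x = M * sin (theta x).

Definition crossGY (nu x : R) : R := cross (G nu) (G (nu + 1)) (Y nu) (Y (nu + 1)) x.
Definition dotGY (nu x : R) : R := x * (G nu x * G (nu + 1) x + Y nu x * Y (nu + 1) x).

(** Rotating both vectors by the same angle changes neither their dot nor their cross product, so
    the oscillation in x drops out. *)
Lemma GY_products (nu x : R) : 0 < x ->
  crossGY nu x = x * (HL 0 nu x * HL 0 (nu + 1) x + HL (PI / 2) nu x * HL (PI / 2) (nu + 1) x)
  /\ dotGY nu x = x * (HL 0 nu x * HL (PI / 2) (nu + 1) x - HL (PI / 2) nu x * HL 0 (nu + 1) x)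
  /\ G nu x ^ 2 + Y nu x ^ 2 = HL 0 nu x ^ 2 + HL (PI / 2) nu x ^ 2.
Proof.
  intros Hx. unfold crossGY, dotGY, cross, G, Y, cyl. set (b := PI / 2 + nu * (PI / 2) - x).
  replace (PI / 2 + (nu + 1) * (PI / 2) - x) with (b + PI / 2) by (unfold b; ring).
  replace (PI + nu * (PI / 2) - x) with (b + PI / 2) by (unfold b; field).
  replace (PI + (nu + 1) * (PI / 2) - x) with (b + PI / 2 + PI / 2) by (unfold b; field).
  rewrite !(fun n => proj1 (HL_quarter (b + PI / 2) n x Hx)), !(fun n => proj1 (HL_quarter b n x Hx)).
  rewrite !(HL_eq b) by easy. rewrite cos_plus, sin_plus, cos_PI2, sin_PI2.
  pose proof (sin2_cos2 b) as E. unfold Rsqr in E.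
  generalize dependent (sin b). generalize (cos b). intros c s E.
  generalize (HL 0 nu x), (HL (PI / 2) nu x), (HL 0 (nu + 1) x), (HL (PI / 2) (nu + 1) x).
  intros p q p' q'. split; [|split].
  - transitivity (x * (p * p' + q * q') * (s * s + c * c)); [ring | rewrite E; ring].
  - transitivity (x * (p * q' - q * p') * (s * s + c * c)); [ring | rewrite E; ring].
  - transitivity ((p ^ 2 + q ^ 2) * (s * s + c * c)); [ring | rewrite E; ring].
Qed.

Lemma crossGY_const (nu x x' : R) : 0 < x -> 0 < x' -> crossGY nu x = crossGY nu x'.
Proof. exact (cross_constant nu _ _ _ _ (bpair_G nu) (bpair_Y nu) x x'). Qed.

Lemma HL_limits (nu : R) : is_lim (fun x => HL 0 nu x / Lap1 x) p_infty 1
  /\ is_lim (fun x => HL (PI / 2) nu x / Lap1 x) p_infty 1.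
Proof.
  split.
  - replace 1 with (cos 0 + sin 0) by (rewrite cos_0, sin_0; ring). apply HL_over_Lap1.
  - replace 1 with (cos (PI / 2) + sin (PI / 2)) by (rewrite cos_PI2, sin_PI2; ring). apply HL_over_Lap1.
Qed.

Lemma crossGY_over_Lap1 (nu : R) : is_lim (fun x => crossGY nu x / (x * Lap1 x ^ 2)) p_infty 2.
Proof.
  apply is_lim_ext_loc with (fun x => HL 0 nu x / Lap1 x * (HL 0 (nu + 1) x / Lap1 x)
     + HL (PI / 2) nu x / Lap1 x * (HL (PI / 2) (nu + 1) x / Lap1 x)).
  - exists 0. intros x Hx. pose proof (Lap1_pos x Hx). rewrite (proj1 (GY_products nu x Hx)). field. lra.
  - destruct (HL_limits nu) as [L1 L2]. destruct (HL_limits (nu + 1)) as [L3 L4]. limit. ring.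
Qed.

(** It is constant, and asymptotic to 2 x Lap1(x)^2 at infinity. *)
Lemma crossGY_pos (nu x : R) : 0 < x -> 0 < crossGY nu x.
Proof.
  intros Hx.
  pose proof (crossGY_over_Lap1 nu) as L. apply is_lim_spec in L.
  destruct (L (mkposreal 1 Rlt_0_1)) as [B HB]. change (pos (mkposreal 1 Rlt_0_1)) with 1 in HB.
  set (t := Rmax B 0 + 1).
  assert (Ht : 0 < t) by (unfold t; pose proof (Rmax_r B 0); lra).
  assert (HtB : B < t) by (unfold t; pose proof (Rmax_l B 0); lra).
  specialize (HB t HtB). apply Rabs_def2 in HB.
  rewrite (crossGY_const nu x t Hx Ht). pose proof (Lap1_pos t Ht).
  assert (0 < t * Lap1 t ^ 2) by (apply Rmult_lt_0_compat; [easy | apply pow_lt; easy]).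
  replace (crossGY nu t) with (crossGY nu t / (t * Lap1 t ^ 2) * (t * Lap1 t ^ 2)) by (field; lra).
  apply Rmult_lt_0_compat; lra.
Qed.

(** Both [HL 0] and [HL (PI / 2)] are asymptotic to Lap1, so the determinant in the dot product of
    consecutive orders is negligible against their cross product: the vectors become orthogonal.
    The multiple k of the vector itself is smaller by a factor 1/x. *)
Lemma ratio_lim (nu k : R) :
  is_lim (fun x => (dotGY nu x + k * (G nu x ^ 2 + Y nu x ^ 2)) / crossGY nu x) p_infty 0.
Proof.
  apply is_lim_ext_loc with (fun x =>
     (HL 0 nu x / Lap1 x * (HL (PI / 2) (nu + 1) x / Lap1 x) - HL (PI / 2) nu x / Lap1 x * (HL 0 (nu + 1) x / Lap1 x)
      + k * / x * (HL 0 nu x / Lap1 x * (HL 0 nu x / Lap1 x) + HL (PI / 2) nu x / Lap1 x * (HL (PI / 2) nu x / Lap1 x)))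
     * / (crossGY nu x / (x * Lap1 x ^ 2))).
  - exists 0. intros x Hx. pose proof (Lap1_pos x Hx). pose proof (crossGY_pos nu x Hx).
    destruct (GY_products nu x Hx) as (_ & -> & ->). field. lra.
  - destruct (HL_limits nu) as [L1 L2]. destruct (HL_limits (nu + 1)) as [L3 L4].
    pose proof (is_lim_inv (fun x => x) p_infty p_infty (is_lim_id _) ltac:(easy)) as L5.
    assert (L6 : is_lim (fun x => / (crossGY nu x / (x * Lap1 x ^ 2))) p_infty (/ 2)).
    { apply (is_lim_inv _ p_infty 2); [apply crossGY_over_Lap1 |]. intros E. injection E. lra. }
    limit. simpl. field.
Qed.

(** When (u, v) lies to the left of (g, y), the angle between them is pi/2 minus an arctangent.
    This transports a phase from one vector to the other without choosing a branch. *)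
Lemma rotate_phase (g y u v M t : R) : 0 < M -> g = M * cos t -> y = M * sin t ->
  0 < g * v - y * u ->
  let t2 := t + PI / 2 - atan ((g * u + y * v) / (g * v - y * u)) in
  exists M2, 0 < M2 /\ u = M2 * cos t2 /\ v = M2 * sin t2.
Proof.
  intros HM Hg Hy Hd t2.
  set (d := g * v - y * u) in *. set (a := g * u + y * v) in *.
  set (w := sqrt (1 + (a / d)²)).
  assert (Hw : 0 < w).
  { apply sqrt_lt_R0. pose proof (Rle_0_sqr (a / d)). lra. }
  assert (Hc : cos (PI / 2 - atan (a / d)) = a / d / w) by (rewrite cos_shift; apply sin_atan).
  assert (Hs : sin (PI / 2 - atan (a / d)) = 1 / w) by (rewrite sin_shift; apply cos_atan).
  pose proof (sin2_cos2 t) as E. unfold Rsqr in E.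
  exists (d * w / M). split.
  { apply Rdiv_lt_0_compat; [apply Rmult_lt_0_compat|]; easy. }
  unfold t2. replace (t + PI / 2 - atan (a / d)) with (t + (PI / 2 - atan (a / d))) by ring.
  rewrite cos_plus, sin_plus, Hc, Hs. split.
  - replace (d * w / M * (cos t * (a / d / w) - sin t * (1 / w)))
      with ((a * cos t - d * sin t) / M) by (field; lra).
    unfold a, d. rewrite Hg, Hy.
    transitivity (u * (sin t * sin t + cos t * cos t)); [rewrite E; ring | field; lra].
  - replace (d * w / M * (sin t * (a / d / w) + cos t * (1 / w)))
      with ((a * sin t + d * cos t) / M) by (field; lra).
    unfold a, d. rewrite Hg, Hy.
    transitivity (v * (sin t * sin t + cos t * cos t)); [rewrite E; ring | field; lra].
Qed.

(** The limit at infinity fixes the branch of the phase. The bound near 0 then says how many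
    half-turns have been made in between, which is what numbers the zeros. *)
Definition has_phase (nu : R) (theta : R -> R) : Prop :=
  phase_of (G nu) (Y nu) theta /\
  is_lim (fun x => theta x - x) p_infty (- (nu * (PI / 2)) - PI / 4) /\
  exists delta, 0 < delta /\ forall x, 0 < x < delta -> theta x < PI / 2.

Lemma gd_range (p : R) : 0 <= p -> 0 <= gd p < PI / 2.
Proof.
  intros Hp. unfold gd. pose proof (atan_bound (sinh p)). split; [|lra].
  pose proof (sinh_ge p Hp). destruct (Rle_lt_or_eq_dec 0 (sinh p) ltac:(lra)) as [H1|H1].
  - left. rewrite <- atan_0. now apply atan_increasing.
  - rewrite <- H1, atan_0. lra.
Qed.

Lemma coshdt_pos (nu p : R) : 0 <= nu <= 1 / 2 -> 0 <= p -> 0 < coshdt 0 nu p /\ 0 < coshdt (PI / 2) nu p.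
Proof.
  intros Hnu Hp. pose proof (gd_range p Hp) as Hq. pose proof PI_RGT_0. pose proof (gs_range p).
  assert (Ha : 0 <= nu * gd p <= PI / 4) by (split; nra).
  assert (Hsin : 0 <= sin (nu * gd p)) by (apply sin_ge_0; lra).
  assert (Hcos : 0 < cos (nu * gd p)) by (apply cos_gt_0; lra).
  assert (Hsc : sin (nu * gd p) <= cos (nu * gd p)).
  { rewrite <- sin_shift. apply sin_incr_1; lra. }
  assert (He : exp (- nu * p) <= exp (nu * p)) by (apply exp_le; nra).
  pose proof (exp_pos (- nu * p)). unfold coshdt, expdt.
  replace (0 - nu * gd p) with (- (nu * gd p)) by ring.
  replace (0 - - nu * gd p) with (nu * gd p) by ring.
  replace (PI / 2 - - nu * gd p) with (PI / 2 + nu * gd p) by ring.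
  rewrite cos_neg, sin_neg, cos_shift, sin_shift, (cos_plus (PI / 2)), (sin_plus (PI / 2)), cos_PI2, sin_PI2.
  set (c := cos (nu * gd p)) in *. set (s := sin (nu * gd p)) in *.
  assert (gs p * s <= s) by nra. split.
  - assert (0 <= exp (nu * p) * (c + gs p * - s)) by (apply Rmult_le_pos; lra).
    assert (0 < exp (- nu * p) * (c + gs p * s)) by (apply Rmult_lt_0_compat; nra). lra.
  - assert (0 < gs p * c) by (apply Rmult_lt_0_compat; lra).
    assert (exp (- nu * p) * s <= exp (nu * p) * s) by (apply Rmult_le_compat_r; lra).
    assert (0 < exp (nu * p) * (gs p * c)) by (apply Rmult_lt_0_compat; lra).
    assert (0 < exp (- nu * p) * (gs p * c)) by (apply Rmult_lt_0_compat; lra). lra.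
Qed.

Lemma HL_pos (nu x : R) : -1 / 2 < nu <= 1 / 2 -> 0 < x -> 0 < HL 0 nu x /\ 0 < HL (PI / 2) nu x.
Proof.
  intros Hnu Hx.
  assert (W : forall nu, 0 <= nu <= 1 / 2 -> 0 < HL 0 nu x /\ 0 < HL (PI / 2) nu x).
  { intros n Hn. unfold HL. split; (apply Lap_pos; [apply kernel_gh | apply expo_coshdt | easy | |];
      intros p Hp; [left|]; apply coshdt_pos; lra). }
  destruct (Rle_lt_dec 0 nu); [apply W; lra|].
  rewrite <- !(HL_opp _ nu). apply W. lra.
Qed.

Lemma continuous_derive (f : R -> R) (x l : R) : is_derive f x l -> continuous f x.
Proof. intros H. apply (ex_derive_continuous f). now exists l. Qed.

Lemma is_derive_atan (x : R) : is_derive atan x (/ (1 + x ^ 2)).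
Proof. apply is_derive_Reals. apply derivable_pt_lim_atan. Qed.

Lemma continuous_atan (x : R) : continuous atan x.
Proof. exact (continuous_derive _ _ _ (is_derive_atan x)). Qed.

Lemma is_lim_atan (f : R -> R) (l : R) : is_lim f p_infty l ->
  is_lim (fun x => atan (f x)) p_infty (atan l).
Proof. intros Hf. apply (is_lim_comp_continuous f atan p_infty l Hf). apply continuous_atan. Qed.

(** For these orders [HL 0] and [HL (PI / 2)] are positive, so the argument of HL 0 + i HL (pi/2)
    stays in (0, pi/2) and no winding can occur. *)
Lemma has_phase_base (nu : R) : -1 / 2 < nu <= 1 / 2 -> exists theta, has_phase nu theta.
Proof.
  intros Hnu. set (F := fun x => HL (PI / 2) nu x / HL 0 nu x).
  exists (fun x => x - nu * (PI / 2) - PI / 2 + atan (F x)).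
  split; [split|split].
  - intros x Hx. destruct (HL_pos nu x Hnu Hx) as [HA HB].
    apply (continuous_plus (fun x => x - nu * (PI / 2) - PI / 2)).
    + apply (ex_derive_continuous (fun x => x - nu * (PI / 2) - PI / 2)). auto_derive; easy.
    + apply (continuous_comp F atan); [|apply continuous_atan].
      apply (ex_derive_continuous F).
      pose proof (is_derive_HL 0 nu x Hx) as D1. pose proof (is_derive_HL (PI / 2) nu x Hx) as D2.
      unfold F. auto_derive. split; [eexists; exact D2|]. split; [eexists; exact D1|]. split; [lra | easy].
  - intros x Hx. destruct (HL_pos nu x Hnu Hx) as [HA HB].
    set (w := sqrt (1 + (F x)²)).
    assert (Hw : 0 < w) by (apply sqrt_lt_R0; pose proof (Rle_0_sqr (F x)); lra).
    exists (HL 0 nu x * w). split; [now apply Rmult_lt_0_compat|].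
    unfold G, Y, cyl. set (a := x - nu * (PI / 2)).
    replace (PI / 2 + nu * (PI / 2) - x) with (PI / 2 - a) by (unfold a; ring).
    replace (PI + nu * (PI / 2) - x) with (PI - a) by (unfold a; ring).
    rewrite (HL_eq (PI / 2 - a)), (HL_eq (PI - a)), cos_shift, sin_shift by easy.
    rewrite (cos_minus PI), (sin_minus PI), cos_PI, sin_PI.
    replace (a - PI / 2 + atan (F x)) with (a + atan (F x) - PI / 2) by ring.
    rewrite cos_minus, sin_minus, cos_PI2, sin_PI2, cos_plus, sin_plus, cos_atan, sin_atan.
    fold w. unfold F. split; field; lra.
  - apply is_lim_ext_loc with (fun x => (- (nu * (PI / 2)) - PI / 2)
       + atan (HL (PI / 2) nu x / Lap1 x * / (HL 0 nu x / Lap1 x))).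
    + exists 0. intros x Hx. destruct (HL_pos nu x Hnu Hx) as [HA HB]. pose proof (Lap1_pos x Hx).
      replace (HL (PI / 2) nu x / Lap1 x * / (HL 0 nu x / Lap1 x)) with (F x) by (unfold F; field; lra). ring.
    + destruct (HL_limits nu) as [L1 L2].
      assert (L3 : is_lim (fun x => / (HL 0 nu x / Lap1 x)) p_infty (/ 1)).
      { apply (is_lim_inv _ p_infty 1); [exact L1 |]. intros E. injection E. lra. }
      pose proof (is_lim_atan _ _ (is_lim_mult_R _ _ _ _ L2 L3)). limit.
      rewrite Rinv_1, Rmult_1_r, atan_1. field.
  - pose proof PI_RGT_0. exists (PI / 2 * (1 + nu)). split; [nra|].
    intros x Hx. pose proof (atan_bound (F x)). lra.
Qed.

Lemma ex_derive_ratio (g g1 y y1 : R -> R) (k x : R) :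
  ex_derive g x -> ex_derive g1 x -> ex_derive y x -> ex_derive y1 x -> cross g g1 y y1 x <> 0 ->
  ex_derive (fun x => (x * (g x * g1 x + y x * y1 x) + k * (g x ^ 2 + y x ^ 2)) / cross g g1 y y1 x) x.
Proof. intros Dg Dg1 Dy Dy1 Hc. unfold cross in *. auto_derive. now repeat split. Qed.

Lemma continuous_ratio (nu k x : R) : 0 < x ->
  continuous (fun x => atan ((dotGY nu x + k * (G nu x ^ 2 + Y nu x ^ 2)) / crossGY nu x)) x.
Proof.
  intros Hx. destruct (bpair_G nu x Hx) as [D1 D2]. destruct (bpair_Y nu x Hx) as [D3 D4].
  apply (continuous_comp (fun x => (dotGY nu x + k * (G nu x ^ 2 + Y nu x ^ 2)) / crossGY nu x) atan);
    [|apply continuous_atan].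
  apply (ex_derive_continuous (fun x => (dotGY nu x + k * (G nu x ^ 2 + Y nu x ^ 2)) / crossGY nu x)).
  apply (ex_derive_ratio (G nu) (G (nu + 1)) (Y nu) (Y (nu + 1))).
  - eexists; exact D1.
  - eexists; exact D2.
  - eexists; exact D3.
  - eexists; exact D4.
  - apply Rgt_not_eq. now apply crossGY_pos.
Qed.

(** The next order lies to the right of the given one, at an angle in (0, pi) that tends to pi/2:
    the limit at infinity moves by exactly a quarter-turn, and the bound near 0 is kept because
    the phase only decreases. *)
Lemma has_phase_step (nu : R) (theta : R -> R) : has_phase nu theta ->
  exists theta', has_phase (nu + 1) theta'.
Proof.
  intros [[Hc HM] [Hlim (delta & Hd & Hlow)]].
  set (tau := fun x => (dotGY nu x + 0 * (G nu x ^ 2 + Y nu x ^ 2)) / crossGY nu x).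
  exists (fun x => theta x - PI / 2 + atan (tau x)).
  split; [split|split].
  - intros x Hx. apply (continuous_plus (fun x => theta x - PI / 2)); [|now apply continuous_ratio].
    apply (continuous_minus theta (fun _ => PI / 2)); [now apply Hc | apply continuous_const].
  - intros x Hx. destruct (HM x Hx) as (M & HM0 & Eg & Ey).
    pose proof (crossGY_pos nu x Hx) as Hcr.
    (* The cross product with the next order is negative: turn towards its opposite, then by -pi. *)
    destruct (rotate_phase (G nu x) (Y nu x) (- G (nu + 1) x) (- Y (nu + 1) x) M (theta x) HM0 Eg Ey)
      as (M2 & HM2 & Eu & Ev).
    { unfold crossGY, cross in Hcr. apply Rmult_lt_reg_l with x; [easy|]. lra. }
    exists M2. split; [easy|].
    assert (E : (G nu x * - G (nu + 1) x + Y nu x * - Y (nu + 1) x) /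
          (G nu x * - Y (nu + 1) x - Y nu x * - G (nu + 1) x) = - tau x).
    { unfold tau, dotGY, crossGY, cross in *. field. split; [|lra].
      intros E0. replace (G (nu + 1) x * Y nu x - G nu x * Y (nu + 1) x) with 0 in Hcr by lra. lra. }
    rewrite E, atan_opp in Eu, Ev.
    replace (theta x - PI / 2 + atan (tau x)) with (theta x + PI / 2 - - atan (tau x) - PI) by field.
    set (b := theta x + PI / 2 - - atan (tau x)) in *.
    rewrite cos_minus, sin_minus, cos_PI, sin_PI. split; lra.
  - apply is_lim_ext with (fun x => (theta x - x) + (- (PI / 2) + atan (tau x))); [intros x; ring|].
    pose proof (is_lim_atan _ _ (ratio_lim nu 0) : is_lim (fun x => atan (tau x)) p_infty (atan 0)).
    limit. rewrite atan_0. field.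
  - exists delta. split; [easy|]. intros x Hx. specialize (Hlow x Hx). pose proof (atan_bound (tau x)). lra.
Qed.

Lemma has_phase_exists (nu : R) : -1 / 2 < nu -> exists theta, has_phase nu theta.
Proof.
  intros Hnu.
  assert (W : forall n nu, -1 / 2 < nu <= INR n + 1 / 2 -> exists theta, has_phase nu theta).
  { induction n as [|n IH]; intros v Hv.
    - apply has_phase_base. simpl in Hv. lra.
    - rewrite S_INR in Hv. destruct (Rle_lt_dec v (INR n + 1 / 2)); [apply IH; lra|].
      pose proof (pos_INR n).
      destruct (IH (v - 1)) as [t Ht]; [lra|].
      replace v with (v - 1 + 1) by ring. now apply (has_phase_step _ t). }
  destruct (INR_archimed 1 nu Rlt_0_1) as [n Hn]. apply (W n). lra.
Qed.

(** Near x the phase differs from its value at x by less than pi/2, hence by the arctangent of the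
    quotient of cross and dot product with the vector at x. *)
Lemma is_derive_phase (g y theta : R -> R) (x g' y' : R) : phase_of g y theta -> 0 < x ->
  is_derive g x g' -> is_derive y x y' ->
  is_derive theta x ((g x * y' - y x * g') / (g x ^ 2 + y x ^ 2)).
Proof.
  intros [Hc HM] Hx Dg Dy.
  destruct (HM x Hx) as (M & HM0 & Eg & Ey).
  assert (Hn : g x ^ 2 + y x ^ 2 = M ^ 2).
  { pose proof (sin2_cos2 (theta x)) as E. unfold Rsqr in E. rewrite Eg, Ey.
    transitivity (M ^ 2 * (sin (theta x) * sin (theta x) + cos (theta x) * cos (theta x)));
      [ring | rewrite E; ring]. }
  assert (HM2 : 0 < M ^ 2) by now apply pow_lt.
  apply is_derive_ext_loc with
    (fun z => theta x + atan ((g x * y z - y x * g z) / (g x * g z + y x * y z))).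
  - pose proof PI_RGT_0.
    assert (L : locally x (fun z => Rabs (theta z - theta x) < PI / 2)).
    { assert (HP : 0 < PI / 2) by lra.
      apply (proj1 (filterlim_locally theta (theta x)) (Hc x Hx) (mkposreal (PI / 2) HP)). }
    generalize (filter_and _ _ L (locally_above 0 x Hx)). apply filter_imp. intros z [Hz Hz0].
    apply Rabs_def2 in Hz. destruct (HM z Hz0) as (N & HN & Eg' & Ey').
    assert (Hcz : 0 < cos (theta z - theta x)) by (apply cos_gt_0; lra).
    replace ((g x * y z - y x * g z) / (g x * g z + y x * y z)) with (tan (theta z - theta x)).
    + rewrite atan_tan by lra. match goal with |- @eq _ ?a ?b => change (@eq R a b) end. ring.
    + replace (g x * y z - y x * g z) with (M * N * sin (theta z - theta x))
        by (rewrite Eg, Ey, Eg', Ey', sin_minus; ring).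
      replace (g x * g z + y x * y z) with (M * N * cos (theta z - theta x))
        by (rewrite Eg, Ey, Eg', Ey', cos_minus; ring).
      unfold tan. field. lra.
  - set (gx := g x) in *. set (yx := y x) in *.
    evar_last.
    + apply (is_derive_plus (fun _ => theta x)); [apply (is_derive_const (theta x)) |].
      apply (is_derive_comp atan (fun z => (gx * y z - yx * g z) / (gx * g z + yx * y z))).
      * apply is_derive_atan.
      * assert (Hne : gx * g x + yx * y x <> 0) by (fold gx yx; nra).
        apply (is_derive_div (fun z => gx * y z - yx * g z) (fun z => gx * g z + yx * y z) x
          (gx * y' - yx * g') (gx * g' + yx * y')); [| |easy].
        -- apply (is_derive_minus (fun z => gx * y z)); apply is_derive_scal; easy.
        -- apply (is_derive_plus (fun z => gx * g z)); apply is_derive_scal; easy.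
    + unfold plus, zero, scal; simpl; unfold mult; simpl. fold gx yx.
      replace (gx * yx - yx * gx) with 0 by ring.
      field. nra.
Qed.

(** * Phase of the derivatives *)

(** By the recurrence this is x g' - eta g, that is, x^(eta+1) times the derivative of x^(-eta)
    g. *)
Definition udiff (nu eta : R) (g g1 : R -> R) (x : R) : R := (nu - eta) * g x - x * g1 x.

Lemma is_derive_udiff (nu eta : R) (g g1 : R -> R) (x : R) : bpair nu g g1 -> 0 < x ->
  is_derive (udiff nu eta g g1) x
    (- (eta / x) * udiff nu eta g g1 x - (x ^ 2 - (nu ^ 2 - eta ^ 2)) / x * g x).
Proof.
  intros Hg Hx. destruct (Hg x Hx) as [D1 D2].
  unfold udiff. auto_derive.
  - repeat split; eexists; eassumption.
  - derive_with D1. derive_with D2. field. lra.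
Qed.

Definition uG (nu eta : R) := udiff nu eta (G nu) (G (nu + 1)).
Definition uY (nu eta : R) := udiff nu eta (Y nu) (Y (nu + 1)).

Lemma cross_u (nu eta x : R) : G nu x * uY nu eta x - Y nu x * uG nu eta x = crossGY nu x.
Proof. unfold uG, uY, udiff, crossGY, cross. ring. Qed.

(** Phase of the vector whose coordinates vanish where U' and W' do. By [dp_derive] it turns back
    before the point mu with mu^2 = nu^2 - eta^2, and forward after it. The better bound near 0 is
    conditional on a sign of G that the power series will provide. *)
Record derivative_phase (nu eta : R) (psi : R -> R) : Prop := {
  dp_phase : phase_of (uG nu eta) (uY nu eta) psi;
  dp_derive : forall x, 0 < x -> is_derive psi x
    ((x ^ 2 - (nu ^ 2 - eta ^ 2)) * (crossGY nu x / (x * (uG nu eta x ^ 2 + uY nu eta x ^ 2))));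
  dp_norm : forall x, 0 < x -> 0 < uG nu eta x ^ 2 + uY nu eta x ^ 2;
  dp_lim : is_lim (fun x => psi x - x) p_infty (- (nu * (PI / 2)) + PI / 4);
  dp_zero : exists delta, 0 < delta /\ forall x, 0 < x < delta ->
    psi x < 3 * (PI / 2) /\ (0 < G nu x * uG nu eta x -> psi x < PI / 2)
}.

(** The vector (uG, uY) lies to the left of (G, Y), their cross product being that of consecutive
    orders; its angle tends to pi/2 by the same limit as for consecutive orders. Near 0 the phase
    exceeds that of (G, Y) by less than pi; if it were pi/2 or more, G would be positive and uG
    not. *)
Lemma derivative_phase_exists (nu eta : R) : -1 / 2 < nu -> exists psi, derivative_phase nu eta psi.
Proof.
  intros Hnu. destruct (has_phase_exists nu Hnu) as [theta [[Hc HM] [Hlim (delta & Hd & Hlow)]]].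
  pose (tau := fun x => (dotGY nu x + (eta - nu) * (G nu x ^ 2 + Y nu x ^ 2)) / crossGY nu x).
  pose (psi := fun x => theta x + PI / 2 + atan (tau x)).
  exists psi.
  assert (HM2 : forall x, 0 < x -> exists M, 0 < M /\
     uG nu eta x = M * cos (psi x) /\ uY nu eta x = M * sin (psi x)).
  { intros x Hx. destruct (HM x Hx) as (M & HM0 & Eg & Ey).
    pose proof (crossGY_pos nu x Hx) as Hcr.
    destruct (rotate_phase (G nu x) (Y nu x) (uG nu eta x) (uY nu eta x) M (theta x) HM0 Eg Ey)
      as (M2 & HM2 & Eu & Ev).
    { now rewrite cross_u. }
    exists M2. split; [easy|]. rewrite cross_u in Eu, Ev.
    replace ((G nu x * uG nu eta x + Y nu x * uY nu eta x) / crossGY nu x) with (- tau x) in Eu, Ev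
      by (unfold tau, uG, uY, udiff, dotGY; field; lra).
    rewrite atan_opp in Eu, Ev. unfold psi.
    replace (theta x + PI / 2 + atan (tau x)) with (theta x + PI / 2 - - atan (tau x)) by ring.
    split; [exact Eu | exact Ev]. }
  assert (HPh : phase_of (uG nu eta) (uY nu eta) psi).
  { split; [|exact HM2]. intros x Hx.
    apply (continuous_plus (fun x => theta x + PI / 2)); [|now apply continuous_ratio].
    apply (continuous_plus theta (fun _ => PI / 2)); [now apply Hc | apply continuous_const]. }
  assert (Hnorm : forall x, 0 < x -> 0 < uG nu eta x ^ 2 + uY nu eta x ^ 2).
  { intros x Hx. destruct (HM2 x Hx) as (M & HM0 & Eu & Ev).
    pose proof (sin2_cos2 (psi x)) as E. unfold Rsqr in E. rewrite Eu, Ev.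
    replace ((M * cos (psi x)) ^ 2 + (M * sin (psi x)) ^ 2)
      with (M ^ 2 * (sin (psi x) * sin (psi x) + cos (psi x) * cos (psi x))) by ring.
    rewrite E, Rmult_1_r. now apply pow_lt. }
  split; [exact HPh | | exact Hnorm | | ].
  - intros x Hx. pose proof (Hnorm x Hx). evar_last.
    + apply (is_derive_phase (uG nu eta) (uY nu eta) psi x); [exact HPh | exact Hx | |].
      * apply is_derive_udiff; [apply bpair_G | easy].
      * apply is_derive_udiff; [apply bpair_Y | easy].
    + simpl. fold (uG nu eta) (uY nu eta). rewrite <- (cross_u nu eta).
      field. simpl in H. lra.
  - apply is_lim_ext with (fun x => (theta x - x) + (PI / 2 + atan (tau x))).
    + intros x. unfold psi. ring.
    + pose proof (is_lim_atan _ _ (ratio_lim nu (eta - nu)) : is_lim (fun x => atan (tau x)) p_infty (atan 0)).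
      limit. rewrite atan_0. field.
  - exists delta. split; [easy|]. intros x Hx. specialize (Hlow x Hx).
    pose proof (atan_bound (tau x)). split; [unfold psi; lra|].
    intros Hpos.
    destruct (HM x (proj1 Hx)) as (M & HM0 & Eg & _). destruct (HM2 x (proj1 Hx)) as (M2 & HM20 & Eu & _).
    rewrite Eg, Eu in Hpos.
    assert (Hcc : 0 < cos (theta x) * cos (psi x)).
    { apply Rmult_lt_reg_l with (M * M2); [now apply Rmult_lt_0_compat|]. lra. }
    apply Rnot_le_lt. intros Hge.
    assert (Hc1 : cos (psi x) <= 0) by (apply cos_le_0; unfold psi in *; lra).
    assert (Hc2 : 0 < cos (theta x)) by (apply cos_gt_0; unfold psi in *; lra).
    nra.
Qed.

(** * The Gamma function *)

(** The integrand of Euler's integral after the substitution t = e^u. [Gam] cuts the integral at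
    u = 0. *)
Definition kG (l u : R) : R := exp (l * u - exp u).
Definition Gam (l : R) : R := Int (kG l) + Int (fun p => kG l (- p)).

Lemma continuous_kG (l p : R) : continuous (kG l) p.
Proof. apply (ex_derive_continuous (kG l)). unfold kG. auto_derive; easy. Qed.

Lemma continuous_kG_neg (l p : R) : continuous (fun p => kG l (- p)) p.
Proof. apply (ex_derive_continuous (fun p => kG l (- p))). unfold kG. auto_derive; easy. Qed.

Lemma edom_kG (l : R) : edom (kG l).
Proof.
  split; [apply continuous_kG|]. exists (exp ((l + 1) ^ 2)), 1. split; [lra|].
  intros p Hp. unfold kG. rewrite Rabs_pos_eq by apply exp_nonneg.
  rewrite <- exp_plus. apply exp_le.
  pose proof (exp_ge_sqr p Hp). pose proof (pow2_ge_0 (p / 2 - (l + 1))). lra.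
Qed.

Lemma kG_neg_bound (l p : R) : Rabs (kG l (- p)) <= 1 * exp (- (l * p)).
Proof.
  unfold kG. rewrite Rabs_pos_eq by apply exp_nonneg. rewrite Rmult_1_l. apply exp_le.
  pose proof (exp_pos (- p)). lra.
Qed.

Lemma edom_kG_neg (l : R) : 0 < l -> edom (fun p => kG l (- p)).
Proof.
  intros Hl. split; [apply continuous_kG_neg|]. exists 1, l. split; [easy|].
  intros p _. apply kG_neg_bound.
Qed.

Lemma Gam_pos (l : R) : 0 < l -> 0 < Gam l.
Proof.
  intros Hl. unfold Gam. apply Rplus_lt_0_compat.
  - apply Int_pos; [apply edom_kG | intros; apply exp_nonneg | intros; apply exp_pos].
  - apply Int_pos; [now apply edom_kG_neg | intros; apply exp_nonneg | intros; apply exp_pos].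
Qed.

Lemma kG_succ (l u : R) : kG (l + 1) u = exp u * kG l u.
Proof. unfold kG. rewrite <- exp_plus. f_equal. ring. Qed.

Lemma Gam_S (l : R) : 0 < l -> Gam (l + 1) = l * Gam l.
Proof.
  intros Hl. unfold Gam.
  assert (E1 : Int (fun p => l * kG l p + -1 * kG (l + 1) p) = - kG l 0).
  { apply (Int_derive (kG l)).
    - intros p. rewrite kG_succ. unfold kG. auto_derive; [easy |]. unfold Rminus. ring.
    - apply edom_plus; apply edom_scal, edom_kG.
    - apply edom_kG. }
  assert (E2 : Int (fun p => - l * kG l (- p) + kG (l + 1) (- p)) = - kG l (- 0)).
  { apply (Int_derive (fun p => kG l (- p))).
    - intros p. rewrite kG_succ. unfold kG. auto_derive; [easy | unfold Rminus; ring].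
    - apply edom_plus; [apply edom_scal|]; apply edom_kG_neg; lra.
    - now apply edom_kG_neg. }
  rewrite (Int_lin l (-1) (kG l) (kG (l + 1))) in E1;
    [| apply edom_kG | apply edom_kG | easy].
  rewrite (Int_lin (- l) 1 (fun p => kG l (- p)) (fun p => kG (l + 1) (- p))) in E2;
    [| apply edom_kG_neg; lra | apply edom_kG_neg; lra | intros; ring].
  rewrite Ropp_0 in E2. lra.
Qed.

Lemma Gam_1 : Gam 1 = 1.
Proof.
  unfold Gam.
  rewrite (Int_derive (fun p => - exp (- exp p)) (kG 1)).
  - rewrite (Int_derive (fun p => exp (- exp (- p)) - 1) (fun p => kG 1 (- p))).
    + rewrite Ropp_0, exp_0. ring.
    + intros p. unfold kG. auto_derive; [easy|].
      replace (1 * - p - exp (- p)) with (- p + - exp (- p)) by ring. rewrite exp_plus; unfold Rminus; ring.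
    + apply edom_kG_neg; lra.
    + split.
      * intros p. apply (ex_derive_continuous (fun p => exp (- exp (- p)) - 1)). auto_derive; easy.
      * exists 1, 1. split; [lra|]. intros p Hp.
        pose proof (exp_ineq1_le (- exp (- p))). pose proof (exp_pos (- p)).
        assert (exp (- exp (- p)) <= exp 0) by (apply exp_le; lra). rewrite exp_0 in H1.
        rewrite !Rmult_1_l. rewrite Rabs_minus_sym, Rabs_pos_eq; lra.
  - intros p. unfold kG. auto_derive; [easy|].
    replace (1 * p - exp p) with (p + - exp p) by ring. rewrite exp_plus; unfold Rminus; ring.
  - apply edom_kG.
  - split.
    + intros p. apply (ex_derive_continuous (fun p => - exp (- exp p))). auto_derive; easy.
    + exists 1, 1. split; [lra|]. intros p Hp. rewrite Rabs_Ropp, Rabs_pos_eq by apply exp_nonneg.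
      rewrite Rmult_1_l. apply exp_le. pose proof (exp_ineq1_le p). lra.
Qed.

(** Weighted arithmetic-geometric mean inequality of 1 and e^y. *)
Lemma young (t y : R) : 0 <= t <= 1 -> exp (t * y) <= 1 - t + t * exp y.
Proof.
  intros Ht.
  assert (H1 : exp (t * y) * (1 - t * y) <= 1).
  { pose proof (exp_ineq1_le (- (t * y))). pose proof (exp_pos (t * y)).
    assert (exp (t * y) * exp (- (t * y)) = 1) by (rewrite exp_Ropp; field; lra). nra. }
  assert (H2 : exp (t * y) * (1 + (1 - t) * y) <= exp y).
  { replace (exp y) with (exp (t * y) * exp ((1 - t) * y)) by (rewrite <- exp_plus; f_equal; ring).
    apply Rmult_le_compat_l; [apply exp_nonneg | apply exp_ineq1_le]. }
  replace (exp (t * y)) with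
    ((1 - t) * (exp (t * y) * (1 - t * y)) + t * (exp (t * y) * (1 + (1 - t) * y))) by ring.
  nra.
Qed.

(** Log-convexity of the integral, from the weighted arithmetic-geometric mean inequality for its
    integrand. *)
Lemma Gam_interpolate (a m t : R) : 0 < a -> 0 < m -> 0 <= t <= 1 ->
  Gam (a + t) <= Rpower m t * ((1 - t) * Gam a + t / m * Gam (a + 1)).
Proof.
  intros Ha Hm Ht.
  assert (W : forall u, kG (a + t) u <= Rpower m t * ((1 - t) * kG a u + t / m * kG (a + 1) u)).
  { intros u. rewrite kG_succ.
    replace (kG (a + t) u) with (kG a u * (Rpower m t * exp (t * (u - ln m)))).
    - replace (Rpower m t * ((1 - t) * kG a u + t / m * (exp u * kG a u)))
        with (kG a u * (Rpower m t * (1 - t + t * (exp u / m)))) by (field; lra).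
      apply Rmult_le_compat_l; [apply exp_nonneg|].
      apply Rmult_le_compat_l; [apply exp_nonneg|].
      replace (exp u / m) with (exp (u - ln m)).
      + now apply young.
      + unfold Rminus. rewrite exp_plus, exp_Ropp, exp_ln by easy. reflexivity.
    - unfold kG, Rpower. rewrite <- !exp_plus. f_equal. ring. }
  unfold Gam.
  apply Rle_trans with
    (Int (fun p => Rpower m t * (1 - t) * kG a p + Rpower m t * (t / m) * kG (a + 1) p) +
     Int (fun p => Rpower m t * (1 - t) * kG a (- p) + Rpower m t * (t / m) * kG (a + 1) (- p))).
  - apply Rplus_le_compat; apply Int_le.
    + apply edom_kG.
    + apply edom_plus; apply edom_scal, edom_kG.
    + intros p _. specialize (W p). lra.
    + apply edom_kG_neg; lra.
    + apply edom_plus; apply edom_scal, edom_kG_neg; lra.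
    + intros p _. specialize (W (- p)). lra.
  - rewrite (Int_lin (Rpower m t * (1 - t)) (Rpower m t * (t / m)) (kG a) (kG (a + 1))
      (fun p => Rpower m t * (1 - t) * kG a p + Rpower m t * (t / m) * kG (a + 1) p));
      [| apply edom_kG | apply edom_kG | easy].
    rewrite (Int_lin (Rpower m t * (1 - t)) (Rpower m t * (t / m)) (fun p => kG a (- p))
      (fun p => kG (a + 1) (- p))
      (fun p => Rpower m t * (1 - t) * kG a (- p) + Rpower m t * (t / m) * kG (a + 1) (- p)));
      [| apply edom_kG_neg; lra | apply edom_kG_neg; lra | easy].
    right. ring.
Qed.

Lemma Gam_upper (a t : R) : 0 < a -> 0 <= t <= 1 -> Gam (a + t) <= Rpower a t * Gam a.
Proof.
  intros Ha Ht. eapply Rle_trans; [now apply (Gam_interpolate a a t)|].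
  rewrite Gam_S by easy. right. field. lra.
Qed.

Lemma Gam_lower (a t : R) : 0 < a -> 0 <= t <= 1 -> a * Gam a <= Rpower (a + t) (1 - t) * Gam (a + t).
Proof.
  intros Ha Ht. rewrite <- Gam_S by easy. replace (a + 1) with (a + t + (1 - t)) by ring.
  apply Gam_upper; lra.
Qed.

Lemma Gam_near_1_right (t : R) : 0 <= t <= 1 -> / (1 + t) <= Gam (1 + t) <= 1.
Proof.
  intros Ht. pose proof (Gam_upper 1 t Rlt_0_1 Ht) as H1. pose proof (Gam_lower 1 t Rlt_0_1 Ht) as H2.
  rewrite Gam_1 in *. replace (Rpower 1 t) with 1 in H1 by (unfold Rpower; rewrite ln_1, Rmult_0_r, exp_0; easy).
  split; [|lra].
  assert (Hp : 0 < Gam (1 + t)) by (apply Gam_pos; lra).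
  assert (Rpower (1 + t) (1 - t) <= 1 + t).
  { rewrite <- (Rpower_1 (1 + t)) at 2 by lra. destruct (Req_dec t 0) as [->|]; [right; f_equal; ring|].
    apply Rle_Rpower; lra. }
  apply Rmult_le_reg_l with (1 + t); [lra|]. rewrite Rinv_r by lra. nra.
Qed.

Lemma Gam_near_1_left (e : R) : 0 <= e < 1 -> 1 <= Gam (1 - e) <= / (1 - e).
Proof.
  intros He. assert (Hp : 0 < Gam (1 - e)) by (apply Gam_pos; lra). split.
  - pose proof (Gam_upper (1 - e) e ltac:(lra) ltac:(lra)) as H.
    replace (1 - e + e) with 1 in H by ring. rewrite Gam_1 in H.
    assert (Rpower (1 - e) e <= Rpower 1 e) by (apply Rle_Rpower_l; lra).
    unfold Rpower at 2 in H0. rewrite ln_1, Rmult_0_r, exp_0 in H0. nra.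
  - apply Rmult_le_reg_l with (1 - e); [lra|]. rewrite Rinv_r, <- Gam_S by lra.
    replace (1 - e + 1) with (1 + (1 - e)) by ring. apply Gam_near_1_right. lra.
Qed.

(** * Euler's limit *)

(** The sequence in Euler's limit for 1/Gamma. *)
Definition euler (z : R) (n : nat) : R :=
  prod_f_R0 (fun i => z + INR i) n / (INR (fact n) * Rpower (INR n) z).

Lemma prod_shift (z : R) (n : nat) :
  z * prod_f_R0 (fun i => z + 1 + INR i) n = prod_f_R0 (fun i => z + INR i) n * (z + INR n + 1).
Proof.
  induction n as [|n IH].
  - simpl. ring.
  - change (prod_f_R0 (fun i => z + 1 + INR i) (S n))
      with (prod_f_R0 (fun i => z + 1 + INR i) n * (z + 1 + INR (S n))).
    change (prod_f_R0 (fun i => z + INR i) (S n))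
      with (prod_f_R0 (fun i => z + INR i) n * (z + INR (S n))).
    rewrite <- Rmult_assoc, IH, S_INR. ring.
Qed.

Lemma euler_shift (z : R) (n : nat) : (1 <= n)%nat ->
  z * euler (z + 1) n = euler z n * (1 + (z + 1) * / INR n).
Proof.
  intros Hn. assert (HN : 0 < INR n) by (apply lt_0_INR; lia).
  unfold euler. rewrite Rpower_plus, Rpower_1 by easy.
  pose proof (INR_fact_lt_0 n). assert (0 < Rpower (INR n) z) by apply exp_pos.
  replace (z * (prod_f_R0 (fun i => z + 1 + INR i) n / (INR (fact n) * (Rpower (INR n) z * INR n))))
    with ((z * prod_f_R0 (fun i => z + 1 + INR i) n) / (INR (fact n) * (Rpower (INR n) z * INR n)))
    by (field; lra).
  rewrite prod_shift. field. lra.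
Qed.

Lemma prod_Gam (t : R) (n : nat) : 0 < t ->
  prod_f_R0 (fun i => t + INR i) n * Gam t = Gam (t + INR n + 1).
Proof.
  intros Ht. induction n as [|n IH].
  - simpl. rewrite Rplus_0_r, Gam_S by easy. ring.
  - change (prod_f_R0 (fun i => t + INR i) (S n))
      with (prod_f_R0 (fun i => t + INR i) n * (t + INR (S n))).
    pose proof (pos_INR n).
    rewrite Rmult_assoc, (Rmult_comm (t + INR (S n))), <- Rmult_assoc, IH, S_INR.
    replace (t + (INR n + 1) + 1) with ((t + INR n + 1) + 1) by ring.
    rewrite (Gam_S (t + INR n + 1)) by lra. ring.
Qed.

Lemma Gam_fact (n : nat) : Gam (INR n + 1) = INR (fact n).
Proof.
  induction n as [|n IH].
  - simpl. rewrite Rplus_0_l. apply Gam_1.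
  - pose proof (pos_INR n). rewrite S_INR, Gam_S, IH by lra.
    rewrite fact_simpl, mult_INR, S_INR. ring.
Qed.

(** The Bohr-Mollerup argument: by log-convexity, Gam (n + t) / Gam n lies between n^t / (1 + t/n)
    and n^t. *)
Lemma euler_Gam_bounds (t : R) (n : nat) : 0 < t <= 1 -> (1 <= n)%nat ->
  1 <= euler t n * Gam t <= 1 + t * / INR n.
Proof.
  intros Ht Hn. assert (HN : 0 < INR n) by (apply lt_0_INR; lia).
  pose proof (INR_fact_lt_0 n) as Hf. assert (HR : 0 < Rpower (INR n) t) by apply exp_pos.
  assert (E : euler t n * Gam t = (INR n + t) * Gam (INR n + t) / (INR (fact n) * Rpower (INR n) t)).
  { unfold euler. rewrite <- Gam_S by lra. replace (INR n + t + 1) with (t + INR n + 1) by ring.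
    rewrite <- prod_Gam by lra. field. lra. }
  rewrite E.
  assert (Hfn : INR (fact n) = INR n * Gam (INR n)).
  { rewrite <- Gam_fact. now apply Gam_S. }
  pose proof (Gam_upper (INR n) t HN ltac:(lra)) as Hu.
  pose proof (Gam_lower (INR n) t HN ltac:(lra)) as Hl.
  rewrite <- Hfn in Hl.
  assert (HG : 0 < Gam (INR n)) by now apply Gam_pos.
  assert (HG2 : 0 < Gam (INR n + t)) by (apply Gam_pos; lra).
  split.
  - apply Rmult_le_reg_r with (INR (fact n) * Rpower (INR n) t); [now apply Rmult_lt_0_compat|].
    unfold Rdiv. rewrite Rmult_assoc, Rinv_l, Rmult_1_l, Rmult_1_r by nra.
    apply Rle_trans with (Rpower (INR n + t) (1 - t) * Gam (INR n + t) * Rpower (INR n + t) t).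
    + apply Rmult_le_compat; try lra. apply Rle_Rpower_l; lra.
    + right. replace (Rpower (INR n + t) (1 - t) * Gam (INR n + t) * Rpower (INR n + t) t)
        with (Rpower (INR n + t) (1 - t) * Rpower (INR n + t) t * Gam (INR n + t)) by ring.
      rewrite <- Rpower_plus. replace (1 - t + t) with 1 by ring. rewrite Rpower_1 by lra. ring.
  - rewrite Hfn. apply Rmult_le_reg_r with (INR n * Gam (INR n) * Rpower (INR n) t).
    { repeat apply Rmult_lt_0_compat; easy. }
    unfold Rdiv. rewrite Rmult_assoc, Rinv_l, Rmult_1_r.
    2:{ apply Rgt_not_eq. repeat apply Rmult_lt_0_compat; easy. }
    replace ((1 + t * / INR n) * (INR n * Gam (INR n) * Rpower (INR n) t))
      with ((INR n + t) * (Rpower (INR n) t * Gam (INR n))) by (field; lra).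
    apply Rmult_le_compat_l; lra.
Qed.

Lemma is_lim_seq_inv_INR : is_lim_seq (fun n => / INR n) 0.
Proof. apply (is_lim_seq_inv INR p_infty); [apply is_lim_seq_INR | easy]. Qed.

Lemma euler_lim_unit (t : R) : 0 < t <= 1 -> is_lim_seq (euler t) (/ Gam t).
Proof.
  intros Ht. assert (HG : 0 < Gam t) by (apply Gam_pos; lra).
  apply is_lim_seq_ext with (fun n => euler t n * Gam t * / Gam t).
  { intros n. field. lra. }
  assert (L : is_lim_seq (fun n => euler t n * Gam t) 1).
  { apply is_lim_seq_le_le_loc with (fun _ => 1) (fun n => 1 + t * / INR n).
    - exists 1%nat. intros n Hn. now apply euler_Gam_bounds.
    - apply is_lim_seq_const.
    - pose proof is_lim_seq_inv_INR. limit. ring. }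
  apply (is_lim_seq_value _ (1 * / Gam t)); [|ring].
  apply (is_lim_seq_mult' _ _ 1 (/ Gam t)); [exact L | apply is_lim_seq_const].
Qed.

Lemma shift_factor_lim (z : R) : is_lim_seq (fun n => 1 + (z + 1) * / INR n) 1.
Proof.
  pose proof is_lim_seq_inv_INR. limit. ring.
Qed.

Lemma euler_lim_up (z l : R) : z <> 0 -> is_lim_seq (euler z) l -> is_lim_seq (euler (z + 1)) (l / z).
Proof.
  intros Hz Hl. apply is_lim_seq_ext_loc with (fun n => euler z n * (1 + (z + 1) * / INR n) * / z).
  - exists 1%nat. intros n Hn. rewrite <- euler_shift by easy. field. easy.
  - pose proof (shift_factor_lim z). limit. field. easy.
Qed.

Lemma euler_lim_down (z l : R) : is_lim_seq (euler (z + 1)) l -> is_lim_seq (euler z) (z * l).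
Proof.
  intros Hl.
  apply is_lim_seq_ext_loc with (fun n => z * euler (z + 1) n * / (1 + (z + 1) * / INR n)).
  - assert (E : eventually (fun n => 0 < 1 + (z + 1) * / INR n)).
    { pose proof (shift_factor_lim z) as L. apply is_lim_seq_spec in L.
      destruct (L (mkposreal 1 Rlt_0_1)) as [N HN]. exists N. intros n Hn.
      specialize (HN n Hn). simpl in HN. apply Rabs_def2 in HN. lra. }
    destruct E as [N HN]. exists (S N). intros n Hn. specialize (HN n ltac:(lia)).
    rewrite euler_shift by lia. field.
    assert (0 < INR n) by (apply lt_0_INR; lia). split; [lra|].
    intros E. replace (1 + (z + 1) * / INR n) with ((INR n + (z + 1)) / INR n) in HN by (field; lra).
    rewrite E in HN. unfold Rdiv in HN. lra.
  - assert (L : is_lim_seq (fun n => / (1 + (z + 1) * / INR n)) (/ 1)).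
    { apply (is_lim_seq_inv _ 1); [apply shift_factor_lim|]. intros E. injection E. lra. }
    limit. field.
Qed.

Lemma euler_lim_pos (n : nat) : forall z, 0 < z <= INR n + 1 -> exists l : R, is_lim_seq (euler z) l /\ 0 < l.
Proof.
  induction n as [|n IH]; intros z Hz.
  - simpl in Hz. exists (/ Gam z). split; [apply euler_lim_unit; lra|].
    apply Rinv_0_lt_compat, Gam_pos; lra.
  - rewrite S_INR in Hz. destruct (Rle_lt_dec z (INR n + 1)); [apply IH; lra|].
    pose proof (pos_INR n). destruct (IH (z - 1)) as (l & Hl & Hp); [lra|].
    exists (l / (z - 1)). split; [|apply Rdiv_lt_0_compat; lra].
    replace z with (z - 1 + 1) at 1 by ring. apply euler_lim_up; [lra | easy].
Qed.

Lemma rGamma_unique (z l : R) : is_lim_seq (euler z) l -> rGamma z = l.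
Proof. intros H. unfold rGamma. fold (euler z). now rewrite (is_lim_seq_unique _ _ H). Qed.

Lemma INR_above (z : R) : exists n, z <= INR n.
Proof. destruct (INR_archimed 1 z Rlt_0_1) as [n Hn]. exists n. lra. Qed.

Lemma rGamma_pos (z : R) : 0 < z -> 0 < rGamma z.
Proof.
  intros Hz. destruct (INR_above z) as [n Hn].
  destruct (euler_lim_pos n z) as (l & Hl & Hp); [lra|]. now rewrite (rGamma_unique z l).
Qed.

(** Existence of the limit on (0, 1] propagates to all of R by the functional equation, upwards
    and downwards. *)
Lemma rGamma_lim (z : R) : is_lim_seq (euler z) (rGamma z).
Proof.
  assert (W : forall n z, - INR n < z -> exists l : R, is_lim_seq (euler z) l).
  { induction n as [|n IH]; intros w Hw.
    - simpl in Hw. destruct (INR_above w) as [n Hn].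
      destruct (euler_lim_pos n w) as (l & Hl & Hp); [lra|]. now exists l.
    - rewrite S_INR in Hw. destruct (IH (w + 1)) as [l Hl]; [lra|].
      exists (w * l). now apply euler_lim_down. }
  destruct (INR_above (1 - z)) as [n Hn]. destruct (W n z) as [l Hl]; [lra|].
  now rewrite (rGamma_unique z l).
Qed.

Lemma rGamma_S (z : R) : rGamma z = z * rGamma (z + 1).
Proof. apply rGamma_unique. apply euler_lim_down. apply rGamma_lim. Qed.

Lemma rGamma_Gam (t : R) : 0 < t <= 1 -> rGamma t = / Gam t.
Proof. intros Ht. now apply rGamma_unique, euler_lim_unit. Qed.

Lemma rGamma_neq_0 (z : R) : (forall n, z + INR n <> 0) -> rGamma z <> 0.
Proof.
  assert (W : forall n z, - INR n < z -> (forall n, z + INR n <> 0) -> rGamma z <> 0).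
  { induction n as [|n IH]; intros w Hw Hz.
    - simpl in Hw. apply Rgt_not_eq, rGamma_pos. lra.
    - rewrite S_INR in Hw. rewrite rGamma_S. apply Rmult_integral_contrapositive. split.
      + specialize (Hz 0%nat). simpl in Hz. lra.
      + apply IH; [lra|]. intros m. specialize (Hz (S m)). rewrite S_INR in Hz. lra. }
  destruct (INR_above (1 - z)) as [n Hn]. apply (W n). lra.
Qed.

(** * Laplace integrals with a power weight near 0 *)

Lemma kernel_exp : kernel exp.
Proof.
  split.
  - intros p. apply (ex_derive_continuous exp). auto_derive; easy.
  - intros p Hp. pose proof (exp_pos p). repeat split; lra.
Qed.

Lemma expo_exp1 (l : R) : expo (fun p => exp (l * p)).
Proof. apply expo_ext with (fun p => 1 * exp (l * p)); [intros; ring | apply expo_exp]. Qed.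

Lemma Int_tail (f : R -> R) (M d s : R) : (forall p, continuous f p) -> 0 < d -> 0 <= s ->
  (forall p, 0 <= p -> Rabs (f p) <= M * exp (- (d * p))) ->
  Rabs (Int f - RInt f 0 s) <= M / d * exp (- (d * s)).
Proof.
  intros Hc Hd Hs Hb.
  assert (Hf : edom f) by (split; [easy | now exists M, d]).
  apply (is_lim_le_loc (fun b => Rabs (RInt f 0 b - RInt f 0 s)) (fun _ => M / d * exp (- (d * s)))
    p_infty (Rabs (Int f - RInt f 0 s)) (M / d * exp (- (d * s)))).
  - exists s. intros b Hbs. rewrite <- (RInt_Chasles_R f 0 s b) by easy.
    replace (RInt f 0 s + RInt f s b - RInt f 0 s) with (RInt f s b) by lra.
    apply (edom_tail f M d); try easy. lra.
  - apply (is_lim_comp_continuous (fun b => RInt f 0 b - RInt f 0 s) Rabs p_infty (Int f - RInt f 0 s));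
      [|apply continuous_Rabs].
    apply is_lim_minus'; [now apply Int_correct | apply is_lim_const].
  - apply is_lim_const.
Qed.

(** The substitution e^u = x e^p turns the left-hand integral into Euler's integral without its
    part below ln x. *)
Lemma power_Lap_exp (l x : R) : 0 < l -> 0 < x < 1 ->
  Rabs (Rpower x l * Lap exp (fun p => exp (l * p)) x - Gam l) <= Rpower x l / l.
Proof.
  intros Hl Hx. set (s := - ln x).
  assert (Hs : 0 < s).
  { unfold s. rewrite <- ln_1 at 1. pose proof (ln_increasing x 1 (proj1 Hx) (proj2 Hx)).
    rewrite ln_1 in H |- *. lra. }
  assert (E : Rpower x l * Lap exp (fun p => exp (l * p)) x = RInt (fun p => kG l (- p)) 0 s + Int (kG l)).
  { unfold Lap. rewrite <- Int_scal by (apply Lap_edom; [apply kernel_exp | apply expo_exp1 | easy]).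
    rewrite (Int_ext _ (fun p => kG l (p - s))).
    2:{ intros p _. unfold kG, Rpower, s. rewrite <- !exp_plus. f_equal.
        replace (p - - ln x) with (p + ln x) by ring. rewrite exp_plus, exp_ln by easy. ring. }
    apply Int_unique.
    assert (DK : forall u, is_derive (fun u => RInt (kG l) 0 u) u (kG l u)).
    { intros u. apply (is_derive_RInt (kG l) _ 0); [|apply continuous_kG].
      exists (mkposreal 1 Rlt_0_1). intros z _. apply (RInt_correct (kG l)), continuous_RInt, continuous_kG. }
    set (K := fun u => RInt (kG l) 0 u) in *.
    assert (EK : RInt (fun p => kG l (- p)) 0 s = - K (- s)).
    { apply is_RInt_unique. evar_last.
      - apply (is_RInt_derive (fun p => - K (- p))); intros p _; [|apply continuous_kG_neg].
        pose proof (DK (- p)) as D. auto_derive; [now exists (kG l (- p)) | derive_with D; ring].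
      - unfold minus, plus, opp; simpl. unfold K at 2. rewrite Ropp_0, (RInt_point 0 (kG l)).
        change (zero : R) with 0. ring. }
    apply is_lim_ext with (fun b => RInt (fun p => kG l (- p)) 0 s + K (b - s)).
    - intros b. rewrite EK. symmetry. apply is_RInt_unique. evar_last.
      + apply (is_RInt_derive (fun p => K (p - s)) (fun p => kG l (p - s))); intros p _.
        * pose proof (DK (p - s)) as D.
          auto_derive; [now exists (kG l (p - s)) | change (p + - s) with (p - s); derive_with D; ring].
        * apply (ex_derive_continuous (fun p => kG l (p - s))). unfold kG. auto_derive; easy.
      + unfold minus, plus, opp; simpl. unfold Rminus. rewrite Rplus_0_l. ring.
    - apply is_lim_plus'; [apply is_lim_const|].
      apply (is_lim_comp (fun b => RInt (kG l) 0 b) (fun b => b - s) p_infty (Int (kG l)) p_infty).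
      + apply Int_correct, edom_kG.
      + apply is_lim_spec. intros B. exists (B + s). intros b Hb. lra.
      + exists 0. intros b _. easy. }
  rewrite E. unfold Gam.
  replace (RInt (fun p => kG l (- p)) 0 s + Int (kG l) - (Int (kG l) + Int (fun p => kG l (- p))))
    with (- (Int (fun p => kG l (- p)) - RInt (fun p => kG l (- p)) 0 s)) by ring.
  rewrite Rabs_Ropp.
  replace (Rpower x l / l) with (1 / l * exp (- (l * s))).
  - apply Int_tail; [apply continuous_kG_neg | easy | lra | intros p _; apply kG_neg_bound].
  - unfold Rpower, s. replace (- (l * - ln x)) with (l * ln x) by ring. field. lra.
Qed.

Definition EL (l x : R) : R := Lap gh (fun p => exp (l * p)) x.

Lemma gs_ge (p : R) : 0 <= p -> exp (- p) / 2 <= gs p.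
Proof.
  intros Hp. unfold gs. rewrite exp_Ropp. pose proof (exp_pos p).
  assert (cosh p <= exp p) by now apply cosh_le_exp.
  pose proof (cosh_ge_1 p).
  apply Rle_trans with (/ exp p); [|apply Rinv_le_contravar; lra].
  assert (0 < / exp p) by now apply Rinv_0_lt_compat. lra.
Qed.

(** cosh - 1/cosh lies below exp / 2 by at most 1, so that the integrals differ by a factor of at
    most e^x. *)
Lemma EL_bounds (l x : R) : 0 < x ->
  Lap exp (fun p => exp (l * p)) (x / 2) <= EL l x <= exp x * Lap exp (fun p => exp (l * p)) (x / 2).
Proof.
  intros Hx.
  assert (E1 : edom (fun p => exp (- (x * gh p)) * exp (l * p))).
  { apply Lap_edom; [apply kernel_gh | apply expo_exp1 | easy]. }
  assert (E2 : edom (fun p => exp (- (x / 2 * exp p)) * exp (l * p))).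
  { apply Lap_edom; [apply kernel_exp | apply expo_exp1 | lra]. }
  assert (W : forall p, 0 <= p -> 0 <= exp p / 2 - gh p <= 1).
  { intros p Hp. unfold gh. fold (gs p). pose proof (gs_ge p Hp). pose proof (gs_range p).
    unfold cosh. pose proof (exp_pos (- p)). lra. }
  unfold EL, Lap. split.
  - apply Int_le; [easy | easy |]. intros p Hp. apply Rmult_le_compat_r; [apply exp_nonneg|].
    apply exp_le. pose proof (W p Hp). nra.
  - rewrite <- Int_scal by easy. apply Int_le; [easy | now apply edom_scal |].
    intros p Hp. rewrite <- Rmult_assoc. apply Rmult_le_compat_r; [apply exp_nonneg|].
    rewrite <- exp_plus. apply exp_le. pose proof (W p Hp). nra.
Qed.

(** Limits at 0 from the right are taken along this sequence, which stays in (0, 1). Up to a shift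
    it is the sequence by which [Lim] at a finite point is defined. *)
Definition xs (n : nat) : R := / (INR n + 2).

Lemma xs_range (n : nat) : 0 < xs n < 1.
Proof.
  unfold xs. pose proof (pos_INR n). split; [apply Rinv_0_lt_compat; lra|].
  rewrite <- Rinv_1. apply Rinv_lt_contravar; lra.
Qed.

Lemma xs_lim : is_lim_seq xs 0.
Proof.
  apply (is_lim_seq_inv (fun n => INR n + 2) p_infty); [|easy].
  apply (is_lim_seq_plus INR (fun _ => 2) p_infty 2); [apply is_lim_seq_INR | apply is_lim_seq_const | easy].
Qed.

Lemma xs_power_lim (s : R) : 0 < s -> is_lim_seq (fun n => Rpower (xs n) s) 0.
Proof.
  intros Hs. apply is_lim_seq_spec. intros eps.
  pose proof xs_lim as L. apply is_lim_seq_spec in L.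
  assert (Hp : 0 < Rpower eps (/ s)) by apply exp_pos.
  destruct (L (mkposreal _ Hp)) as [N HN]. exists N. intros n Hn. specialize (HN n Hn).
  rewrite Rminus_0_r in *. pose proof (xs_range n).
  change (pos (mkposreal _ Hp)) with (Rpower eps (/ s)) in HN.
  rewrite Rabs_pos_eq in HN by lra. rewrite Rabs_pos_eq by apply exp_nonneg.
  replace (pos eps) with (Rpower (Rpower eps (/ s)) s).
  - apply Rlt_Rpower_l; lra.
  - rewrite Rpower_mult, Rinv_l, Rpower_1; [easy | apply cond_pos | lra].
Qed.

Lemma EL_lim (l : R) : 0 < l ->
  is_lim_seq (fun n => Rpower (xs n) l * EL l (xs n)) (Rpower 2 l * Gam l).
Proof.
  intros Hl.
  set (T := fun n => Rpower (xs n / 2) l * Lap exp (fun p => exp (l * p)) (xs n / 2)).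
  assert (HT : is_lim_seq T (Gam l)).
  { apply is_lim_seq_ext with (fun n => (T n - Gam l) + Gam l); [intros; ring|].
    apply (is_lim_seq_value _ (0 + Gam l)); [|ring].
    apply is_lim_seq_plus'; [|apply is_lim_seq_const].
    apply is_lim_seq_abs_0.
    apply is_lim_seq_le_le with (fun _ => 0) (fun n => Rpower (xs n) l * / l).
    - intros n. split; [apply Rabs_pos|]. pose proof (xs_range n).
      eapply Rle_trans; [apply power_Lap_exp; [easy|lra]|].
      apply Rmult_le_compat_r; [left; now apply Rinv_0_lt_compat|]. apply Rle_Rpower_l; lra.
    - apply is_lim_seq_const.
    - pose proof (xs_power_lim l Hl). limit. ring. }
  assert (E : forall n, Rpower (xs n) l * Lap exp (fun p => exp (l * p)) (xs n / 2) = Rpower 2 l * T n).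
  { intros n. pose proof (xs_range n). unfold T.
    replace (Rpower (xs n) l) with (Rpower 2 l * Rpower (xs n / 2) l); [ring|].
    rewrite Rpower_mult_distr by lra. f_equal. field. }
  apply is_lim_seq_le_le with (fun n => Rpower 2 l * T n) (fun n => exp (xs n) * (Rpower 2 l * T n)).
  - intros n. pose proof (xs_range n). rewrite <- E.
    destruct (EL_bounds l (xs n) ltac:(lra)) as [H1 H2].
    assert (0 < Rpower (xs n) l) by apply exp_pos. split.
    + apply Rmult_le_compat_l; lra.
    + replace (exp (xs n) * (Rpower (xs n) l * Lap exp (fun p => exp (l * p)) (xs n / 2)))
        with (Rpower (xs n) l * (exp (xs n) * Lap exp (fun p => exp (l * p)) (xs n / 2))) by ring.
      apply Rmult_le_compat_l; lra.
  - limit. easy.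
  - assert (L : is_lim_seq (fun n => exp (xs n)) (exp 0)).
    { apply (is_lim_seq_continuous exp); [|apply xs_lim]. apply derivable_continuous_pt, derivable_pt_exp. }
    limit. rewrite exp_0. ring.
Qed.

(** * The power series *)

Definition cJ (nu : R) (m : nat) : R := (-1) ^ m * rGamma (INR m + nu + 1) / INR (fact m).
Definition fJ (nu y : R) : R := PSeries (cJ nu) y.

(** Orders at which no coefficient of the series vanishes. *)
Definition regular (nu : R) : Prop := forall n : nat, nu + 1 + INR n <> 0.

Lemma regular_S (nu : R) : regular nu -> regular (nu + 1).
Proof. intros H n. specialize (H (S n)). rewrite S_INR in H. lra. Qed.

Lemma regular_pos (nu : R) : -1 < nu -> regular nu.
Proof. intros H n. pose proof (pos_INR n). lra. Qed.

Lemma cJ_neq_0 (nu : R) (m : nat) : regular nu -> cJ nu m <> 0.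
Proof.
  intros H. unfold cJ. pose proof (INR_fact_neq_0 m).
  apply Rmult_integral_contrapositive. split; [|now apply Rinv_neq_0_compat].
  apply Rmult_integral_contrapositive. split; [apply pow_nonzero; lra|].
  apply rGamma_neq_0. intros n. specialize (H (m + n)%nat). rewrite plus_INR in H. lra.
Qed.

Lemma cJ_S (nu : R) (m : nat) : INR (S m) * cJ nu (S m) = - cJ (nu + 1) m.
Proof.
  unfold cJ. rewrite fact_simpl, mult_INR, S_INR.
  replace (INR m + 1 + nu + 1) with (INR m + (nu + 1) + 1) by ring.
  pose proof (INR_fact_neq_0 m). pose proof (pos_INR m). simpl pow. field. split; lra.
Qed.

Lemma cJ_pred (nu : R) (m : nat) : cJ (nu - 1) m = (INR m + nu) * cJ nu m.
Proof.
  unfold cJ. replace (INR m + (nu - 1) + 1) with (INR m + nu) by ring.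
  rewrite (rGamma_S (INR m + nu)). field. apply INR_fact_neq_0.
Qed.

(** The ratio of consecutive coefficients is -1/((m+1)(m+nu+1)). *)
Lemma cJ_CV (nu : R) : regular nu -> CV_radius (cJ nu) = p_infty.
Proof.
  intros H. apply CV_radius_infinite_DAlembert; [intros n; now apply cJ_neq_0|].
  apply is_lim_seq_ext_loc with (fun n => / INR (S n) * / (INR n + (nu + 1))).
  - destruct (INR_above (- (nu + 1) + 1)) as [N HN]. exists N. intros n Hn.
    assert (INR N <= INR n) by now apply le_INR.
    pose proof (cJ_S nu n) as E. pose proof (cJ_pred (nu + 1) n) as E2.
    replace (nu + 1 - 1) with nu in E2 by ring.
    pose proof (cJ_neq_0 nu n H).
    assert (HS : 0 < INR (S n)) by (apply lt_0_INR; lia).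
    assert (Hp : 0 < INR n + (nu + 1)) by lra.
    replace (cJ nu (S n) / cJ nu n) with (- (/ INR (S n) * / (INR n + (nu + 1)))).
    + rewrite Rabs_Ropp, Rabs_pos_eq; [easy|]. left.
      apply Rmult_lt_0_compat; now apply Rinv_0_lt_compat.
    + assert (Hc : cJ (nu + 1) n <> 0) by (apply cJ_neq_0, regular_S, H).
      replace (cJ nu (S n)) with (- cJ (nu + 1) n / INR (S n)) by (rewrite <- E; field; lra).
      rewrite E2. field. repeat split; lra.
  - apply (is_lim_seq_value _ (0 * 0)); [|ring]. apply is_lim_seq_mult'.
    + apply (is_lim_seq_incr_1 (fun n => / INR n)). apply is_lim_seq_inv_INR.
    + apply (is_lim_seq_inv (fun n => INR n + (nu + 1)) p_infty); [|easy].
      apply (is_lim_seq_plus INR (fun _ => nu + 1) p_infty (nu + 1));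
        [apply is_lim_seq_INR | apply is_lim_seq_const | easy].
Qed.

Lemma is_derive_fJ (nu y : R) : regular nu -> is_derive (fJ nu) y (- fJ (nu + 1) y).
Proof.
  intros H. unfold fJ. rewrite <- PSeries_opp.
  rewrite (PSeries_ext (PS_opp (cJ (nu + 1))) (PS_derive (cJ nu))).
  - apply is_derive_PSeries. now rewrite cJ_CV.
  - intros n. unfold PS_opp, PS_derive. rewrite cJ_S. reflexivity.
Qed.

(** The coefficients satisfy c_(nu-1) = (m + nu) c_nu, and m c_m are the coefficients of y f'. *)
Lemma fJ_pred (nu y : R) : regular nu -> fJ (nu - 1) y = nu * fJ nu y - y * fJ (nu + 1) y.
Proof.
  intros H.
  assert (Hd : PSeries (PS_derive (cJ nu)) y = - fJ (nu + 1) y).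
  { unfold fJ. rewrite <- PSeries_opp. apply PSeries_ext.
    intros n. unfold PS_opp, PS_derive. rewrite cJ_S. reflexivity. }
  transitivity (nu * fJ nu y + y * - fJ (nu + 1) y); [|ring].
  rewrite <- Hd, <- PSeries_incr_1. unfold fJ. rewrite <- PSeries_scal.
  rewrite <- PSeries_plus.
  - apply PSeries_ext. intros n. rewrite cJ_pred.
    destruct n as [|n].
    + change ((0 + nu) * cJ nu 0 = nu * cJ nu 0 + 0). ring.
    + change ((INR (S n) + nu) * cJ nu (S n) = nu * cJ nu (S n) + INR (S n) * cJ nu (S n)). ring.
  - apply ex_pseries_scal; [apply Rmult_comm|]. apply CV_radius_inside. now rewrite cJ_CV.
  - apply CV_radius_inside. rewrite CV_radius_incr_1, CV_radius_derive. now rewrite cJ_CV.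
Qed.

Lemma BesselJ_eq_fJ (nu x : R) : BesselJ nu x = Rpower (x / 2) nu * fJ nu (x ^ 2 / 4).
Proof. reflexivity. Qed.

Lemma BesselJ_three_terms (nu x : R) : regular nu -> 0 < x ->
  BesselJ (nu - 1) x = 2 * nu / x * BesselJ nu x - BesselJ (nu + 1) x.
Proof.
  intros H Hx. rewrite !BesselJ_eq_fJ, fJ_pred by easy.
  unfold Rminus at 1. rewrite !Rpower_plus, Rpower_Ropp, Rpower_1 by lra. field. lra.
Qed.

Lemma is_derive_J_up (nu x : R) : regular nu -> 0 < x ->
  is_derive (BesselJ nu) x (nu / x * BesselJ nu x - BesselJ (nu + 1) x).
Proof.
  intros H Hx.
  apply (is_derive_ext (fun x => exp (nu * ln (x / 2)) * fJ nu (x ^ 2 / 4))); [reflexivity|].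
  pose proof (is_derive_fJ nu (x ^ 2 / 4) H) as D.
  rewrite !BesselJ_eq_fJ, Rpower_plus, Rpower_1 by lra. unfold Rpower.
  auto_derive.
  - split; [lra|]. split; [|easy].
    replace (x * (x * 1) * / 4) with (x ^ 2 / 4) by (simpl; field). now exists (- fJ (nu + 1) (x ^ 2 / 4)).
  - replace (x * (x * 1) * / 4) with (x ^ 2 / 4) by (simpl; field).
    replace (x * / 2) with (x / 2) by field.
    derive_with D. field. lra.
Qed.

Lemma is_derive_J_down (nu x : R) : regular nu -> 0 < x ->
  is_derive (BesselJ nu) x (BesselJ (nu - 1) x - nu / x * BesselJ nu x).
Proof.
  intros H Hx. evar_last; [now apply is_derive_J_up|].
  simpl. rewrite BesselJ_three_terms by easy. field. lra.
Qed.

Lemma bpair_J (nu : R) : regular nu -> bpair nu (BesselJ nu) (BesselJ (nu + 1)).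
Proof.
  intros H x Hx. split; [now apply is_derive_J_up|].
  evar_last; [apply is_derive_J_down; [now apply regular_S | easy]|].
  simpl. now replace (nu + 1 - 1) with nu by ring.
Qed.

Lemma fJ_xs_lim (nu : R) : regular nu -> is_lim_seq (fun n => fJ nu (xs n ^ 2 / 4)) (rGamma (nu + 1)).
Proof.
  intros H.
  replace (rGamma (nu + 1)) with (fJ nu 0).
  2:{ unfold fJ. rewrite PSeries_0. unfold cJ. simpl. rewrite Rplus_0_l. field. }
  apply (is_lim_seq_continuous (fJ nu) (fun n => xs n ^ 2 / 4)).
  - apply continuity_pt_filterlim. apply (ex_derive_continuous (fJ nu)).
    exists (- fJ (nu + 1) 0). now apply is_derive_fJ.
  - apply is_lim_seq_ext with (fun n => xs n * xs n * / 4); [intros; simpl; field|].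
    pose proof xs_lim. limit. ring.
Qed.

Lemma J_xs_lim (nu : R) : regular nu ->
  is_lim_seq (fun n => Rpower (xs n) (- nu) * BesselJ nu (xs n)) (Rpower 2 (- nu) * rGamma (nu + 1)).
Proof.
  intros H.
  apply is_lim_seq_ext with (fun n => Rpower 2 (- nu) * fJ nu (xs n ^ 2 / 4)).
  - intros n. pose proof (xs_range n). rewrite BesselJ_eq_fJ, <- Rmult_assoc. f_equal.
    unfold Rpower. rewrite <- exp_plus. f_equal.
    rewrite ln_div by lra. ring.
  - pose proof (fJ_xs_lim nu H). limit. easy.
Qed.

(** * The Bessel function of the first kind as an integral *)

Lemma xs_Lap_small (A : R -> R) (C l s : R) : expo A -> 0 <= l < s ->
  (forall p, 0 <= p -> Rabs (A p) <= C * exp (l * p)) ->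
  is_lim_seq (fun n => Rpower (xs n) s * Lap gh A (xs n)) 0.
Proof.
  intros HA Hls HC.
  destruct (Lap_small gh A C l ((l + s) / 2) kernel_gh HA ltac:(lra) HC) as (K & HK & Hb).
  apply is_lim_seq_abs_0.
  apply is_lim_seq_le_le with (fun _ => 0) (fun n => K * Rpower (xs n) (s - (l + s) / 2)).
  - intros n. pose proof (xs_range n). split; [apply Rabs_pos|].
    rewrite Rabs_mult, (Rabs_pos_eq (Rpower _ _)) by apply exp_nonneg.
    unfold Rminus at 1. rewrite Rpower_plus.
    replace (K * (Rpower (xs n) s * Rpower (xs n) (- ((l + s) / 2))))
      with (Rpower (xs n) s * (K * Rpower (xs n) (- ((l + s) / 2)))) by ring.
    apply Rmult_le_compat_l; [apply exp_nonneg|]. apply Hb. lra.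
  - apply is_lim_seq_const.
  - pose proof (xs_power_lim (s - (l + s) / 2) ltac:(lra)). limit. ring.
Qed.

Lemma sin_ge_mul_cos (y : R) : 0 <= y <= PI / 2 -> y * cos y <= sin y.
Proof.
  intros Hy. destruct (MVT_derive (fun y => sin y - y * cos y) (fun y => y * sin y) 0 y) as (c & Hc & E).
  - lra.
  - intros x _. auto_derive; [easy | ring].
  - rewrite sin_0, Rmult_0_l in E.
    assert (0 <= sin c) by (apply sin_ge_0; lra).
    assert (0 <= c * sin c * (y - 0)) by (apply Rmult_le_pos; [apply Rmult_le_pos|]; lra). lra.
Qed.

Lemma sin_ge_half (x : R) : 0 <= x <= PI / 2 -> x / 2 <= sin x.
Proof.
  intros Hx. pose proof (sin_ge_mul_cos (x / 2) ltac:(lra)) as H.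
  assert (Hc : 0 <= cos x) by (apply cos_ge_0; lra).
  replace x with (2 * (x / 2)) in Hc by field. rewrite cos_2a_cos in Hc.
  replace (sin x) with (2 * sin (x / 2) * cos (x / 2)) by (rewrite <- sin_2a; f_equal; field).
  assert (0 <= cos (x / 2)) by (apply cos_ge_0; lra).
  assert (x / 2 * cos (x / 2) * cos (x / 2) <= sin (x / 2) * cos (x / 2)) by (apply Rmult_le_compat_r; lra).
  nra.
Qed.

Lemma gs_le_exp (p : R) : gs p <= 2 * exp (- p).
Proof.
  unfold gs. rewrite exp_Ropp. pose proof (exp_pos p). pose proof (exp_pos (- p)).
  replace (2 * / exp p) with (/ (exp p / 2)) by (field; lra).
  apply Rinv_le_contravar; [lra|]. unfold cosh. lra.
Qed.

Lemma cogd_range (p : R) : 0 <= p -> 0 <= PI / 2 - gd p <= 4 * exp (- p).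
Proof.
  intros Hp. pose proof (gd_range p Hp). split; [lra|].
  pose proof (sin_ge_half (PI / 2 - gd p) ltac:(lra)) as H1. rewrite sin_shift, cos_gd in H1.
  pose proof (gs_le_exp p). lra.
Qed.

Lemma cos_lipschitz (a d : R) : 0 <= d -> Rabs (cos (a + d) - cos a) <= d.
Proof.
  intros Hd. destruct (MVT_derive cos (fun y => - sin y) a (a + d)) as (c & _ & E); [lra | |].
  - intros y _. auto_derive; [easy | ring].
  - rewrite E. replace (a + d - a) with d by ring. rewrite Rabs_mult, Rabs_Ropp, (Rabs_pos_eq d) by easy.
    assert (Rabs (sin c) <= 1) by apply Rabs_le, SIN_bound. nra.
Qed.

(** The leading part of the integrand as p grows, where gd(p) tends to pi/2; the remainder is
    bounded because the order is at most 1. *)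
Lemma coshdt_remainder (nu g p : R) : 0 < nu <= 1 -> 0 <= p ->
  Rabs (coshdt (g + nu * (PI / 2)) nu p - cos g * (exp (nu * p) / 2)) <= 8.
Proof.
  intros Hnu Hp. unfold coshdt, expdt.
  set (d := nu * (PI / 2 - gd p)). set (e := g + nu * (PI / 2) - - nu * gd p).
  replace (g + nu * (PI / 2) - nu * gd p) with (g + d) by (unfold d; ring).
  pose proof (cogd_range p Hp). pose proof (gs_le_exp p). pose proof (gs_range p) as Hs.
  assert (Hd : 0 <= d <= 4 * exp (- p)) by (unfold d; split; nra).
  assert (HE : exp (nu * p) * exp (- p) <= 1) by (rewrite <- exp_plus, <- exp_0; apply exp_le; nra).
  assert (HE' : exp (- nu * p) <= 1) by (rewrite <- exp_0; apply exp_le; nra).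
  pose proof (exp_pos (nu * p)). pose proof (exp_pos (- nu * p)).
  assert (B1 : Rabs (cos (g + d) + gs p * sin (g + d) - cos g) <= 6 * exp (- p)).
  { pose proof (cos_lipschitz g d (proj1 Hd)) as Hc. apply Rabs_le_between in Hc.
    pose proof (SIN_bound (g + d)). assert (- gs p <= gs p * sin (g + d) <= gs p) by (split; nra).
    apply Rabs_le. lra. }
  pose proof (turn_bound (gs p) e ltac:(lra)) as B2.
  replace (_ - _) with (exp (nu * p) / 2 * (cos (g + d) + gs p * sin (g + d) - cos g)
    + exp (- nu * p) / 2 * (cos e + gs p * sin e)) by (unfold e; field).
  eapply Rle_trans; [apply Rabs_triang|].
  rewrite !Rabs_mult, !(Rabs_pos_eq (exp _ / 2)) by lra.
  assert (exp (nu * p) / 2 * Rabs (cos (g + d) + gs p * sin (g + d) - cos g)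
    <= exp (nu * p) / 2 * (6 * exp (- p))) by (apply Rmult_le_compat_l; lra).
  assert (exp (- nu * p) / 2 * Rabs (cos e + gs p * sin e) <= 1 / 2 * 2)
    by (apply Rmult_le_compat; try lra; apply Rabs_pos).
  nra.
Qed.

(** Near 0 the integral is governed by large p, where it is half the integral of e^(nu p) up to
    the factor cos g. *)
Lemma xs_HL (nu k : R) (g : nat -> R) : 0 < nu <= 1 -> is_lim_seq (fun n => cos (g n)) k ->
  is_lim_seq (fun n => Rpower (xs n) nu * HL (g n + nu * (PI / 2)) nu (xs n))
    (k * (/ 2 * (Rpower 2 nu * Gam nu))).
Proof.
  intros Hnu Hg.
  set (rem := fun n => HL (g n + nu * (PI / 2)) nu (xs n) - cos (g n) * (/ 2 * EL nu (xs n))).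
  apply is_lim_seq_ext with (fun n => cos (g n) * (/ 2 * (Rpower (xs n) nu * EL nu (xs n)))
     + Rpower (xs n) nu * rem n); [intros n; unfold rem; ring|].
  apply (is_lim_seq_value _ (k * (/ 2 * (Rpower 2 nu * Gam nu)) + 0)); [|ring].
  apply is_lim_seq_plus'.
  - pose proof (EL_lim nu ltac:(lra)). limit. easy.
  - apply is_lim_seq_abs_0.
    apply is_lim_seq_le_le with (fun _ => 0) (fun n => Rpower (xs n) nu * Lap gh (fun _ => 8) (xs n)).
    + intros n. pose proof (xs_range n). split; [apply Rabs_pos|].
      rewrite Rabs_mult, (Rabs_pos_eq (Rpower _ _)) by apply exp_nonneg.
      apply Rmult_le_compat_l; [apply exp_nonneg|].
      replace (rem n) with (Lap gh (fun p => coshdt (g n + nu * (PI / 2)) nu p - cos (g n) * (exp (nu * p) / 2)) (xs n)).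
      * apply Lap_abs_le; [apply kernel_gh | | apply expo_const | lra | intros; now apply coshdt_remainder].
        apply expo_minus; [apply expo_coshdt|]. apply expo_scal.
        apply expo_ext with (fun p => / 2 * exp (nu * p)); [intros; field | apply expo_exp].
      * unfold rem, HL, EL.
        rewrite (Lap_gh_lin (coshdt (g n + nu * (PI / 2)) nu) (fun p => exp (nu * p)) _ 1 (- (cos (g n) * / 2)));
          [ring | apply expo_coshdt | apply expo_exp1 | lra | intros; field].
    + apply is_lim_seq_const.
    + apply (xs_Lap_small _ 8 0); [apply expo_const | lra |].
      intros p _. rewrite Rmult_0_l, exp_0, Rabs_pos_eq; lra.
Qed.

Lemma xs_cos (a : R) : is_lim_seq (fun n => cos (a - xs n)) (cos a).
Proof.
  replace (cos a) with (cos (a - 0)) by now rewrite Rminus_0_r.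
  apply (is_lim_seq_continuous (fun x => cos (a - x)) xs 0); [|apply xs_lim].
  apply continuity_pt_filterlim. apply (ex_derive_continuous (fun x => cos (a - x))). auto_derive; easy.
Qed.

Lemma xs_G (nu : R) : 0 < nu <= 1 -> is_lim_seq (fun n => Rpower (xs n) nu * G nu (xs n)) 0.
Proof.
  intros Hnu. apply is_lim_seq_ext with (fun n =>
    Rpower (xs n) nu * HL (PI / 2 - xs n + nu * (PI / 2)) nu (xs n)).
  - intros n. unfold G, cyl. f_equal. f_equal. ring.
  - eapply is_lim_seq_value; [apply xs_HL; [easy | apply xs_cos] | rewrite cos_PI2; ring].
Qed.

Lemma xs_G_neg (l : R) : 0 < l <= 1 ->
  is_lim_seq (fun n => Rpower (xs n) l * G (- l) (xs n)) (sin (l * PI) * (/ 2 * (Rpower 2 l * Gam l))).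
Proof.
  intros Hl. apply is_lim_seq_ext with (fun n =>
    Rpower (xs n) l * HL (PI / 2 - l * PI - xs n + l * (PI / 2)) l (xs n)).
  - intros n. unfold G, cyl. rewrite HL_opp. f_equal. f_equal. field.
  - rewrite <- cos_shift. apply xs_HL; [easy | apply xs_cos].
Qed.

Lemma xs_G_sub (nu : R) : -1 < nu < 1 -> is_lim_seq (fun n => xs n * G nu (xs n)) 0.
Proof.
  intros Hnu. assert (Ha : 0 <= Rabs nu < 1) by (split; [apply Rabs_pos | apply Rabs_def1; lra]).
  apply is_lim_seq_abs_0.
  apply is_lim_seq_le_le with (fun _ => 0)
    (fun n => Rpower (xs n) 1 * Lap gh (fun p => 2 * exp (Rabs nu * p)) (xs n)).
  - intros n. pose proof (xs_range n). split; [apply Rabs_pos|].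
    rewrite Rpower_1, Rabs_mult, (Rabs_pos_eq (xs n)) by lra. apply Rmult_le_compat_l; [lra|].
    unfold G, cyl, HL. apply Lap_abs_le; [apply kernel_gh | apply expo_coshdt | apply expo_exp | lra |].
    intros p Hp. now apply coshdt_bound.
  - apply is_lim_seq_const.
  - apply (xs_Lap_small _ 2 (Rabs nu)); [apply expo_exp | easy |].
    intros p _. rewrite Rabs_pos_eq; [lra|]. pose proof (exp_pos (Rabs nu * p)). lra.
Qed.

Lemma G_three_terms (nu x : R) : 0 < x -> G (nu + 1) x = 2 * nu / x * G nu x - G (nu - 1) x.
Proof.
  intros Hx. pose proof (is_derive_unique _ _ _ (is_derive_cyl_up (PI / 2) nu x Hx)) as E1.
  rewrite (is_derive_unique _ _ _ (is_derive_cyl_down (PI / 2) nu x Hx)) in E1. fold G in E1.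
  replace (2 * nu / x * G nu x) with (nu / x * G nu x + nu / x * G nu x) by (field; lra). lra.
Qed.

(** Both functions solve Bessel's equation, and x times their Wronskian is constant and vanishes
    in the limit at 0, because x^nu G tends to 0. Two solutions with zero Wronskian are
    proportional, with the factor read off from their Wronskians with Y. *)
Lemma J_proportional_base (nu : R) : 0 < nu <= 1 ->
  exists b, forall x, 0 < x -> BesselJ nu x = b * G nu x.
Proof.
  intros Hnu.
  assert (Hr : regular nu) by (apply regular_pos; lra).
  pose proof (bpair_J nu Hr) as PJ. pose proof (bpair_G nu) as PG. pose proof (bpair_Y nu) as PY.
  assert (H0 : forall x, 0 < x -> cross (G nu) (G (nu + 1)) (BesselJ nu) (BesselJ (nu + 1)) x = 0).
  { intros x Hx.
    assert (L : is_lim_seq (fun n => cross (G nu) (G (nu + 1)) (BesselJ nu) (BesselJ (nu + 1)) (xs n)) 0).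
    { apply is_lim_seq_ext with (fun n =>
        2 * nu * ((Rpower (xs n) nu * G nu (xs n)) * (Rpower (xs n) (- nu) * BesselJ nu (xs n)))
        - (xs n * G (nu - 1) (xs n)) * Rpower (xs n) nu * (Rpower (xs n) (- nu) * BesselJ nu (xs n))
        - (Rpower (xs n) nu * G nu (xs n)) * (xs n * xs n)
          * (Rpower (xs n) (- (nu + 1)) * BesselJ (nu + 1) (xs n))).
      - intros n. pose proof (xs_range n). unfold cross. rewrite G_three_terms by lra.
        rewrite Ropp_plus_distr, Rpower_plus, !Rpower_Ropp, Rpower_1 by lra.
        assert (0 < Rpower (xs n) nu) by apply exp_pos. field. lra.
      - pose proof (xs_G nu Hnu). pose proof (J_xs_lim nu Hr). pose proof xs_lim.
        pose proof (J_xs_lim (nu + 1) (regular_S _ Hr)).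
        pose proof (xs_G_sub (nu - 1) ltac:(lra)). pose proof (xs_power_lim nu ltac:(lra)).
        apply (is_lim_seq_value _ (2 * nu * (0 * (Rpower 2 (- nu) * rGamma (nu + 1)))
          - 0 * 0 * (Rpower 2 (- nu) * rGamma (nu + 1))
          - 0 * (0 * 0) * (Rpower 2 (- (nu + 1)) * rGamma (nu + 1 + 1)))); [|ring].
        repeat first [assumption | apply is_lim_seq_const | apply is_lim_seq_minus' | apply is_lim_seq_mult']. }
    apply (is_lim_seq_ext _ (fun _ => cross (G nu) (G (nu + 1)) (BesselJ nu) (BesselJ (nu + 1)) x)) in L.
    - apply is_lim_seq_unique in L. rewrite Lim_seq_const in L. now injection L.
    - intros n. apply (cross_constant nu); [easy | easy | apply xs_range | easy]. }
  exists (cross (BesselJ nu) (BesselJ (nu + 1)) (Y nu) (Y (nu + 1)) 1 / crossGY nu 1).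
  intros x Hx. specialize (H0 x Hx).
  rewrite (cross_constant nu _ _ _ _ PJ PY 1 x Rlt_0_1 Hx), (crossGY_const nu 1 x Rlt_0_1 Hx).
  pose proof (crossGY_pos nu x Hx) as Hc.
  apply Rmult_eq_reg_r with (crossGY nu x); [|lra].
  replace (cross (BesselJ nu) (BesselJ (nu + 1)) (Y nu) (Y (nu + 1)) x / crossGY nu x * G nu x * crossGY nu x)
    with (G nu x * cross (BesselJ nu) (BesselJ (nu + 1)) (Y nu) (Y (nu + 1)) x) by (field; lra).
  unfold crossGY, cross in *.
  assert (H1 : x * G (nu + 1) x * BesselJ nu x = x * G nu x * BesselJ (nu + 1) x) by lra.
  transitivity (Y nu x * (x * G (nu + 1) x * BesselJ nu x) - BesselJ nu x * x * G nu x * Y (nu + 1) x); [ring|].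
  rewrite H1. ring.
Qed.

Lemma derive_agree (f g : R -> R) (x l l' : R) : 0 < x -> (forall y, 0 < y -> f y = g y) ->
  is_derive f x l -> is_derive g x l' -> l = l'.
Proof.
  intros Hx Hfg Df Dg.
  assert (D : is_derive g x l).
  { apply (is_derive_ext_loc f); [|easy].
    generalize (locally_above 0 x Hx). now apply filter_imp. }
  rewrite <- (is_derive_unique _ _ _ D). now apply is_derive_unique.
Qed.

Lemma J_proportional_up (nu b : R) : regular nu ->
  (forall x, 0 < x -> BesselJ nu x = b * G nu x) ->
  forall x, 0 < x -> BesselJ (nu + 1) x = b * G (nu + 1) x.
Proof.
  intros Hr H x Hx.
  pose proof (derive_agree _ _ x _ _ Hx H (is_derive_J_up nu x Hr Hx)
    (is_derive_scal (G nu) x b _ (is_derive_cyl_up (PI / 2) nu x Hx))) as E.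
  simpl in E. fold G in E. rewrite H in E by easy. lra.
Qed.

Lemma J_proportional_down (nu b : R) : regular nu ->
  (forall x, 0 < x -> BesselJ nu x = b * G nu x) ->
  forall x, 0 < x -> BesselJ (nu - 1) x = b * G (nu - 1) x.
Proof.
  intros Hr H x Hx.
  pose proof (derive_agree _ _ x _ _ Hx H (is_derive_J_down nu x Hr Hx)
    (is_derive_scal (G nu) x b _ (is_derive_cyl_down (PI / 2) nu x Hx))) as E.
  simpl in E. fold G in E. rewrite H in E by easy. lra.
Qed.

Lemma J_proportional_up_n (nu b : R) (n : nat) : regular nu ->
  (forall x, 0 < x -> BesselJ nu x = b * G nu x) ->
  forall x, 0 < x -> BesselJ (nu + INR n) x = b * G (nu + INR n) x.
Proof.
  intros Hr H. assert (Hn : regular (nu + INR n) /\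
    forall x, 0 < x -> BesselJ (nu + INR n) x = b * G (nu + INR n) x); [|apply Hn].
  induction n as [|n [IH1 IH2]].
  - simpl. rewrite Rplus_0_r. now split.
  - rewrite S_INR, <- Rplus_assoc. split; [now apply regular_S | now apply J_proportional_up].
Qed.

Lemma J_neq_0 (nu : R) : 0 < nu -> ~ (forall x, 0 < x -> BesselJ nu x = 0).
Proof.
  intros Hnu H. assert (Hr : regular nu) by (apply regular_pos; lra).
  pose proof (J_xs_lim nu Hr) as L.
  apply (is_lim_seq_ext _ (fun _ => 0)) in L.
  - apply is_lim_seq_unique in L. rewrite Lim_seq_const in L. injection L as E.
    assert (0 < Rpower 2 (- nu) * rGamma (nu + 1)).
    { apply Rmult_lt_0_compat; [apply exp_pos | apply rGamma_pos; lra]. }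
    lra.
  - intros n. rewrite H by apply xs_range. ring.
Qed.

Lemma base_decomposition (nu : R) : 0 < nu -> exists v n, 0 < v <= 1 /\ nu = v + INR n.
Proof.
  intros Hnu.
  assert (W : forall n nu, 0 < nu <= INR n + 1 -> exists v n, 0 < v <= 1 /\ nu = v + INR n).
  { induction n as [|n IH]; intros v Hv.
    - simpl in Hv. exists v, 0%nat. simpl. lra.
    - rewrite S_INR in Hv. destruct (Rle_lt_dec v (INR n + 1)); [apply IH; lra|].
      pose proof (pos_INR n). destruct (IH (v - 1)) as (w & m & Hw & E); [lra|].
      exists w, (S m). rewrite S_INR. lra. }
  destruct (INR_above nu) as [n Hn]. apply (W n). lra.
Qed.

Lemma BesselJ_eq_G (nu : R) : 0 < nu ->
  exists b, b <> 0 /\ forall x, 0 < x -> BesselJ nu x = b * G nu x.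
Proof.
  intros Hnu. destruct (base_decomposition nu Hnu) as (v & n & Hv & E).
  destruct (J_proportional_base v Hv) as [b Hb].
  assert (H : forall x, 0 < x -> BesselJ nu x = b * G nu x).
  { rewrite E. apply J_proportional_up_n; [apply regular_pos; lra | easy]. }
  exists b. split; [|easy]. intros ->. apply (J_neq_0 nu Hnu). intros x Hx. rewrite H by easy. ring.
Qed.

(** * The Bessel function of the second kind as an integral *)

(** The factor of proportionality between the Bessel function and G at nonintegral orders. By the
    reflection formula it equals 2/pi; the symmetry under nu -> 1 - nu and the limit at 0, both
    accessible in this form, do the work of that formula. *)
Definition bconst (nu : R) : R := 2 / (sin (nu * PI) * (Gam nu * Gam (1 - nu))).

Lemma bconst_sym (nu : R) : bconst (1 - nu) = bconst nu.
Proof.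
  unfold bconst. replace (1 - (1 - nu)) with nu by ring.
  replace ((1 - nu) * PI) with (PI - nu * PI) by ring. rewrite sin_PI_x.
  f_equal. f_equal. ring.
Qed.

Lemma sin_unit_pos (nu : R) : 0 < nu < 1 -> 0 < sin (nu * PI).
Proof. intros H. pose proof PI_RGT_0. apply sin_gt_0; nra. Qed.

(** The factor is found by comparing the leading terms at 0 of order nu - 1, where the integral
    gives Gam (1 - nu) and the series 1 / Gam nu. *)
Lemma J_proportional_unit (nu : R) : 0 < nu < 1 ->
  forall x, 0 < x -> BesselJ nu x = bconst nu * G nu x.
Proof.
  intros Hnu. destruct (J_proportional_base nu) as [b Hb]; [lra|].
  assert (Hr : regular nu) by (apply regular_pos; lra).
  pose proof (J_proportional_down nu b Hr Hb) as Hd.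
  set (l := 1 - nu). assert (El : nu - 1 = - l) by (unfold l; ring). rewrite El in Hd.
  assert (Hl : 0 < l < 1) by (unfold l; lra).
  assert (Hrl : regular (- l)) by (apply regular_pos; lra).
  pose proof (J_xs_lim (- l) Hrl) as L1. rewrite Ropp_involutive in L1.
  assert (L2 : is_lim_seq (fun n => Rpower (xs n) l * BesselJ (- l) (xs n))
     (b * (sin (l * PI) * (/ 2 * (Rpower 2 l * Gam l))))).
  { apply is_lim_seq_ext with (fun n => b * (Rpower (xs n) l * G (- l) (xs n))).
    - intros n. rewrite Hd by apply xs_range. ring.
    - pose proof (xs_G_neg l ltac:(lra)). limit. easy. }
  apply is_lim_seq_unique in L1. apply is_lim_seq_unique in L2. rewrite L1 in L2. injection L2 as E.
  assert (Eg : rGamma (- l + 1) = / Gam nu).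
  { replace (- l + 1) with nu by (unfold l; ring). apply rGamma_Gam; lra. }
  rewrite Eg in E.
  assert (Es : sin (l * PI) = sin (nu * PI)).
  { unfold l. replace ((1 - nu) * PI) with (PI - nu * PI) by ring. apply sin_PI_x. }
  rewrite Es in E. pose proof (sin_unit_pos nu Hnu).
  assert (0 < Rpower 2 l) by apply exp_pos.
  assert (HGn : 0 < Gam nu) by (apply Gam_pos; lra). assert (HGl : 0 < Gam l) by (apply Gam_pos; lra).
  assert (Eb : b = bconst nu).
  { unfold bconst. fold l.
    apply Rmult_eq_reg_r with (sin (nu * PI) * (/ 2 * (Rpower 2 l * Gam l))).
    - rewrite <- E. field. lra.
    - apply Rgt_not_eq. repeat apply Rmult_lt_0_compat; lra. }
  now rewrite <- Eb.
Qed.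

Lemma regular_unit_shift (v : R) (n : nat) : 0 < v < 1 -> regular (v - INR n).
Proof.
  intros Hv m.
  destruct (Nat.le_gt_cases n m) as [H|H].
  - apply le_INR in H. lra.
  - assert (H' : (S m <= n)%nat) by lia. apply le_INR in H'. rewrite S_INR in H'.
    destruct (Nat.eq_dec n (S m)) as [->|Hne].
    + rewrite S_INR. lra.
    + assert (H2 : (S (S m) <= n)%nat) by lia. apply le_INR in H2. rewrite !S_INR in H2. lra.
Qed.

(** Going down from v in (0, 1) never meets a negative integer. *)
Lemma J_proportional_neg (v : R) (n : nat) : 0 < v < 1 ->
  forall x, 0 < x -> BesselJ (v - INR n) x = bconst v * G (v - INR n) x.
Proof.
  intros Hv. induction n as [|n IH].
  - simpl. rewrite Rminus_0_r. now apply J_proportional_unit.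
  - rewrite S_INR. replace (v - (INR n + 1)) with (v - INR n - 1) by ring.
    apply J_proportional_down; [now apply regular_unit_shift | easy].
Qed.

Lemma Y_quotient (nu x : R) : 0 < x ->
  G nu x * cos (nu * PI) - G (- nu) x = sin (nu * PI) * Y nu x.
Proof.
  intros Hx. unfold G, Y, cyl. rewrite HL_opp. set (b := PI / 2 + nu * (PI / 2) - x).
  replace (PI + nu * (PI / 2) - x) with (b + PI / 2) by (unfold b; field).
  replace (PI / 2 + - nu * (PI / 2) - x) with (b + - (nu * PI)) by (unfold b; field).
  rewrite (HL_turn b) by easy. rewrite cos_neg, sin_neg. ring.
Qed.

(** The orders v + n and - (v + n) are reached from v and 1 - v by integer steps, so both carry
    the same factor, by the symmetry of [bconst]; the quotient then reduces to addition of
    angles. *)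
Lemma BesselY_quotient_eq (v x : R) (n : nat) : 0 < v < 1 -> 0 < x ->
  BesselY_quotient (v + INR n) x = bconst v * Y (v + INR n) x /\ sin ((v + INR n) * PI) <> 0.
Proof.
  intros Hv Hx.
  assert (Hs : sin ((v + INR n) * PI) <> 0).
  { intros E. assert (E' : sin (v * PI + INR n * PI) = 0) by (rewrite <- E; f_equal; ring).
    pose proof (sin_unit_pos v Hv). rewrite sin_plus in E'.
    assert (En : sin (INR n * PI) = 0).
    { apply sin_eq_0_1. exists (Z.of_nat n). now rewrite INR_IZR_INZ. }
    rewrite En in E'. pose proof (sin2_cos2 (INR n * PI)) as E2. unfold Rsqr in E2. rewrite En in E2.
    assert (cos (INR n * PI) <> 0) by nra. assert (sin (v * PI) = 0) by nra. lra. }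
  split; [|easy].
  unfold BesselY_quotient.
  rewrite (J_proportional_up_n v (bconst v) n); [| apply regular_pos; lra | now apply J_proportional_unit | easy].
  replace (- (v + INR n)) with ((1 - v) - INR (S n)) at 1 by (rewrite S_INR; ring).
  rewrite (J_proportional_neg (1 - v) (S n)) by (easy || lra).
  rewrite bconst_sym.
  replace (1 - v - INR (S n)) with (- (v + INR n)) by (rewrite S_INR; ring).
  replace (bconst v * G (v + INR n) x * cos ((v + INR n) * PI) - bconst v * G (- (v + INR n)) x)
    with (bconst v * (G (v + INR n) x * cos ((v + INR n) * PI) - G (- (v + INR n)) x)) by ring.
  rewrite Y_quotient by easy. field. easy.
Qed.

Lemma exp_turn_lipschitz (a b c s n nu : R) : 0 <= s <= 1 -> 0 <= n -> n <= nu <= n + 1 ->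
  let f := fun v => exp (v * a) * (cos (c + v * b) + s * sin (c + v * b)) in
  Rabs (f nu - f n) <= (nu - n) * (2 * (Rabs a + Rabs b) * exp ((n + 1) * Rabs a)).
Proof.
  intros Hs Hn Hnu f.
  destruct (MVT_derive f (fun v => a * (exp (v * a) * (cos (c + v * b) + s * sin (c + v * b)))
     + b * (exp (v * a) * (cos (c + v * b + PI / 2) + s * sin (c + v * b + PI / 2)))) n nu) as (v & Hv & E).
  - lra.
  - intros v _. unfold f. rewrite (cos_plus _ (PI / 2)), (sin_plus _ (PI / 2)), cos_PI2, sin_PI2.
    auto_derive; [easy | ring].
  - rewrite E, Rabs_mult, (Rabs_pos_eq (nu - n)), Rmult_comm by lra. apply Rmult_le_compat_l; [lra|].
    assert (He : exp (v * a) <= exp ((n + 1) * Rabs a)).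
    { apply exp_le. pose proof (Rle_abs a). pose proof (Rabs_pos a). nra. }
    assert (W : forall k u, Rabs (k * (exp (v * a) * (cos u + s * sin u))) <= Rabs k * (exp ((n + 1) * Rabs a) * 2)).
    { intros k u. rewrite !Rabs_mult, Rabs_exp.
      apply Rmult_le_compat_l; [apply Rabs_pos|].
      apply Rmult_le_compat; [apply exp_nonneg | apply Rabs_pos | easy | now apply turn_bound]. }
    eapply Rle_trans; [apply Rabs_triang|].
    pose proof (W a (c + v * b)). pose proof (W b (c + v * b + PI / 2)). lra.
Qed.

(** The integrand is a combination of exp(v a) times trigonometric functions of v b, whose
    derivatives in the order v are dominated uniformly on [n, n + 1]. *)
Lemma coshdt_lipschitz (c n nu p : R) : 0 <= n -> n <= nu <= n + 1 -> 0 <= p ->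
  Rabs (coshdt (c + nu * (PI / 2)) nu p - coshdt (c + n * (PI / 2)) n p)
  <= (nu - n) * (8 * exp ((n + 2) * p)).
Proof.
  intros Hn Hnu Hp. pose proof (gs_range p) as Hs. pose proof (gd_range p Hp). pose proof PI_4.
  pose proof (exp_turn_lipschitz p (PI / 2 - gd p) c (gs p) n nu ltac:(lra) Hn Hnu) as L1.
  pose proof (exp_turn_lipschitz (- p) (PI / 2 + gd p) c (gs p) n nu ltac:(lra) Hn Hnu) as L2.
  cbv zeta in L1, L2. rewrite Rabs_Ropp in L2.
  rewrite (Rabs_pos_eq p), (Rabs_pos_eq (PI / 2 - gd p)) in L1 by lra.
  rewrite (Rabs_pos_eq p), (Rabs_pos_eq (PI / 2 + gd p)) in L2 by lra.
  assert (B : forall b, b <= PI -> (nu - n) * (2 * (p + b) * exp ((n + 1) * p)) <= (nu - n) * (8 * exp ((n + 2) * p))).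
  { intros b Hb. apply Rmult_le_compat_l; [lra|].
    replace ((n + 2) * p) with (p + (n + 1) * p) by ring. rewrite exp_plus, <- Rmult_assoc.
    apply Rmult_le_compat_r; [apply exp_nonneg|]. pose proof (exp_ineq1_le p). lra. }
  pose proof (B (PI / 2 - gd p) ltac:(lra)). pose proof (B (PI / 2 + gd p) ltac:(lra)).
  unfold coshdt, expdt.
  replace (c + nu * (PI / 2) - nu * gd p) with (c + nu * (PI / 2 - gd p)) by ring.
  replace (c + n * (PI / 2) - n * gd p) with (c + n * (PI / 2 - gd p)) by ring.
  replace (c + nu * (PI / 2) - - nu * gd p) with (c + nu * (PI / 2 + gd p)) by ring.
  replace (c + n * (PI / 2) - - n * gd p) with (c + n * (PI / 2 + gd p)) by ring.
  replace (- nu * p) with (nu * - p) by ring. replace (- n * p) with (n * - p) by ring.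
  apply Rabs_le_between in L1. apply Rabs_le_between in L2. apply Rabs_le. lra.
Qed.

Lemma Y_order_limit (n x : R) (o : nat -> R) : 0 <= n -> 0 < x ->
  (forall m, n <= o m <= n + 1) -> is_lim_seq o n -> is_lim_seq (fun m => Y (o m) x) (Y n x).
Proof.
  intros Hn Hx Ho Hlim. set (w := fun nu => coshdt (PI - x + nu * (PI / 2)) nu).
  assert (HY : forall nu, Y nu x = Lap gh (w nu) x).
  { intros nu. unfold Y, cyl, HL, w. f_equal. f_equal. ring. }
  set (K := Lap gh (fun p => 8 * exp ((n + 2) * p)) x).
  apply is_lim_seq_ext with (fun m => Y (o m) x - Y n x + Y n x); [intros; ring|].
  apply (is_lim_seq_value _ (0 + Y n x)); [|ring]. apply is_lim_seq_plus'; [|apply is_lim_seq_const].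
  apply is_lim_seq_abs_0. apply is_lim_seq_le_le with (fun _ => 0) (fun m => (o m - n) * K).
  - intros m. split; [apply Rabs_pos|]. rewrite !HY.
    replace (Lap gh (w (o m)) x - Lap gh (w n) x) with (Lap gh (fun p => w (o m) p - w n p) x).
    + replace ((o m - n) * K) with (Lap gh (fun p => (o m - n) * (8 * exp ((n + 2) * p))) x).
      * apply Lap_abs_le; [apply kernel_gh | apply expo_minus; apply expo_coshdt | apply expo_scal, expo_exp | easy |].
        intros p Hp. now apply coshdt_lipschitz.
      * unfold K. rewrite (Lap_gh_lin (fun p => 8 * exp ((n + 2) * p)) (fun _ => 0)
          (fun p => (o m - n) * (8 * exp ((n + 2) * p))) (o m - n) 0);
          [ring | apply expo_exp | apply expo_const | easy | intros; ring].
    + rewrite (Lap_gh_lin (w (o m)) (w n) (fun p => w (o m) p - w n p) 1 (-1));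
        [ring | apply expo_coshdt | apply expo_coshdt | easy | intros; ring].
  - apply is_lim_seq_const.
  - limit. ring.
Qed.

(** Here Gam x is written as Gam (1 + x) / x and sin (pi x) as x times a quotient tending to
    pi. *)
Lemma bconst_lim : is_lim_seq (fun n => bconst (xs n)) (2 / PI).
Proof.
  pose proof xs_lim. assert (HG : is_lim_seq (fun n => Gam (1 + xs n)) 1).
  { apply is_lim_seq_le_le with (fun n => / (1 + xs n)) (fun _ => 1).
    - intros n. pose proof (xs_range n). apply Gam_near_1_right. lra.
    - apply (is_lim_seq_value _ (/ 1)); [|field]. apply (is_lim_seq_inv (fun n => 1 + xs n) 1).
      + limit. ring.
      + intros E. injection E. lra.
    - apply is_lim_seq_const. }
  assert (Hl1 : is_lim_seq (fun n => 1 - xs n) 1).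
  { limit. ring. }
  assert (HG' : is_lim_seq (fun n => Gam (1 - xs n)) 1).
  { apply is_lim_seq_le_le with (fun _ => 1) (fun n => / (1 - xs n)).
    - intros n. pose proof (xs_range n). apply Gam_near_1_left. lra.
    - apply is_lim_seq_const.
    - apply (is_lim_seq_value _ (/ 1)); [|field].
      apply (is_lim_seq_inv (fun n => 1 - xs n) 1); [easy|]. intros E. injection E. lra. }
  assert (Hs : is_lim_seq (fun n => sin (xs n * PI) / (xs n * PI)) 1).
  { pose proof is_lim_sinc_0 as L.
    apply (is_lim_comp_seq (fun x => sin x / x) (fun n => xs n * PI) 0 1 L).
    - exists 0%nat. intros n _ E. injection E. pose proof (xs_range n). pose proof PI_RGT_0.
      assert (0 < xs n * PI) by (apply Rmult_lt_0_compat; lra). lra.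
    - limit. ring. }
  apply is_lim_seq_ext with (fun n => 2 * / (sin (xs n * PI) / (xs n * PI) * PI
      * (Gam (1 + xs n) * Gam (1 - xs n)))).
  - intros n. pose proof (xs_range n) as Hx. unfold bconst.
    replace (1 + xs n) with (xs n + 1) by ring. rewrite Gam_S by lra.
    pose proof (sin_unit_pos (xs n) Hx). pose proof PI_RGT_0.
    assert (0 < Gam (xs n)) by (apply Gam_pos; lra).
    assert (0 < Gam (1 - xs n)) by (apply Gam_pos; lra). field. repeat split; lra.
  - pose proof PI_RGT_0.
    assert (L : is_lim_seq (fun n => / (sin (xs n * PI) / (xs n * PI) * PI * (Gam (1 + xs n) * Gam (1 - xs n))))
      (/ (1 * PI * (1 * 1)))).
    { apply (is_lim_seq_inv _ (1 * PI * (1 * 1))); [limit; ring |]. intros E. injection E. lra. }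
    limit. field. lra.
Qed.

Lemma BesselY_eq_Y (nu : R) : 0 < nu ->
  exists k, k <> 0 /\ forall x, 0 < x -> BesselY nu x = k * Y nu x.
Proof.
  intros Hnu. destruct (base_decomposition nu Hnu) as (v & n & Hv & E).
  destruct (Rlt_dec v 1) as [Hv1 | Hv1].
  - exists (bconst v). split.
    + unfold bconst. pose proof (sin_unit_pos v ltac:(lra)).
      assert (0 < Gam v) by (apply Gam_pos; lra). assert (0 < Gam (1 - v)) by (apply Gam_pos; lra).
      apply Rgt_not_eq. apply Rdiv_lt_0_compat; [lra|]. repeat apply Rmult_lt_0_compat; easy.
    + intros x Hx. destruct (BesselY_quotient_eq v x n ltac:(lra) Hx) as [Eq Hs].
      unfold BesselY. rewrite E. destruct (Req_EM_T _ 0); [easy | exact Eq].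
  - assert (En : nu = INR (S n)) by (rewrite S_INR; lra).
    exists (2 / PI). pose proof PI_RGT_0. split.
    { apply Rgt_not_eq. apply Rdiv_lt_0_compat; lra. }
    intros x Hx. unfold BesselY. destruct (Req_EM_T (sin (nu * PI)) 0) as [_|Hs].
    2:{ exfalso. apply Hs. apply sin_eq_0_1. exists (Z.of_nat (S n)). now rewrite En, INR_IZR_INZ. }
    assert (L : is_lim_seq (fun m => BesselY_quotient (xs m + INR (S n)) x) (2 / PI * Y nu x)).
    { apply is_lim_seq_ext with (fun m => bconst (xs m) * Y (xs m + INR (S n)) x).
      - intros m. pose proof (xs_range m). symmetry. now apply BesselY_quotient_eq.
      - apply is_lim_seq_mult'; [apply bconst_lim|].
        apply (Y_order_limit nu x (fun m => xs m + INR (S n))); [lra | easy | |].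
        + intros m. pose proof (xs_range m). lra.
        + pose proof xs_lim. limit. lra. }
    (* [Lim] at nu is the limit along nu + 1 / (m + 1), which [xs] shifts by one. *)
    unfold Lim. rewrite <- Lim_seq_incr_1.
    rewrite (Lim_seq_ext _ (fun m => BesselY_quotient (xs m + INR (S n)) x)).
    + now rewrite (is_lim_seq_unique _ _ L).
    + intros m. f_equal. unfold Rbar_loc_seq, xs. rewrite S_INR, En.
      replace (INR m + 1 + 1) with (INR m + 2) by ring. ring.
Qed.

(** * The polynomial r *)

(** With s = [sq mu x] one has psi_low' = N0 / (x s^(3/2)); [N1] and [N2] are the derivatives of
    [N0]. *)
Definition sq (mu x : R) : R := x ^ 2 - mu ^ 2.
Definition N0 (mu eta x : R) : R :=
  x ^ 4 - x ^ 2 * (2 * mu ^ 2 + eta ^ 2 / 2 + eta) + mu ^ 2 * (mu ^ 2 + eta ^ 2 / 2).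
Definition N1 (mu eta x : R) : R := 4 * x ^ 3 - 2 * x * (2 * mu ^ 2 + eta ^ 2 / 2 + eta).
Definition N2 (mu eta x : R) : R := 12 * x ^ 2 - 2 * (2 * mu ^ 2 + eta ^ 2 / 2 + eta).

(** The origin of r: it is the numerator of kappa - 1 in [kappa_excess]. *)
Lemma r_identity_poly (mu eta x : R) :
  let s := sq mu x in let N := N0 mu eta x in let N' := N1 mu eta x in let N'' := N2 mu eta x in
  r mu eta x = 16 * N ^ 4 - 12 * x ^ 2 * s ^ 3 * N' ^ 2
   + 8 * N * x * s ^ 2 * (N' * (s + 3 * x ^ 2) + x * s * N'')
   - 4 * N ^ 2 * s * (4 * s ^ 3 - 4 * eta ^ 2 * s ^ 2 + 4 * (5 - 2 * eta) * x ^ 2 * s - 15 * x ^ 4).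
Proof. cbv zeta. unfold r, sq, N0, N1, N2. field. Qed.

Lemma IVT_level (f : R -> R) (a b y : R) : a <= b -> (forall x, a <= x <= b -> continuous f x) ->
  f a <= y <= f b -> exists z, a <= z <= b /\ f z = y.
Proof.
  intros Hab Hc [H1 H2].
  destruct (Req_dec (f a) y) as [E|Ha]; [exists a; lra|].
  destruct (Req_dec (f b) y) as [E|Hb]; [exists b; lra|].
  assert (a <> b) by (intros E; rewrite E in *; lra).
  destruct (IVT_interv (fun x => f x - y) a b) as (z & Hz & Ez); try lra.
  - intros x Hx. apply continuity_pt_filterlim.
    apply (continuous_minus f (fun _ => y)); [now apply Hc | apply continuous_const].
  - exists z. split; lra.
Qed.

Lemma increasing_of_derive (f f' : R -> R) (a b : R) : a < b ->
  (forall x, a <= x <= b -> is_derive f x (f' x)) -> (forall x, a < x < b -> 0 < f' x) -> f a < f b.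
Proof.
  intros Hab Hd Hp. destruct (MVT_cor2 f f' a b Hab) as (c & E & Hc).
  - intros x Hx. apply is_derive_Reals. now apply Hd.
  - assert (0 < f' c * (b - a)) by (apply Rmult_lt_0_compat; [now apply Hp | lra]). lra.
Qed.

(** Square root of the discriminant of [N0], a quadratic in x^2, up to a factor 2. *)
Definition discr (mu eta : R) : R := sqrt (eta ^ 2 * (eta + 2) ^ 2 + 16 * mu ^ 2 * eta).

Definition greatest_root (mu eta x : R) : Prop :=
  0 < x /\ r mu eta x = 0 /\ forall y, 0 < y -> r mu eta y = 0 -> y <= x.

Lemma discr_sqr (mu eta : R) : 0 < mu -> 0 < eta -> discr mu eta * discr mu eta = eta ^ 2 * (eta + 2) ^ 2 + 16 * mu ^ 2 * eta.
Proof.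
  intros Hmu Heta. apply sqrt_sqrt.
  assert (0 <= mu ^ 2 * eta) by (apply Rmult_le_pos; [apply pow2_ge_0 | lra]).
  assert (0 <= eta ^ 2 * (eta + 2) ^ 2) by (apply Rmult_le_pos; apply pow2_ge_0). lra.
Qed.

Lemma discr_pos (mu eta : R) : 0 < mu -> 0 < eta -> 0 < discr mu eta.
Proof.
  intros Hmu Heta.
  apply sqrt_lt_R0. assert (0 < mu ^ 2 * eta) by (apply Rmult_lt_0_compat; [apply pow_lt|]; lra).
  assert (0 <= eta ^ 2 * (eta + 2) ^ 2) by (apply Rmult_le_pos; apply pow2_ge_0). lra.
Qed.

Lemma x_sharp_sqr (mu eta : R) : 0 < mu -> 0 < eta -> x_sharp mu eta ^ 2 = (4 * mu ^ 2 + eta * (eta + 2) + discr mu eta) / 4.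
Proof.
  intros Hmu Heta.
  unfold x_sharp. fold (discr mu eta). pose proof (discr_pos mu eta Hmu Heta).
  assert (H0 : 0 <= 4 * mu ^ 2 + eta * (eta + 2) + discr mu eta).
  { pose proof (pow2_ge_0 mu). assert (0 <= eta * (eta + 2)) by (apply Rmult_le_pos; lra). lra. }
  pose proof (sqrt_sqrt _ H0) as E.
  transitivity (sqrt (4 * mu ^ 2 + eta * (eta + 2) + discr mu eta) * sqrt (4 * mu ^ 2 + eta * (eta + 2) + discr mu eta) / 4);
    [field | now rewrite E].
Qed.

Lemma x_sharp_gt (mu eta : R) : 0 < mu -> 0 < eta -> mu < x_sharp mu eta.
Proof.
  intros Hmu Heta.
  pose proof (x_sharp_sqr mu eta Hmu Heta) as E. pose proof (discr_pos mu eta Hmu Heta).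
  assert (0 <= x_sharp mu eta) by (unfold x_sharp; apply Rmult_le_pos; [lra | apply sqrt_pos]).
  assert (0 < eta * (eta + 2)) by (apply Rmult_lt_0_compat; lra).
  assert (mu ^ 2 < x_sharp mu eta ^ 2) by lra.
  apply Rnot_le_lt. intros H3. assert (x_sharp mu eta ^ 2 <= mu ^ 2) by (apply pow_incr; lra). lra.
Qed.

Lemma N0_factor (mu eta x : R) : 0 < mu -> 0 < eta -> N0 mu eta x =
  (x ^ 2 - x_sharp mu eta ^ 2) * (x ^ 2 - (4 * mu ^ 2 + eta * (eta + 2) - discr mu eta) / 4).
Proof.
  intros Hmu Heta.
  rewrite (x_sharp_sqr mu eta Hmu Heta). unfold N0.
  transitivity (x ^ 4 - x ^ 2 * (4 * mu ^ 2 + eta * (eta + 2)) / 2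
     + ((4 * mu ^ 2 + eta * (eta + 2)) ^ 2 - discr mu eta * discr mu eta) / 16); [rewrite (discr_sqr mu eta Hmu Heta); field | field].
Qed.

Lemma N0_pos (mu eta x : R) : 0 < mu -> 0 < eta -> x_sharp mu eta < x -> 0 < N0 mu eta x.
Proof.
  intros Hmu Heta Hx. rewrite (N0_factor mu eta _ Hmu Heta). pose proof (x_sharp_gt mu eta Hmu Heta). pose proof (discr_pos mu eta Hmu Heta). pose proof (x_sharp_sqr mu eta Hmu Heta) as E.
  assert (x_sharp mu eta ^ 2 < x ^ 2) by nra.
  apply Rmult_lt_0_compat; lra.
Qed.

(** At x_sharp only the second term of [r_identity_poly] survives, since [N0] vanishes there; it
    is negative because the zero is simple. *)
Lemma r_x_sharp (mu eta : R) : 0 < mu -> 0 < eta -> r mu eta (x_sharp mu eta) < 0.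
Proof.
  intros Hmu Heta.
  pose proof (r_identity_poly mu eta (x_sharp mu eta)) as E. cbv zeta in E.
  assert (HN : N0 mu eta (x_sharp mu eta) = 0) by (rewrite (N0_factor mu eta _ Hmu Heta); ring).
  rewrite HN in E. rewrite E.
  assert (HN1 : N1 mu eta (x_sharp mu eta) = x_sharp mu eta * discr mu eta).
  { unfold N1. transitivity (x_sharp mu eta * (4 * x_sharp mu eta ^ 2 - (4 * mu ^ 2 + eta * (eta + 2)))); [field|].
    rewrite (x_sharp_sqr mu eta Hmu Heta). field. }
  rewrite HN1. pose proof (x_sharp_gt mu eta Hmu Heta). pose proof (discr_pos mu eta Hmu Heta).
  assert (0 < sq mu (x_sharp mu eta)) by (unfold sq; nra).
  assert (0 < x_sharp mu eta ^ 2 * sq mu (x_sharp mu eta) ^ 3 * (x_sharp mu eta * discr mu eta) ^ 2).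
  { apply Rmult_lt_0_compat; [apply Rmult_lt_0_compat; apply pow_lt; lra |].
    apply pow_lt, Rmult_lt_0_compat; lra. }
  lra.
Qed.

Lemma r_eventually_pos (mu eta : R) : exists B, forall x, B < x -> 0 < r mu eta x.
Proof.
  pose (poly := fun c12 c10 c8 c6 c4 c2 c0 x : R =>
    12 * x ^ 14 + x ^ 12 * c12 + x ^ 10 * c10 + x ^ 8 * c8 + x ^ 6 * c6 + x ^ 4 * c4 + x ^ 2 * c2 + c0).
  assert (W : forall c12 c10 c8 c6 c4 c2 c0, exists B, forall x, B < x -> 0 < poly c12 c10 c8 c6 c4 c2 c0 x).
  { intros. set (S := Rabs c12 + Rabs c10 + Rabs c8 + Rabs c6 + Rabs c4 + Rabs c2 + Rabs c0).
    exists (1 + S). intros x Hx.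
    pose proof (Rabs_pos c12). pose proof (Rabs_pos c10). pose proof (Rabs_pos c8). pose proof (Rabs_pos c6).
    pose proof (Rabs_pos c4). pose proof (Rabs_pos c2). pose proof (Rabs_pos c0).
    assert (HS : 0 <= S) by (unfold S; lra). assert (Hx1 : 1 < x) by lra.
    assert (T : forall k c, (k <= 12)%nat -> - (x ^ 12 * Rabs c) <= x ^ k * c).
    { intros k c Hk. assert (x ^ k <= x ^ 12) by (apply Rle_pow; [lra | easy]).
      assert (0 < x ^ k) by (apply pow_lt; lra).
      pose proof (Rle_abs (- c)) as H9. rewrite Rabs_Ropp in H9. pose proof (Rabs_pos c). nra. }
    pose proof (T 12%nat c12 ltac:(lia)). pose proof (T 10%nat c10 ltac:(lia)).
    pose proof (T 8%nat c8 ltac:(lia)). pose proof (T 6%nat c6 ltac:(lia)).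
    pose proof (T 4%nat c4 ltac:(lia)). pose proof (T 2%nat c2 ltac:(lia)).
    pose proof (T 0%nat c0 ltac:(lia)) as T0. rewrite pow_O in T0.
    assert (Hp : 0 < x ^ 12) by (apply pow_lt; lra).
    assert (x ^ 14 > x ^ 12 * S).
    { replace (x ^ 14) with (x ^ 12 * (x * x)) by ring. apply Rmult_lt_compat_l; [easy | nra]. }
    assert (0 < x ^ 14) by (apply pow_lt; lra).
    unfold poly, S in *. lra. }
  edestruct W as [B HB]. exists B. intros x Hx. specialize (HB x Hx). unfold poly in HB.
  unfold r. exact HB.
Qed.

Lemma continuous_r (mu eta x : R) : continuous (r mu eta) x.
Proof. apply (ex_derive_continuous (r mu eta)). unfold r. auto_derive; easy. Qed.

Lemma root_above (mu eta a : R) : 0 < a -> r mu eta a < 0 -> exists z, a < z /\ r mu eta z = 0.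
Proof.
  intros Ha Hr. destruct (r_eventually_pos mu eta) as [B HB].
  assert (HM : a <= Rmax a B + 1) by (pose proof (Rmax_l a B); lra).
  destruct (IVT_level (r mu eta) a (Rmax a B + 1) 0 HM) as (z & Hz & Ez).
  - intros x _. apply continuous_r.
  - split; [lra|]. left. apply HB. pose proof (Rmax_r a B). lra.
  - exists z. split; [|easy]. destruct (Req_dec a z) as [E|E]; [rewrite E in Hr; lra | lra].
Qed.

(** The supremum of the roots is a root: near a point where r does not vanish there are no
    roots. *)
Lemma greatest_root_exists (mu eta : R) : 0 < mu -> 0 < eta -> exists x, greatest_root mu eta x.
Proof.
  intros Hmu Heta.
  pose proof (x_sharp_gt mu eta Hmu Heta).
  destruct (root_above mu eta (x_sharp mu eta) ltac:(lra) (r_x_sharp mu eta Hmu Heta)) as (z0 & Hz0 & Ez0).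
  destruct (r_eventually_pos mu eta) as [B HB].
  destruct (completeness (fun y => 0 < y /\ r mu eta y = 0)) as [m [Hub Hlub]].
  - exists B. intros y [Hy Ey]. apply Rnot_lt_le. intros HBy. specialize (HB y HBy). lra.
  - exists z0. split; lra.
  - assert (Hm0 : z0 <= m) by (apply Hub; split; lra).
    exists m. split; [lra|]. split.
    + destruct (Req_dec (r mu eta m) 0) as [E|E]; [easy|]. exfalso.
      assert (He : 0 < Rabs (r mu eta m)) by now apply Rabs_pos_lt.
      destruct (proj1 (filterlim_locally (r mu eta) (r mu eta m)) (continuous_r mu eta m) (mkposreal _ He)) as [d Hd].
      assert (Hb : m <= m - d / 2).
      { apply Hlub. intros y [Hy Ey]. apply Rnot_lt_le. intros Hlt.
        assert (Hym : y <= m) by (apply Hub; easy).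
        assert (Hball : ball m d y).
        { unfold ball; simpl; unfold AbsRing_ball, abs, minus, plus, opp; simpl.
          pose proof (cond_pos d). apply Rabs_def1; lra. }
        specialize (Hd y Hball). unfold ball in Hd; simpl in Hd; unfold AbsRing_ball, abs, minus, plus, opp in Hd; simpl in Hd.
        rewrite Ey, Rplus_0_l, Rabs_Ropp in Hd. lra. }
      pose proof (cond_pos d). lra.
    + intros y Hy Ey. apply Hub. easy.
Qed.

Lemma x_at_spec (mu eta : R) : 0 < mu -> 0 < eta -> greatest_root mu eta (x_at mu eta).
Proof.
  intros Hmu Heta. apply (epsilon_spec (inhabits 0) (greatest_root mu eta)). now apply greatest_root_exists.
Qed.

Lemma x_at_gt (mu eta : R) : 0 < mu -> 0 < eta -> x_sharp mu eta < x_at mu eta.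
Proof.
  intros Hmu Heta.
  pose proof (x_sharp_gt mu eta Hmu Heta). destruct (x_at_spec mu eta Hmu Heta) as (_ & _ & Hmax).
  destruct (root_above mu eta (x_sharp mu eta) ltac:(lra) (r_x_sharp mu eta Hmu Heta)) as (z0 & Hz0 & Ez0).
  specialize (Hmax z0 ltac:(lra) Ez0). lra.
Qed.

Lemma r_pos_after (mu eta x : R) : 0 < mu -> 0 < eta -> x_at mu eta < x -> 0 < r mu eta x.
Proof.
  intros Hmu Heta Hx. destruct (x_at_spec mu eta Hmu Heta) as (H0 & _ & Hmax).
  destruct (Rtotal_order (r mu eta x) 0) as [H|[H|H]]; [| |lra].
  - destruct (root_above mu eta x ltac:(lra) H) as (z & Hz & Ez). specialize (Hmax z ltac:(lra) Ez). lra.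
  - specialize (Hmax x ltac:(lra) H). lra.
Qed.

(** * The lower bound and its derivative *)

Lemma acos_eq_atan (mu x : R) : 0 < mu < x -> acos (mu / x) = atan (sqrt (sq mu x) / mu).
Proof.
  intros H. rewrite acos_atan by (apply Rdiv_lt_0_compat; lra). f_equal.
  assert (Hs : 0 < sq mu x) by (unfold sq; nra).
  replace (1 - (mu / x)²) with (sq mu x / x ^ 2) by (unfold sq, Rsqr; field; lra).
  rewrite sqrt_div_alt by nra. rewrite <- Rsqr_pow2, sqrt_Rsqr by lra. field. split; lra.
Qed.

Lemma mu_sqr (nu eta : R) : 0 < eta -> eta < nu -> mu_of nu eta ^ 2 = nu ^ 2 - eta ^ 2.
Proof.
  intros Heta Hnu. unfold mu_of. replace (sqrt (nu ^ 2 - eta ^ 2) ^ 2) with (sqrt (nu ^ 2 - eta ^ 2) * sqrt (nu ^ 2 - eta ^ 2)) by ring.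
  apply sqrt_sqrt. nra.
Qed.

Lemma mu_pos (nu eta : R) : 0 < eta -> eta < nu -> 0 < mu_of nu eta.
Proof. intros Heta Hnu. apply sqrt_lt_R0. nra. Qed.

Definition psi_slope (mu eta x : R) : R := N0 mu eta x / (x * sqrt (sq mu x) ^ 3).

Lemma psi_low_atan (nu eta x : R) : 0 < eta -> eta < nu -> mu_of nu eta < x ->
  psi_low nu eta x =
  sqrt (sq (mu_of nu eta) x)
  - (eta ^ 2 / (2 * mu_of nu eta) + mu_of nu eta) * atan (sqrt (sq (mu_of nu eta) x) / mu_of nu eta)
  + eta / sqrt (sq (mu_of nu eta) x)
  + PI / 4 * (eta ^ 2 / mu_of nu eta + 2 * (mu_of nu eta - nu) + 1).
Proof.
  intros Heta Hnu Hx. pose proof (mu_pos nu eta Heta Hnu). unfold psi_low. cbv zeta.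
  rewrite acos_eq_atan by lra. reflexivity.
Qed.

Lemma sq_pos (nu eta x : R) : 0 < eta -> eta < nu -> mu_of nu eta < x -> 0 < sq (mu_of nu eta) x.
Proof. intros Heta Hnu Hx. pose proof (mu_pos nu eta Heta Hnu). unfold sq. nra. Qed.

Lemma is_derive_sq (mu x : R) : is_derive (sq mu) x (2 * x).
Proof. unfold sq. auto_derive; [easy | ring]. Qed.

Lemma is_derive_sqrt_sq (mu x : R) : 0 < sq mu x -> is_derive (fun x => sqrt (sq mu x)) x (x / sqrt (sq mu x)).
Proof.
  intros Hs. pose proof (is_derive_sq mu x) as D. auto_derive.
  - repeat split; [eexists; eassumption | easy].
  - derive_with D. field. apply Rgt_not_eq, sqrt_lt_R0, Hs.
Qed.

Lemma sqrt_sq_sqr (mu x : R) : 0 < sq mu x -> sqrt (sq mu x) ^ 2 = sq mu x.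
Proof.
  intros Hs. replace (sqrt (sq mu x) ^ 2) with (sqrt (sq mu x) * sqrt (sq mu x)) by ring.
  apply sqrt_sqrt. lra.
Qed.

Lemma is_derive_psi_low (nu eta x : R) : 0 < eta -> eta < nu -> mu_of nu eta < x ->
  is_derive (psi_low nu eta) x (psi_slope (mu_of nu eta) eta x).
Proof.
  intros Heta Hnu Hx. pose proof (mu_pos nu eta Heta Hnu) as Hm. pose proof (sq_pos nu eta x Heta Hnu Hx) as Hs.
  set (mu := mu_of nu eta) in *.
  apply (is_derive_ext_loc (fun x => sqrt (sq mu x) - (eta ^ 2 / (2 * mu) + mu) * atan (sqrt (sq mu x) / mu) + eta / sqrt (sq mu x)
  + PI / 4 * (eta ^ 2 / mu + 2 * (mu - nu) + 1))).
  - generalize (locally_above mu x Hx). apply filter_imp. intros z Hz. symmetry. now apply psi_low_atan.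
  - pose proof (is_derive_sqrt_sq mu x Hs) as Dq.
    assert (Hq : 0 < sqrt (sq mu x)) by now apply sqrt_lt_R0.
    assert (Hqq : sqrt (sq mu x) ^ 2 = x ^ 2 - mu ^ 2) by now apply sqrt_sq_sqr.
    set (q := fun x => sqrt (sq mu x)) in *.
    change (is_derive (fun x => q x - (eta ^ 2 / (2 * mu) + mu) * atan (q x / mu) + eta / q x
      + PI / 4 * (eta ^ 2 / mu + 2 * (mu - nu) + 1)) x (psi_slope mu eta x)).
    unfold psi_slope. change (sqrt (sq mu x)) with (q x) in *.
    auto_derive.
    + repeat split; try (eexists; exact Dq). lra.
    + derive_with Dq.
      assert (Hden : 1 + (q x * / mu) ^ 2 = x ^ 2 / mu ^ 2).
      { replace ((q x * / mu) ^ 2) with (q x ^ 2 * / mu ^ 2) by (field; lra). rewrite Hqq. field. lra. }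
      replace (1 + q x * / mu * (q x * / mu * 1)) with (x ^ 2 / mu ^ 2) by (rewrite <- Hden; ring).
      assert (HN : N0 mu eta x = (x ^ 2 - mu ^ 2 - eta ^ 2 / 2) * q x ^ 2 - eta * x ^ 2)
        by (rewrite Hqq; unfold N0; field).
      rewrite HN. field. lra.
Qed.

Lemma is_lim_sqrt_sq (mu : R) : 0 < mu -> is_lim (fun x => sqrt (sq mu x)) p_infty p_infty.
Proof.
  intros Hmu. apply is_lim_spec. intros B. exists (mu + Rmax B 0). intros x Hx.
  pose proof (Rmax_l B 0). pose proof (Rmax_r B 0).
  apply Rlt_le_trans with (x - mu); [lra|].
  rewrite <- (sqrt_Rsqr (x - mu)) by lra. apply sqrt_le_1_alt. unfold sq, Rsqr. nra.
Qed.

Lemma is_lim_inv_infty (f : R -> R) : is_lim f p_infty p_infty -> is_lim (fun x => / f x) p_infty 0.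
Proof. intros H. apply (is_lim_inv f p_infty p_infty H). easy. Qed.

Lemma psi_low_lim (nu eta : R) : 0 < eta -> eta < nu ->
  is_lim (fun x => psi_low nu eta x - x) p_infty (- (nu * (PI / 2)) + PI / 4).
Proof.
  intros Heta Hnu. pose proof (mu_pos nu eta Heta Hnu) as Hm.
  pose proof (is_lim_sqrt_sq _ Hm) as Hq.
  apply is_lim_ext_loc with (fun x =>
    - mu_of nu eta ^ 2 * / (sqrt (sq (mu_of nu eta) x) + x)
    - (eta ^ 2 / (2 * mu_of nu eta) + mu_of nu eta)
      * (PI / 2 - atan (mu_of nu eta * / sqrt (sq (mu_of nu eta) x)))
    + eta * / sqrt (sq (mu_of nu eta) x)
    + PI / 4 * (eta ^ 2 / mu_of nu eta + 2 * (mu_of nu eta - nu) + 1)).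
  - exists (mu_of nu eta). intros x Hx.
    rewrite psi_low_atan by easy. pose proof (sq_pos nu eta x Heta Hnu Hx) as Hs.
    set (mu := mu_of nu eta) in *.
    assert (Hr : 0 < sqrt (sq mu x)) by now apply sqrt_lt_R0.
    assert (Hrr : sqrt (sq mu x) ^ 2 = x ^ 2 - mu ^ 2) by now apply sqrt_sq_sqr.
    replace (sqrt (sq mu x) / mu) with (/ (mu * / sqrt (sq mu x))) by (field; lra).
    rewrite atan_inv by (apply Rmult_lt_0_compat; [easy | now apply Rinv_0_lt_compat]).
    replace (- mu ^ 2 * / (sqrt (sq mu x) + x)) with (sqrt (sq mu x) - x).
    + unfold Rdiv. ring.
    + apply Rmult_eq_reg_r with (sqrt (sq mu x) + x); [|lra].
      replace (- mu ^ 2 * / (sqrt (sq mu x) + x) * (sqrt (sq mu x) + x)) with (- mu ^ 2) by (field; lra).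
      replace ((sqrt (sq mu x) - x) * (sqrt (sq mu x) + x)) with (sqrt (sq mu x) ^ 2 - x ^ 2) by ring.
      rewrite Hrr. ring.
  - set (mu := mu_of nu eta) in *.
    pose proof (is_lim_inv_infty _ Hq) as L1.
    assert (L2 : is_lim (fun x => / (sqrt (sq mu x) + x)) p_infty 0).
    { apply is_lim_inv_infty. apply (is_lim_plus _ (fun x => x) p_infty p_infty p_infty); [easy | apply is_lim_id | easy]. }
    pose proof (is_lim_atan _ _ (is_lim_mult_R _ _ _ _ (is_lim_const mu p_infty) L1)).
    limit. rewrite (Rmult_0_r mu), atan_0. field. lra.
Qed.

Lemma psi_slope_pos (mu eta x : R) : 0 < mu -> 0 < eta -> x_sharp mu eta < x -> 0 < psi_slope mu eta x.
Proof.
  intros Hm He Hx. pose proof (x_sharp_gt mu eta Hm He). unfold psi_slope.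
  apply Rdiv_lt_0_compat; [now apply N0_pos|].
  apply Rmult_lt_0_compat; [lra|]. apply pow_lt, sqrt_lt_R0. unfold sq. nra.
Qed.

Lemma psi_low_increasing (nu eta a b : R) : 0 < eta -> eta < nu ->
  x_sharp (mu_of nu eta) eta < a -> a < b -> psi_low nu eta a < psi_low nu eta b.
Proof.
  intros He Hn Ha Hab. pose proof (mu_pos nu eta He Hn) as Hm. pose proof (x_sharp_gt _ _ Hm He).
  apply (increasing_of_derive _ (psi_slope (mu_of nu eta) eta)); [easy | |].
  - intros x Hx. apply is_derive_psi_low; lra.
  - intros x Hx. apply psi_slope_pos; lra.
Qed.

Lemma unbounded_of_lim (f : R -> R) (l : R) : is_lim (fun x => f x - x) p_infty l ->
  forall t, exists B, forall x, B < x -> t < f x.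
Proof.
  intros L t. apply is_lim_spec in L. destruct (L (mkposreal 1 Rlt_0_1)) as [B HB].
  change (pos (mkposreal 1 Rlt_0_1)) with 1 in HB.
  exists (Rmax B (t - l + 1)). intros x Hx.
  assert (H1 : B < x) by (eapply Rle_lt_trans; [apply Rmax_l | exact Hx]).
  assert (H2 : t - l + 1 < x) by (eapply Rle_lt_trans; [apply Rmax_r | exact Hx]).
  specialize (HB x H1). apply Rabs_def2 in HB. lra.
Qed.

(** On the half-line beyond x_sharp the lower bound increases to infinity, which gives the
    preimage; it lies beyond x_at because its level exceeds the value there. *)
Lemma psi_low_inv_spec (nu eta t : R) : 0 < eta -> eta < nu ->
  psi_low nu eta (x_at (mu_of nu eta) eta) < t ->
  x_at (mu_of nu eta) eta < psi_low_inv nu eta t /\ psi_low nu eta (psi_low_inv nu eta t) = t.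
Proof.
  intros He Hn Ht. pose proof (mu_pos nu eta He Hn) as Hm.
  pose proof (x_sharp_gt _ _ Hm He). pose proof (x_at_gt _ _ Hm He) as Hat.
  assert (Hex : exists x, x_sharp (mu_of nu eta) eta < x /\ psi_low nu eta x = t).
  { destruct (unbounded_of_lim _ _ (psi_low_lim nu eta He Hn) t) as [B HB].
    set (a := x_at (mu_of nu eta) eta) in *. set (b := Rmax a B + 1).
    assert (Hab : a <= b) by (unfold b; pose proof (Rmax_l a B); lra).
    destruct (IVT_level (psi_low nu eta) a b t Hab) as (z & Hz & Ez).
    - intros x Hx. apply (continuous_derive _ _ _ (is_derive_psi_low nu eta x He Hn ltac:(lra))).
    - split; [lra|]. left. apply HB. unfold b. pose proof (Rmax_r a B). lra.
    - exists z. split; [lra | easy]. }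
  pose proof (epsilon_spec (inhabits 0) (fun x => x_sharp (mu_of nu eta) eta < x /\ psi_low nu eta x = t) Hex) as Hs.
  cbv beta in Hs. fold (the (fun x => x_sharp (mu_of nu eta) eta < x /\ psi_low nu eta x = t)) in Hs.
  fold (psi_low_inv nu eta t) in Hs. destruct Hs as [Hs1 Hs2]. split; [|easy].
  apply Rnot_le_lt. intros [Hle|Heq].
  - pose proof (psi_low_increasing nu eta _ _ He Hn Hs1 Hle). lra.
  - rewrite Heq in Hs2. lra.
Qed.

(** * Sturm comparison with the lower bound *)

(** [ampl] is the amplitude s^(5/4) N0^(-1/2) for which A sin(psi_low - c) solves, with a suitable
    companion, the first-order system of (uG, G) with one coefficient changed (Liouville-Green);
    [rho] is its logarithmic derivative and [xslope] is x psi_low'. *)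
Definition rho (mu eta x : R) : R := 5 * x / (2 * sq mu x) - N1 mu eta x / (2 * N0 mu eta x).
Definition rho' (mu eta x : R) : R :=
  5 / (2 * sq mu x) - 5 * x ^ 2 / sq mu x ^ 2
  - N2 mu eta x / (2 * N0 mu eta x) + N1 mu eta x ^ 2 / (2 * N0 mu eta x ^ 2).
Definition ampl (mu eta x : R) : R := exp (5 / 4 * ln (sq mu x) - ln (N0 mu eta x) / 2).
Definition xslope (mu eta x : R) : R := N0 mu eta x / sqrt (sq mu x) ^ 3.

(** The changed coefficient kappa of the model system, less 1, in closed form. *)
Lemma kappa_excess (mu eta x : R) : x <> 0 -> sq mu x <> 0 -> N0 mu eta x <> 0 ->
  (N0 mu eta x ^ 2 / sq mu x ^ 3 - x * rho mu eta x * (x * rho mu eta x + eta)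
     - x * (rho mu eta x + x * rho' mu eta x)) / sq mu x
   + (x * rho mu eta x + eta) * (2 * x ^ 2 / sq mu x ^ 2 + eta / sq mu x) - 1
  = r mu eta x / (16 * sq mu x ^ 4 * N0 mu eta x ^ 2).
Proof.
  intros Hx Hs HN. rewrite r_identity_poly. cbv zeta. unfold rho, rho'.
  assert (E : x ^ 2 - mu ^ 2 = sq mu x) by reflexivity.
  generalize dependent (sq mu x). intros s Hs E.
  generalize dependent (N0 mu eta x). intros N HN.
  generalize (N1 mu eta x), (N2 mu eta x). intros N' N''.
  field. repeat split; easy.
Qed.

(** Mixed Wronskian of a true solution (u, g) and of the model. The companion of the model is
    defined by the second equation of the system, u' = - eta/x u - s/x g; the first equation x
    g' = eta g + u then holds with kappa u in place of u, and kappa - 1 is the coefficient found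
    here. *)
Lemma sturm_abstract (eta P0 x rh' : R) (g u A rh k P s : R -> R) :
  is_derive g x ((eta * g x + u x) / x) ->
  is_derive u x (- (eta / x) * u x - s x / x * g x) ->
  is_derive A x (rh x * A x) -> is_derive rh x rh' ->
  is_derive k x (k x * (2 * x / s x - 2 * rh x)) ->
  is_derive P x (k x / x) -> is_derive s x (2 * x) -> x <> 0 -> s x <> 0 ->
  is_derive (fun x => u x * (- (A x * ((x * rh x + eta) * sin (P x - P0) + k x * cos (P x - P0)) / s x))
                      - g x * (A x * sin (P x - P0))) x
    (((k x ^ 2 - x * rh x * (x * rh x + eta) - x * (rh x + x * rh')) / s x
      + (x * rh x + eta) * (2 * x ^ 2 / s x ^ 2 + eta / s x) - 1) * (u x * (A x * sin (P x - P0))) / x).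
Proof.
  intros Dg Du DA Dr Dk DP Ds Hx Hs.
  auto_derive.
  - repeat split; (eexists; eassumption) || easy.
  - derive_with Dg. derive_with Du. derive_with DA. derive_with Dr. derive_with Dk. derive_with DP. derive_with Ds.
    unfold Rminus. generalize (sin (P x + - P0)), (cos (P x + - P0)). intros sn cs.
    field. split; easy.
Qed.

Lemma is_derive_N0 (mu eta x : R) : is_derive (N0 mu eta) x (N1 mu eta x).
Proof. unfold N0, N1. auto_derive; [easy | field]. Qed.

Lemma is_derive_N1 (mu eta x : R) : is_derive (N1 mu eta) x (N2 mu eta x).
Proof. unfold N1, N2. auto_derive; [easy | field]. Qed.

Lemma is_derive_rho (mu eta x : R) : sq mu x <> 0 -> N0 mu eta x <> 0 ->
  is_derive (rho mu eta) x (rho' mu eta x).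
Proof.
  intros Hs HN. pose proof (is_derive_sq mu x) as D1. pose proof (is_derive_N0 mu eta x) as D2.
  pose proof (is_derive_N1 mu eta x) as D3. unfold rho, rho'. auto_derive.
  - repeat split; try (eexists; eassumption); lra.
  - derive_with D1. derive_with D2. derive_with D3. field. split; easy.
Qed.

Lemma is_derive_xslope (mu eta x : R) : 0 < sq mu x -> N0 mu eta x <> 0 ->
  is_derive (xslope mu eta) x (xslope mu eta x * (2 * x / sq mu x - 2 * rho mu eta x)).
Proof.
  intros Hs HN. pose proof (is_derive_N0 mu eta x) as D2. pose proof (is_derive_sqrt_sq mu x Hs) as Dq.
  pose proof (sqrt_sq_sqr mu x Hs) as Hq. assert (Hq0 : 0 < sqrt (sq mu x)) by now apply sqrt_lt_R0.
  unfold xslope, rho. rewrite <- Hq at 2 3.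
  set (q := fun x => sqrt (sq mu x)) in *. change (sqrt (sq mu x)) with (q x) in *.
  apply (is_derive_ext (fun x => N0 mu eta x / q x ^ 3)); [reflexivity|].
  auto_derive.
  - repeat split; try (eexists; eassumption). apply Rgt_not_eq. repeat apply Rmult_lt_0_compat; lra.
  - derive_with D2. derive_with Dq. field. split; lra.
Qed.

Lemma is_derive_ampl (mu eta x : R) : 0 < sq mu x -> 0 < N0 mu eta x ->
  is_derive (ampl mu eta) x (rho mu eta x * ampl mu eta x).
Proof.
  intros Hs HN. pose proof (is_derive_N0 mu eta x) as D2. pose proof (is_derive_sq mu x) as D1.
  unfold ampl, rho. auto_derive.
  - repeat split; try (eexists; eassumption); easy.
  - derive_with D1. derive_with D2. unfold Rminus, Rdiv. field. lra.
Qed.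

Lemma psi_increasing (nu eta x y : R) (psi : R -> R) : 0 < eta -> eta < nu -> derivative_phase nu eta psi ->
  mu_of nu eta <= x -> x < y -> psi x < psi y.
Proof.
  intros He Hn [_ Hd Hnorm _ _] Hx Hxy. pose proof (mu_pos nu eta He Hn).
  apply (increasing_of_derive psi (fun z => (z ^ 2 - (nu ^ 2 - eta ^ 2)) *
    (crossGY nu z / (z * (uG nu eta z ^ 2 + uY nu eta z ^ 2)))) x y Hxy).
  - intros z Hz. apply Hd. lra.
  - intros z Hz. rewrite <- (mu_sqr nu eta He Hn). apply Rmult_lt_0_compat.
    + apply sq_pos; try easy. lra.
    + apply Rdiv_lt_0_compat; [apply crossGY_pos; lra|]. apply Rmult_lt_0_compat; [lra | apply Hnorm; lra].
Qed.

(** Rotate the solutions so that the true one and the model both vanish at a. If the model turned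
    by at most pi up to b, both would be positive in between and their mixed Wronskian would
    increase strictly from 0, since kappa > 1 where r > 0. But at b, the next zero of the true
    solution, the Wronskian is at most 0. *)
Lemma sturm_step (nu eta a b : R) (psi : R -> R) : 0 < eta -> eta < nu -> derivative_phase nu eta psi ->
  x_at (mu_of nu eta) eta < a -> a < b -> psi b = psi a + PI ->
  PI < psi_low nu eta b - psi_low nu eta a.
Proof.
  intros He Hn Hpsi Ha Hab Hpi.
  pose proof (mu_pos nu eta He Hn) as Hm. pose proof (x_sharp_gt _ _ Hm He) as Hsh.
  pose proof (x_at_gt _ _ Hm He) as Hat. pose proof (mu_sqr nu eta He Hn) as Hmu2.
  pose proof (sq_pos nu eta) as Hsq. pose proof (N0_pos (mu_of nu eta) eta) as HN0.
  pose proof (fun x H => is_derive_psi_low nu eta x He Hn H) as DPhi.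
  pose proof (r_pos_after (mu_of nu eta) eta) as Hr.
  pose proof (psi_low_increasing nu eta) as Hinc.
  set (mu := mu_of nu eta) in *.
  apply Rnot_le_lt. intros Hle.
  assert (Hmon : forall x y, a <= x -> x < y -> psi x < psi y).
  { intros x y Hax Hxy. apply (psi_increasing nu eta x y psi); try easy. fold mu. lra. }
  destruct Hpsi as [[_ HM] _ _ _ _].
  (* After rotation by beta, u is a positive multiple of sin (psi - beta). *)
  set (beta := psi a) in *.
  set (u := fun x => cos beta * uY nu eta x - sin beta * uG nu eta x).
  set (g := fun x => cos beta * Y nu x - sin beta * G nu x).
  assert (Hu : forall x, 0 < x -> exists M, 0 < M /\ u x = M * sin (psi x - beta)).
  { intros x Hx. destruct (HM x Hx) as (M & HM0 & E1 & E2). exists M. split; [easy|].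
    unfold u. rewrite E1, E2, sin_minus. ring. }
  assert (Dg : forall x, 0 < x -> is_derive g x ((eta * g x + u x) / x)).
  { intros x Hx. destruct (bpair_G nu x Hx) as [D1 _]. destruct (bpair_Y nu x Hx) as [D2 _].
    unfold g. evar_last.
    - apply (is_derive_minus (fun x => cos beta * Y nu x)); apply is_derive_scal; [exact D2 | exact D1].
    - unfold minus, plus, opp; simpl. unfold u, uY, uG, udiff. field. lra. }
  assert (Du : forall x, 0 < x -> is_derive u x (- (eta / x) * u x - sq mu x / x * g x)).
  { intros x Hx.
    pose proof (is_derive_udiff nu eta _ _ x (bpair_G nu) Hx) as D1.
    pose proof (is_derive_udiff nu eta _ _ x (bpair_Y nu) Hx) as D2.
    unfold u. evar_last.
    - apply (is_derive_minus (fun x => cos beta * uY nu eta x)); apply is_derive_scal; [exact D2 | exact D1].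
    - unfold minus, plus, opp; simpl. unfold g, sq, uY, uG. rewrite Hmu2. field. lra. }
  set (P0 := psi_low nu eta a).
  (* D is the mixed Wronskian, with the model phase measured from a. *)
  set (D := fun x => u x * (- (ampl mu eta x * ((x * rho mu eta x + eta) * sin (psi_low nu eta x - P0)
       + xslope mu eta x * cos (psi_low nu eta x - P0)) / sq mu x))
       - g x * (ampl mu eta x * sin (psi_low nu eta x - P0))).
  set (D' := fun x => r mu eta x / (16 * sq mu x ^ 4 * N0 mu eta x ^ 2)
       * (u x * (ampl mu eta x * sin (psi_low nu eta x - P0))) / x).
  assert (DD : forall x, a <= x <= b -> is_derive D x (D' x)).
  { intros x Hx. assert (Hs : 0 < sq mu x) by (apply Hsq; try easy; lra).
    assert (HN : 0 < N0 mu eta x) by (apply HN0; lra).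
    assert (Hq0 : 0 < sqrt (sq mu x)) by now apply sqrt_lt_R0.
    evar_last.
    - apply (sturm_abstract eta P0 x (rho' mu eta x) g u (ampl mu eta) (rho mu eta) (xslope mu eta)
        (psi_low nu eta) (sq mu)).
      + apply Dg; lra.
      + apply Du; lra.
      + now apply is_derive_ampl.
      + apply is_derive_rho; lra.
      + apply is_derive_xslope; [easy | lra].
      + evar_last; [apply DPhi; lra|]. unfold psi_slope, xslope. field. split; lra.
      + apply is_derive_sq.
      + lra.
      + lra.
    - unfold D'. f_equal. f_equal. rewrite <- kappa_excess by lra.
      replace (xslope mu eta x ^ 2) with (N0 mu eta x ^ 2 / sq mu x ^ 3); [reflexivity|].
      unfold xslope. rewrite <- (sqrt_sq_sqr mu x Hs) at 1. field. lra. }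
  assert (HDpos : D a < D b).
  { apply (increasing_of_derive D D' a b Hab DD). intros x Hx.
    assert (Hs : 0 < sq mu x) by (apply Hsq; try easy; lra).
    assert (HN : 0 < N0 mu eta x) by (apply HN0; lra).
    assert (H1 : psi a < psi x) by (apply Hmon; lra). assert (H2 : psi x < psi b) by (apply Hmon; lra).
    assert (H3 : P0 < psi_low nu eta x) by (apply Hinc; lra).
    assert (H4 : psi_low nu eta x < psi_low nu eta b) by (apply Hinc; lra).
    destruct (Hu x ltac:(lra)) as (M & HM0 & Eu).
    assert (Hux : 0 < u x).
    { rewrite Eu. apply Rmult_lt_0_compat; [easy|]. fold beta in H1. apply sin_gt_0; lra. }
    assert (Hsn : 0 < sin (psi_low nu eta x - P0)) by (apply sin_gt_0; unfold P0 in *; lra).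
    assert (Ham : 0 < ampl mu eta x) by apply exp_pos.
    unfold D'. apply Rdiv_lt_0_compat; [|lra].
    apply Rmult_lt_0_compat; [|apply Rmult_lt_0_compat; [easy | now apply Rmult_lt_0_compat]].
    apply Rdiv_lt_0_compat; [apply Hr; lra|].
    apply Rmult_lt_0_compat; [apply Rmult_lt_0_compat; [lra|] |]; now apply pow_lt. }
  assert (HDa : D a = 0).
  { unfold D. fold P0. replace (P0 - P0) with 0 by ring. rewrite sin_0.
    assert (Hua : u a = 0).
    { destruct (Hu a ltac:(lra)) as (M & _ & Eu). fold beta in Eu. rewrite Eu.
      replace (beta - beta) with 0 by ring. rewrite sin_0. ring. }
    rewrite Hua. ring. }
  assert (HDb : D b <= 0).
  { assert (Hb0 : 0 < b) by lra.
    destruct (HM b Hb0) as (M & HM0 & E1 & E2). rewrite Hpi in E1, E2.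
    rewrite neg_cos in E1. rewrite neg_sin in E2.
    assert (Hub : u b = 0) by (unfold u; rewrite E1, E2; ring).
    assert (Hgb : 0 < g b).
    { pose proof (crossGY_pos nu b Hb0) as Hc. rewrite <- (cross_u nu eta), E1, E2 in Hc.
      replace (G nu b * (M * - sin beta) - Y nu b * (M * - cos beta)) with (M * g b) in Hc by (unfold g; ring).
      apply Rmult_lt_reg_l with M; [easy|]. lra. }
    assert (H3 : P0 < psi_low nu eta b) by (apply Hinc; lra).
    assert (Hsn : 0 <= sin (psi_low nu eta b - P0)) by (apply sin_ge_0; unfold P0 in *; lra).
    unfold D. rewrite Hub.
    assert (0 <= ampl mu eta b * sin (psi_low nu eta b - P0)) by (apply Rmult_le_pos; [apply exp_nonneg | easy]).
    assert (0 <= g b * (ampl mu eta b * sin (psi_low nu eta b - P0))) by (apply Rmult_le_pos; lra). lra. }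
  lra.
Qed.

(** Suppose the model phase is ahead or level at X. At the points where the true phase has made n
    half-turns more, the gap between the phases increases strictly with n, by [sturm_step]; but
    both phases have the same asymptotics, so that the gap tends to 0. *)
Lemma psi_low_lt_psi (nu eta X : R) (psi : R -> R) : 0 < eta -> eta < nu -> derivative_phase nu eta psi ->
  x_at (mu_of nu eta) eta < X -> psi_low nu eta X < psi X.
Proof.
  intros He Hn Hpsi HX.
  pose proof (mu_pos nu eta He Hn) as Hm. pose proof (x_sharp_gt _ _ Hm He) as Hsh.
  pose proof (x_at_gt _ _ Hm He) as Hat.
  pose proof (fun x y => psi_increasing nu eta x y psi He Hn Hpsi) as Hmon.
  pose proof PI_RGT_0 as Hpi0.
  apply Rnot_le_lt. intros Hle.
  assert (Hc : forall x, 0 < x -> continuous psi x) by apply (dp_phase _ _ _ Hpsi).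
  assert (Hpt : forall n : nat, exists y, X <= y /\ psi y = psi X + INR n * PI).
  { intros n. destruct (unbounded_of_lim _ _ (dp_lim _ _ _ Hpsi) (psi X + INR n * PI)) as [B HB].
    set (b := Rmax X B + 1). assert (Hb : X <= b) by (unfold b; pose proof (Rmax_l X B); lra).
    destruct (IVT_level psi X b (psi X + INR n * PI) Hb) as (z & Hz & Ez).
    - intros x Hx. apply Hc. lra.
    - split; [pose proof (pos_INR n); nra|]. left. apply HB. unfold b. pose proof (Rmax_r X B). lra.
    - exists z. split; [lra | easy]. }
  assert (Hlt : forall x y, X <= x -> X <= y -> psi x < psi y -> x < y).
  { intros x y Hx Hy Hxy. apply Rnot_le_lt. intros [H|H].
    - pose proof (Hmon y x ltac:(lra) H). lra.
    - rewrite H in Hxy. lra. }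
  destruct (Hpt 1%nat) as (y1 & Hy1 & E1). simpl INR in E1. rewrite Rmult_1_l in E1.
  set (d := psi_low nu eta y1 - psi y1).
  assert (Hd : 0 < d).
  { assert (X < y1) by (apply Hlt; lra).
    pose proof (sturm_step nu eta X y1 psi He Hn Hpsi HX H E1). unfold d. lra. }
  assert (Hgap : forall n y, X <= y -> psi y = psi X + INR (S n) * PI -> d <= psi_low nu eta y - psi y).
  { induction n as [|n IH]; intros y Hy Ey.
    - simpl INR in Ey. rewrite Rmult_1_l in Ey. replace y with y1; [unfold d; lra|].
      destruct (Rtotal_order y1 y) as [H|[H|H]]; [|easy|].
      + pose proof (Hmon y1 y ltac:(lra) H). lra.
      + pose proof (Hmon y y1 ltac:(lra) H). lra.
    - destruct (Hpt (S n)) as (y' & Hy' & Ey'). specialize (IH y' Hy' Ey').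
      rewrite (S_INR (S n)) in Ey.
      assert (y' < y) by (apply Hlt; lra).
      assert (psi y = psi y' + PI) by lra.
      pose proof (sturm_step nu eta y' y psi He Hn Hpsi ltac:(lra) H H0). lra. }
  assert (L : is_lim (fun x => psi_low nu eta x - psi x) p_infty 0).
  { apply is_lim_ext with (fun x => (psi_low nu eta x - x) - (psi x - x)); [intros; ring|].
    pose proof (psi_low_lim nu eta He Hn). pose proof (dp_lim _ _ _ Hpsi). limit. ring. }
  apply is_lim_spec in L. destruct (L (mkposreal d Hd)) as [B HB].
  change (pos (mkposreal d Hd)) with d in HB.
  set (b := Rmax X B).
  destruct (INR_archimed PI (psi b - psi X) Hpi0) as [n Hn'].
  destruct (Hpt (S n)) as (y & Hy & Ey).
  assert (HbX : X <= b) by apply Rmax_l.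
  assert (b < y). { apply Hlt; [easy | easy |]. rewrite Ey, S_INR. lra. }
  assert (HBy : B < y) by (pose proof (Rmax_r X B); unfold b in *; lra).
  specialize (HB y HBy). specialize (Hgap n y Hy Ey). rewrite Rminus_0_r in HB.
  apply Rabs_def2 in HB. lra.
Qed.

(** * Counting zeros *)

Lemma psi_decreasing (nu eta x y : R) (psi : R -> R) : 0 < eta -> eta < nu -> derivative_phase nu eta psi ->
  0 < x -> x < y -> y <= mu_of nu eta -> psi y < psi x.
Proof.
  intros He Hn [_ Hd Hnorm _ _] Hx Hxy Hy.
  apply Ropp_lt_cancel.
  apply (increasing_of_derive (fun z => - psi z) (fun z => - ((z ^ 2 - (nu ^ 2 - eta ^ 2)) *
    (crossGY nu z / (z * (uG nu eta z ^ 2 + uY nu eta z ^ 2))))) x y Hxy).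
  - intros z Hz. apply (is_derive_opp psi). apply Hd. lra.
  - intros z Hz. rewrite <- (mu_sqr nu eta He Hn).
    assert (0 < crossGY nu z / (z * (uG nu eta z ^ 2 + uY nu eta z ^ 2))).
    { apply Rdiv_lt_0_compat; [apply crossGY_pos; lra|]. apply Rmult_lt_0_compat; [lra | apply Hnorm; lra]. }
    assert (z ^ 2 - mu_of nu eta ^ 2 < 0) by nra. nra.
Qed.

(** Finiteness as containment in a list passes to subsets without deciding membership. *)
Definition covered (P : R -> Prop) : Prop := exists l, forall x, P x -> In x l.

Lemma covered_or (P Q : R -> Prop) : covered P -> covered Q -> covered (fun x => P x \/ Q x).
Proof.
  intros [l Hl] [m Hm]. exists (l ++ m). intros x [H|H]; apply in_or_app; [left | right]; auto.
Qed.

Lemma covered_incl (P Q : R -> Prop) : (forall x, P x -> Q x) -> covered Q -> covered P.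
Proof. intros H [l Hl]. exists l. auto. Qed.

Lemma covered_unique (P : R -> Prop) : (forall x y, P x -> P y -> x = y) -> covered P.
Proof.
  intros H. destruct (excluded_middle_informative (exists x, P x)) as [[x Hx]|Hno].
  - exists (x :: nil). intros y Hy. left. now apply H.
  - exists nil. intros y Hy. apply Hno. now exists y.
Qed.

Lemma covered_NoDup (P : R -> Prop) : covered P ->
  exists l, NoDup l /\ forall x, In x l <-> P x.
Proof.
  intros [l Hl].
  exists (nodup Req_EM_T (filter (fun x => if excluded_middle_informative (P x) then true else false) l)).
  split; [apply NoDup_nodup|]. intros x. rewrite nodup_In, filter_In.
  specialize (Hl x). destruct (excluded_middle_informative (P x)); intuition congruence.
Qed.

Definition below (z : R) (l : list R) : list R := filter (fun x => if Rlt_dec x z then true else false) l.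

Lemma in_below (z x : R) (l : list R) : In x (below z l) <-> In x l /\ x < z.
Proof. unfold below. rewrite filter_In. destruct (Rlt_dec x z); intuition congruence. Qed.

Lemma list_min (l : list R) : l <> nil -> exists z, In z l /\ forall x, In x l -> z <= x.
Proof.
  induction l as [|a l IH]; [easy|]. intros _. destruct l as [|b l].
  - exists a. split; [now left|]. intros x [->|[]]. lra.
  - destruct IH as (z & Hz & Hmin); [easy|]. destruct (Rle_lt_dec a z).
    + exists a. split; [now left|]. intros x [->|Hx]; [lra|]. specialize (Hmin x Hx). lra.
    + exists z. split; [now right|]. intros x [<-|Hx]; [lra|]. now apply Hmin.
Qed.

(** By induction on the rank, the next element being the least one above the last. *)
Lemma element_of_rank (l : list R) : NoDup l -> forall n, (n < length l)%nat ->
  exists z, In z l /\ length (below z l) = n.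
Proof.
  intros Hl. induction n as [|n IH]; intros Hn.
  - destruct (list_min l) as (z & Hz & Hmin); [intros ->; simpl in Hn; lia|].
    exists z. split; [easy|]. destruct (below z l) as [|y m] eqn:E; [easy|].
    assert (Hy : In y (below z l)) by (rewrite E; now left).
    apply in_below in Hy. destruct Hy as [Hy Hlt]. specialize (Hmin y Hy). lra.
  - destruct IH as (z & Hz & Hlen); [lia|].
    set (up := filter (fun x => if Rlt_dec z x then true else false) l).
    assert (Hup : forall x, In x up <-> In x l /\ z < x).
    { intros x. unfold up. rewrite filter_In. destruct (Rlt_dec z x); intuition congruence. }
    destruct (list_min up) as (z' & Hz' & Hmin).
    { intros Eup. assert (Hincl : incl l (z :: below z l)).
      { intros x Hx. destruct (Rtotal_order x z) as [H|[H|H]].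
        - right. now apply in_below.
        - left. easy.
        - exfalso. assert (Hin : In x up) by now apply Hup. rewrite Eup in Hin. easy. }
      pose proof (NoDup_incl_length Hl Hincl) as H. simpl in H. lia. }
    apply Hup in Hz'. destruct Hz' as [Hz'l Hzz'].
    exists z'. split; [easy|].
    assert (N1 : NoDup (below z' l)) by now apply NoDup_filter.
    assert (N2 : NoDup (z :: below z l)).
    { constructor; [|now apply NoDup_filter]. intros H. apply in_below in H. lra. }
    assert (I1 : incl (below z' l) (z :: below z l)).
    { intros x Hx. apply in_below in Hx. destruct Hx as [Hx Hlt].
      destruct (Rtotal_order x z) as [H|[H|H]]; [right; now apply in_below | now left |].
      assert (Hin : In x up) by now apply Hup. specialize (Hmin x Hin). lra. }
    assert (I2 : incl (z :: below z l) (below z' l)).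
    { intros x [<-|Hx]; apply in_below; [easy|]. apply in_below in Hx. split; [easy | lra]. }
    pose proof (NoDup_incl_length N1 I1). pose proof (NoDup_incl_length N2 I2). simpl in *. lia.
Qed.

(** Finiteness below X makes the k-th zero exist; k zeros below X cannot all precede a k-th zero
    at or above X. *)
Lemma kth_zero_below (f : R -> R) (k : nat) (X : R) (zs : list R) :
  covered (fun x => 0 < x < X /\ f x = 0) ->
  NoDup zs -> length zs = k -> (1 <= k)%nat -> (forall x, In x zs -> 0 < x < X /\ f x = 0) ->
  the (is_pos_zero f k) < X.
Proof.
  intros Hcov Hnd Hlen Hk Hzs.
  assert (Hex : exists z, is_pos_zero f k z).
  { destruct (covered_NoDup _ Hcov) as (l & Hl & Hin).
    assert (Hkl : (k <= length l)%nat).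
    { rewrite <- Hlen. apply NoDup_incl_length; [easy|]. intros x Hx. apply Hin. now apply Hzs. }
    destruct (element_of_rank l Hl (k - 1) ltac:(lia)) as (z & Hz & Hrank).
    apply Hin in Hz. destruct Hz as [[H0 HX] Hf].
    exists z. split; [easy|]. split; [easy|]. exists (below z l). split; [now apply NoDup_filter|].
    split; [lia|]. intros x. rewrite in_below, Hin. split.
    - intros [[Hx Ex] Hlt]. lra.
    - intros [Hx Ex]. lra. }
  pose proof (epsilon_spec (inhabits 0) (is_pos_zero f k) Hex) as Hs.
  fold (the (is_pos_zero f k)) in Hs. destruct Hs as (_ & _ & l & Hl & Hk' & Hin).
  apply Rnot_le_lt. intros Hge.
  assert (Hincl : incl zs l).
  { intros x Hx. apply Hin. destruct (Hzs x Hx). split; [lra | easy]. }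
  pose proof (NoDup_incl_length Hnd Hincl). lia.
Qed.

(** A bounded function meets finitely many of the levels where the cosine vanishes, and an
    injective one meets each level once. *)
Lemma finite_levels (P : R -> Prop) (psi : R -> R) (beta lo hi : R) :
  (forall x, P x -> lo <= psi x <= hi) -> (forall x y, P x -> P y -> psi x = psi y -> x = y) ->
  covered (fun x => P x /\ cos (psi x - beta) = 0).
Proof.
  intros Hb Hinj. pose proof PI_RGT_0 as Hpi.
  assert (W : forall (j0 : Z) n, covered (fun x => P x /\
     exists j, (j0 <= j < j0 + Z.of_nat n)%Z /\ psi x = beta + (IZR j * PI + PI / 2))).
  { intros j0. induction n as [|n IH].
    - exists nil. intros x (_ & j & Hj & _). lia.
    - apply (covered_incl _ (fun x => (P x /\
          exists j, (j0 <= j < j0 + Z.of_nat n)%Z /\ psi x = beta + (IZR j * PI + PI / 2)) \/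
          (P x /\ psi x = beta + (IZR (j0 + Z.of_nat n) * PI + PI / 2)))).
      + intros x (Hx & j & Hj & Ej). destruct (Z.eq_dec j (j0 + Z.of_nat n)) as [->|Hne]; [now right|].
        left. split; [easy|]. exists j. split; [lia | easy].
      + apply covered_or; [easy|]. apply covered_unique. intros x y [Hx Ex] [Hy Ey].
        apply Hinj; [easy | easy | congruence]. }
  set (a := (lo - beta - PI / 2) / PI). set (b := (hi - beta - PI / 2) / PI).
  apply (covered_incl _ (fun x => P x /\ exists j,
     (up a - 1 <= j < (up a - 1) + Z.of_nat (Z.to_nat (up b - up a + 2)))%Z /\
     psi x = beta + (IZR j * PI + PI / 2))); [|apply W].
  intros x [Hx Ex]. split; [easy|].
  destruct (cos_eq_0_0 _ Ex) as [j Ej]. exists j. split; [|lra]. specialize (Hb x Hx).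
  assert (L1 : a <= IZR j) by (apply Rle_div_l; lra).
  assert (L2 : IZR j <= b) by (apply Rle_div_r; lra).
  destruct (archimed a) as [A1 A2]. destruct (archimed b) as [A3 A4].
  assert (K1 : (up a - 1 <= j)%Z) by (apply le_IZR; rewrite minus_IZR; lra).
  assert (K2 : (j < up b)%Z) by (apply lt_IZR; lra).
  rewrite Z2Nat.id; lia.
Qed.

(** The phase is monotone on either side of mu, bounded near 0, and therefore bounded on (0,
    X). *)
Lemma phase_levels_covered (nu eta X beta : R) (psi : R -> R) : 0 < eta -> eta < nu ->
  derivative_phase nu eta psi -> mu_of nu eta < X ->
  covered (fun x => 0 < x < X /\ cos (psi x - beta) = 0).
Proof.
  intros He Hn Hpsi HX. pose proof PI_RGT_0 as Hpi.
  set (mu := mu_of nu eta) in *. assert (Hm : 0 < mu) by (apply mu_pos; easy).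
  assert (Hinc : forall x y, mu <= x -> x < y -> psi x < psi y).
  { intros x y Hx Hxy. now apply (psi_increasing nu eta x y psi). }
  assert (Hdec : forall x y, 0 < x -> x < y -> y <= mu -> psi y < psi x).
  { intros x y Hx Hxy Hy. now apply (psi_decreasing nu eta x y psi). }
  destruct (dp_zero _ _ _ Hpsi) as (delta & Hd & Hlow).
  assert (Hbound : forall x, 0 < x < X -> psi mu <= psi x <= Rmax (3 * (PI / 2)) (psi X)).
  { intros x Hx. pose proof (Rmax_l (3 * (PI / 2)) (psi X)). pose proof (Rmax_r (3 * (PI / 2)) (psi X)).
    destruct (Rlt_le_dec mu x) as [H1|H1].
    - pose proof (Hinc mu x ltac:(lra) H1). pose proof (Hinc x X ltac:(lra) ltac:(lra)). lra.
    - assert (H2 : psi mu <= psi x).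
      { destruct H1 as [H1| ->]; [|lra]. pose proof (Hdec x mu ltac:(lra) H1 ltac:(lra)). lra. }
      set (y := Rmin x (delta / 2)).
      assert (Hy : 0 < y <= x) by (unfold y; split; [apply Rmin_pos; lra | apply Rmin_l]).
      assert (Hyd : y <= delta / 2) by apply Rmin_r.
      assert (psi x <= psi y).
      { destruct (proj2 Hy) as [H3|H3]; [|rewrite H3; lra].
        pose proof (Hdec y x ltac:(lra) H3 H1). lra. }
      pose proof (proj1 (Hlow y ltac:(lra))). lra. }
  apply (covered_incl _ (fun x => ((0 < x < X /\ x <= mu) /\ cos (psi x - beta) = 0)
    \/ ((0 < x < X /\ mu <= x) /\ cos (psi x - beta) = 0))).
  { intros x [Hx Ex]. destruct (Rle_lt_dec x mu); [left | right]; repeat split; lra. }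
  apply covered_or; apply (finite_levels _ _ _ (psi mu) (Rmax (3 * (PI / 2)) (psi X)));
    try (intros x [Hx _]; now apply Hbound); intros x y Hx Hy E; (destruct (Rtotal_order x y) as [H|[H|H]]; [|easy|]).
  - pose proof (Hdec x y ltac:(lra) H ltac:(lra)). lra.
  - pose proof (Hdec y x ltac:(lra) H ltac:(lra)). lra.
  - pose proof (Hinc x y ltac:(lra) H). lra.
  - pose proof (Hinc y x ltac:(lra) H). lra.
Qed.

(** The phase passes each of the levels beta + pi/2 + n pi with n < k between x0 and X. *)
Lemma phase_zeros (nu eta X x0 beta : R) (psi : R -> R) (k : nat) :
  derivative_phase nu eta psi -> 0 < x0 < X -> psi x0 < beta + PI / 2 ->
  PI * (INR k - 1 / 2) + beta < psi X ->
  exists zs, NoDup zs /\ length zs = k /\ forall x, In x zs -> 0 < x < X /\ cos (psi x - beta) = 0.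
Proof.
  intros Hpsi Hx0 Hlow HX. pose proof PI_RGT_0 as Hpi.
  assert (W : forall n, (n <= k)%nat -> exists zs, NoDup zs /\ length zs = n /\
    forall x, In x zs -> (0 < x < X /\ cos (psi x - beta) = 0) /\ psi x < beta + (INR n * PI)).
  { induction n as [|n IH]; intros Hn.
    - exists nil. split; [constructor|]. split; [easy|]. intros x [].
    - destruct IH as (zs & H1 & H2 & H3); [lia|].
      assert (HnR : INR n + 1 <= INR k) by (rewrite <- S_INR; now apply le_INR).
      pose proof (pos_INR n).
      destruct (IVT_level psi x0 X (beta + (INR n * PI + PI / 2)) ltac:(lra)) as (z & Hz & Ez).
      + intros x Hx. apply (proj1 (dp_phase _ _ _ Hpsi)). lra.
      + split; [nra|]. assert (INR n * PI + PI / 2 <= PI * (INR k - 1 / 2)) by nra. lra.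
      + exists (z :: zs). split; [|split].
        * constructor; [|easy]. intros Hin. destruct (H3 z Hin). lra.
        * simpl. now rewrite H2.
        * rewrite S_INR. intros x [<-|Hx].
          -- split; [|lra]. split.
             ++ split; [lra|]. destruct (proj2 Hz) as [Hlt|Heq]; [easy|]. exfalso.
                rewrite Heq in Ez. assert (INR n * PI + PI / 2 <= PI * (INR k - 1 / 2)) by nra. lra.
             ++ rewrite Ez. replace (beta + (INR n * PI + PI / 2) - beta) with (INR n * PI + PI / 2) by ring.
                apply cos_eq_0_1. exists (Z.of_nat n). now rewrite INR_IZR_INZ.
          -- destruct (H3 x Hx) as [Ha Hb]. split; [easy | lra]. }
  destruct (W k (le_n k)) as (zs & H1 & H2 & H3). exists zs. split; [easy|]. split; [easy|].
  intros x Hx. now apply H3.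
Qed.

(** * The phase near 0 *)

(** For eta < nu the function x^(-eta) J increases from 0, as its leading power x^(nu - eta)
    shows, so that G and uG have the same sign near 0. *)
Lemma phase_start (nu eta X : R) (psi : R -> R) : 0 < eta -> eta < nu -> derivative_phase nu eta psi ->
  0 < X -> exists x0, 0 < x0 < X /\ psi x0 < PI / 2.
Proof.
  intros He Hn Hpsi HX.
  destruct (dp_zero _ _ _ Hpsi) as (delta & Hd & Hlow).
  destruct (BesselJ_eq_G nu ltac:(lra)) as (b & Hb & HJ).
  assert (Hr : regular nu) by (apply regular_pos; lra).
  pose proof (J_proportional_up nu b Hr HJ) as HJ1.
  set (j0 := Rpower 2 (- nu) * rGamma (nu + 1)).
  assert (Hj0 : 0 < j0) by (apply Rmult_lt_0_compat; [apply exp_pos | apply rGamma_pos; lra]).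
  assert (L : is_lim_seq (fun n => Rpower (xs n) (- nu) * BesselJ nu (xs n) *
     ((nu - eta) * (Rpower (xs n) (- nu) * BesselJ nu (xs n))
      - xs n * xs n * (Rpower (xs n) (- (nu + 1)) * BesselJ (nu + 1) (xs n))))
     (j0 * ((nu - eta) * j0 - 0 * 0 * (Rpower 2 (- (nu + 1)) * rGamma (nu + 1 + 1))))).
  { pose proof (J_xs_lim nu Hr). pose proof (J_xs_lim (nu + 1) (regular_S _ Hr)). pose proof xs_lim.
    apply is_lim_seq_mult'; [easy|]. apply is_lim_seq_minus'.
    - apply is_lim_seq_mult'; [apply is_lim_seq_const | easy].
    - apply is_lim_seq_mult'; [now apply is_lim_seq_mult' | easy]. }
  apply is_lim_seq_spec in L.
  assert (Hpos : 0 < j0 * ((nu - eta) * j0 - 0 * 0 * (Rpower 2 (- (nu + 1)) * rGamma (nu + 1 + 1)))).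
  { apply Rmult_lt_0_compat; [easy|]. assert (0 < (nu - eta) * j0) by (apply Rmult_lt_0_compat; lra). lra. }
  destruct (L (mkposreal _ Hpos)) as [N1 HN1]. pose proof xs_lim as L0. apply is_lim_seq_spec in L0.
  assert (Hm : 0 < Rmin delta X) by now apply Rmin_pos.
  destruct (L0 (mkposreal _ Hm)) as [N2 HN2].
  set (n := (N1 + N2)%nat). specialize (HN1 n ltac:(unfold n; lia)). specialize (HN2 n ltac:(unfold n; lia)).
  change (pos (mkposreal _ Hm)) with (Rmin delta X) in HN2.
  match type of HN1 with _ < pos (mkposreal ?c _) => change (pos (mkposreal c Hpos)) with c in HN1 end.
  pose proof (xs_range n). rewrite Rminus_0_r, Rabs_pos_eq in HN2 by lra.
  pose proof (Rmin_l delta X). pose proof (Rmin_r delta X).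
  exists (xs n). split; [lra|]. apply (Hlow (xs n)); [lra|].
  apply Rabs_def2 in HN1. destruct HN1 as [_ HN1].
  assert (Hp : 0 < Rpower (xs n) (- nu) * BesselJ nu (xs n) *
     ((nu - eta) * (Rpower (xs n) (- nu) * BesselJ nu (xs n))
      - xs n * xs n * (Rpower (xs n) (- (nu + 1)) * BesselJ (nu + 1) (xs n)))) by lra.
  rewrite HJ, HJ1, Ropp_plus_distr, Rpower_plus, (Rpower_Ropp (xs n) 1), Rpower_1 in Hp by lra.
  set (P := Rpower (xs n) (- nu)) in *. assert (HP : 0 < P) by apply exp_pos.
  replace (P * (b * G nu (xs n)) * ((nu - eta) * (P * (b * G nu (xs n)))
      - xs n * xs n * (P * / xs n * (b * G (nu + 1) (xs n)))))
    with (P ^ 2 * b ^ 2 * (G nu (xs n) * uG nu eta (xs n))) in Hp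
    by (unfold uG, udiff; field; lra).
  apply Rmult_lt_reg_l with (P ^ 2 * b ^ 2); [|lra].
  apply Rmult_lt_0_compat; [now apply pow_lt | nra].
Qed.

(** * The zeros of the derivatives *)

Lemma Derive_ultraspherical (eta c x g' : R) (F g : R -> R) : 0 < x ->
  (forall y, 0 < y -> F y = c * g y) -> is_derive g x g' ->
  Derive (fun y => Rpower y (- eta) * F y) x = c * Rpower x (- eta) / x * (x * g' - eta * g x).
Proof.
  intros Hx HF Dg. apply is_derive_unique.
  apply (is_derive_ext_loc (fun y => exp (- eta * ln y) * (c * g y))).
  - generalize (locally_above 0 x Hx). apply filter_imp. intros z Hz. unfold Rpower. now rewrite HF.
  - unfold Rpower. auto_derive.
    + repeat split; try (eexists; eassumption). easy.
    + derive_with Dg. field. lra.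
Qed.

Lemma mult_eq_0_iff (a b : R) : a <> 0 -> a * b = 0 <-> b = 0.
Proof. intros Ha. split; [intros [H|H]%Rmult_integral; easy | intros ->; ring]. Qed.

Lemma prefactor_neq_0 (eta c x : R) : 0 < x -> c <> 0 -> c * Rpower x (- eta) / x <> 0.
Proof.
  intros Hx Hc. apply Rmult_integral_contrapositive. split; [|apply Rinv_neq_0_compat; lra].
  apply Rmult_integral_contrapositive. split; [easy|]. apply Rgt_not_eq, exp_pos.
Qed.

Lemma Derive_U_zero (nu eta x : R) (psi : R -> R) : 0 < nu -> derivative_phase nu eta psi -> 0 < x ->
  Derive (U nu eta) x = 0 <-> cos (psi x - 0) = 0.
Proof.
  intros Hnu Hpsi Hx. destruct (BesselJ_eq_G nu Hnu) as (b & Hb & HJ).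
  unfold U. rewrite (Derive_ultraspherical eta b x _ _ _ Hx HJ (proj1 (bpair_G nu x Hx))).
  replace (x * (nu / x * G nu x - G (nu + 1) x) - eta * G nu x) with (uG nu eta x)
    by (unfold uG, udiff; field; lra).
  destruct (proj2 (dp_phase _ _ _ Hpsi) x Hx) as (M & HM & E & _). rewrite E, Rminus_0_r.
  rewrite !mult_eq_0_iff; [easy | lra | now apply prefactor_neq_0].
Qed.

Lemma Derive_W_zero (nu eta x : R) (psi : R -> R) : 0 < nu -> derivative_phase nu eta psi -> 0 < x ->
  Derive (W nu eta) x = 0 <-> cos (psi x - PI / 2) = 0.
Proof.
  intros Hnu Hpsi Hx. destruct (BesselY_eq_Y nu Hnu) as (b & Hb & HY).
  unfold W. rewrite (Derive_ultraspherical eta b x _ _ _ Hx HY (proj1 (bpair_Y nu x Hx))).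
  replace (x * (nu / x * Y nu x - Y (nu + 1) x) - eta * Y nu x) with (uY nu eta x)
    by (unfold uY, udiff; field; lra).
  destruct (proj2 (dp_phase _ _ _ Hpsi) x Hx) as (M & HM & _ & E). rewrite E.
  replace (cos (psi x - PI / 2)) with (sin (psi x)) by (rewrite cos_minus, cos_PI2, sin_PI2; ring).
  rewrite !mult_eq_0_iff; [easy | lra | now apply prefactor_neq_0].
Qed.

(** The angle beta is 0 for the first kind and pi/2 for the second. *)
Lemma kth_zero_bound (nu eta beta : R) (f : R -> R) (k : nat) : 0 < eta -> eta < nu -> 0 <= beta ->
  (1 <= k)%nat ->
  (forall psi x, derivative_phase nu eta psi -> 0 < x -> f x = 0 <-> cos (psi x - beta) = 0) ->
  psi_low nu eta (x_at (mu_of nu eta) eta) < PI * (INR k - 1 / 2) + beta ->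
  the (is_pos_zero f k) < psi_low_inv nu eta (PI * (INR k - 1 / 2) + beta).
Proof.
  intros He Hn Hbeta Hk Hf Ht.
  pose proof (mu_pos nu eta He Hn) as Hm. pose proof (x_sharp_gt _ _ Hm He). pose proof (x_at_gt _ _ Hm He).
  destruct (psi_low_inv_spec nu eta _ He Hn Ht) as [HX EX].
  set (X := psi_low_inv nu eta (PI * (INR k - 1 / 2) + beta)) in *.
  destruct (derivative_phase_exists nu eta) as [psi Hpsi]; [lra|].
  pose proof (psi_low_lt_psi nu eta X psi He Hn Hpsi HX) as Hlt. rewrite EX in Hlt.
  destruct (phase_start nu eta X psi He Hn Hpsi ltac:(lra)) as (x0 & Hx0 & Hlow).
  destruct (phase_zeros nu eta X x0 beta psi k Hpsi Hx0 ltac:(lra) Hlt) as (zs & H1 & H2 & H3).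
  apply (kth_zero_below f k X zs); try easy.
  - apply (covered_incl _ (fun x => 0 < x < X /\ cos (psi x - beta) = 0)).
    + intros x [Hx Ex]. split; [easy|]. apply (Hf psi x); easy.
    + apply (phase_levels_covered nu eta); try easy. lra.
  - intros x Hx. destruct (H3 x Hx) as [Ha Hb]. split; [easy|]. apply (Hf psi x); easy.
Qed.

Theorem corollary3p6 :
  forall nu eta : R, 0 < eta -> eta < nu ->
  let mu := mu_of nu eta in
  (forall k : nat, (1 <= k)%nat ->
     PI * (INR k - 1 / 2) > psi_low nu eta (x_at mu eta) ->
     u' nu eta k < psi_low_inv nu eta (PI * (INR k - 1 / 2)))
  /\
  (forall k : nat, (1 <= k)%nat ->
     PI * INR k > psi_low nu eta (x_at mu eta) ->
     w' nu eta k < psi_low_inv nu eta (PI * INR k)).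
Proof.
  intros nu eta He Hn mu. split; intros k Hk Ht.
  - replace (PI * (INR k - 1 / 2)) with (PI * (INR k - 1 / 2) + 0) in * by ring.
    apply kth_zero_bound; try easy; try lra.
    intros psi x Hpsi Hx. apply (Derive_U_zero nu eta x psi); [lra | easy | easy].
  - pose proof PI_RGT_0. replace (PI * INR k) with (PI * (INR k - 1 / 2) + PI / 2) in * by field.
    apply kth_zero_bound; try easy; [lra|].
    intros psi x Hpsi Hx. apply (Derive_W_zero nu eta x psi); [lra | easy | easy].
Qed.
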